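(* Let $\lambda\ne0$ and let $\{g_n(\omega)\}_{n\ge1}$ be independent real random variables with (i) $\mathbb{E}[g_n]=0$, (ii) $\mathbb{E}[g_n^2]=\lambda^2$, (iii) $\sum_{n\ge1}\mathbb{E}[g_n^4]n^{-2}<\infty$, (iv) $\mathbb{P}[\lim_{n\to\infty}g_nn^{-1/4}=0]=1$. Fix $F>0$, $E\in\mathbb{R}$, $\theta_0\in[0,\pi)$, and let $\psi$ be the solution of the generalized eigenvalue equation on $(0,\infty)$ with couplings $g_n(\omega)$ and initial data $\psi(0)=\sin\theta_0$, $\psi'(0^+)=\cos\theta_0$. Then almost surely its Prüfer radius satisfies $$\lim_{n\to\infty}\frac{\log R(n)}{\log n}=\frac{\lambda^2}{8F}.$$
   Context: Generalized eigenvalue equation on $(0,\infty)$: $-\psi''-Fx\psi=E\psi$ on $(0,\infty)\setminus\mathbb{Z}$, $\psi$ continuous at each $n\ge1$, and $\lim_{\epsilon\to0^+}(\psi'(n+\epsilon)-\psi'(n-\epsilon))=g_n\psi(n)$ for $n\ge1$. Reference solution: $\zeta(x)=(\pi/F^{1/3})^{1/2}(i\,\mathrm{Ai}(-F^{1/3}(x+E/F))+\mathrm{Bi}(-F^{1/3}(x+E/F)))$ (Airy functions $\mathrm{Ai},\mathrm{Bi}$), which has no real zeros. Prüfer radius: for a real-valued solution $\psi$ and each $n\ge1$ there is a unique $\alpha(n)\in\mathbb{C}$ with $\psi(x)=\alpha(n)\zeta(x)+\overline{\alpha(n)}\,\overline{\zeta(x)}$ for $x\in(n-1,n)$; set $R(n)=|2i\alpha(n)|=2|\alpha(n)|$.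 *)

(* Defs.v *)
(* R is an arbitrary realType; complex numbers are
   mathcomp-real-closed's R[i]. *)
From HB Require Import structures.
From mathcomp Require Import all_boot all_order all_algebra.
From mathcomp Require Import all_classical all_reals all_analysis.
From mathcomp Require Import complex.

Set Implicit Arguments.
Unset Strict Implicit.
Unset Printing Implicit Defensive.

Import Order.TTheory GRing.Theory Num.Theory.
Import numFieldNormedType.Exports.

Local Open Scope classical_set_scope.
Local Open Scope ring_scope.

Section Airy.
Variable R : realType.

(* Euler Gamma function, Gamma(s) = int_0^oo t^(s-1) e^(-t) dt  (s > 0). *)
Definition Gamma (s : R) : R :=
  fine (\int[@lebesgue_measure R]_(t in `]0%R, +oo[)
          (powR t (s - 1) * expR (- t))%:E)%E.

(* Coefficients of the two canonical power-series solutions of y'' = x y: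
   f(x) = sum_k af k x^(3k),  g(x) = sum_k bg k x^(3k+1). *)
Fixpoint airy_af (k : nat) : R :=
  match k with
  | 0%N => 1
  | k'.+1 => airy_af k' / ((3 * k' + 2)%:R * (3 * k' + 3)%:R)
  end.

Fixpoint airy_bg (k : nat) : R :=
  match k with
  | 0%N => 1
  | k'.+1 => airy_bg k' / ((3 * k' + 3)%:R * (3 * k' + 4)%:R)
  end.

Definition airy_f (x : R) : R :=
  limn (fun N => \sum_(0 <= k < N) (airy_af k * x ^+ (3 * k))).
Definition airy_g (x : R) : R :=
  limn (fun N => \sum_(0 <= k < N) (airy_bg k * x ^+ (3 * k + 1))).

(* Ai(0) = 1/(3^(2/3) Gamma(2/3)),  -Ai'(0) = 1/(3^(1/3) Gamma(1/3)) *)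
Definition airy_c1 : R := 1 / (powR 3 (2 / 3) * Gamma (2 / 3)).
Definition airy_c2 : R := 1 / (powR 3 (1 / 3) * Gamma (1 / 3)).

(* Abramowitz--Stegun 10.4.2--10.4.3 *)
Definition Ai (x : R) : R := airy_c1 * airy_f x - airy_c2 * airy_g x.
Definition Bi (x : R) : R := Num.sqrt 3 * (airy_c1 * airy_f x + airy_c2 * airy_g x).

(* Reference solution
   zeta(x) = (pi/F^(1/3))^(1/2) (i Ai(-F^(1/3)(x+E/F)) + Bi(-F^(1/3)(x+E/F))) *)
Definition zeta (F E : R) (x : R) : R[i] :=
  let y := - powR F (1 / 3) * (x + E / F) in
  ((Num.sqrt (pi / powR F (1 / 3)))%:C * ('i * (Ai y)%:C + (Bi y)%:C))%C.

(* psi solves the generalized eigenvalue equation on (0,oo) with couplings g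
   (g n is used for n >= 1) and initial data psi(0)=sin th0, psi'(0+)=cos th0. *)
Definition is_gen_eigen_solution (F E th0 : R) (g : nat -> R) (psi : R -> R) : Prop :=
  [/\ {within `[0%R, +oo[, continuous psi},
      psi 0 = sin th0,
      derive1 psi x @[x --> (0 : R)^'+] --> cos th0,
      (forall x : R, 0 < x -> (forall n : nat, x != n%:R) ->
          [/\ derivable psi x 1, derivable (derive1 psi) x 1 &
              - derive1n 2 psi x - F * x * psi x = E * psi x]) &
      (forall n : nat, (0 < n)%N ->
          (derive1 psi (n%:R + e) - derive1 psi (n%:R - e)) @[e --> (0 : R)^'+]
            --> g n * psi n%:R)].

(* Prufer amplitude alpha(n): the (unique) complex number with
   psi(x) = alpha zeta(x) + conj(alpha) conj(zeta(x)) on (n-1, n). *)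
Definition prufer_alpha (F E : R) (psi : R -> R) (n : nat) : R[i] :=
  xget 0 [set a : R[i] | forall x : R, (n%:R - 1 < x < n%:R) ->
            ((psi x)%:C = a * zeta F E x + a^* * (zeta F E x)^*)%C].

(* Prufer radius R(n) = |2 i alpha(n)| = 2 |alpha(n)| *)
Definition prufer_radius (F E : R) (psi : R -> R) (n : nat) : R :=
  let a := prufer_alpha F E psi n in 2 * Num.sqrt (complex.Re a ^+ 2 + complex.Im a ^+ 2).

End Airy.

(* Mutual independence of the real random variables (X n)_{n >= 1}:
   product rule over every finite set of (distinct, positive) indices. *)
Definition mutually_independent_pos {d} {T : measurableType d} {R : realType}
  (P : probability T R) (X : nat -> T -> R) : Prop :=
  forall (I : seq nat) (B : nat -> set R),
    uniq I -> all (fun i => (0 < i)%N) I ->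
    (forall i, measurable (B i)) ->
    P (\big[setI/setT]_(i <- I) (X i @^-1` B i)) =
    (\prod_(i <- I) P (X i @^-1` B i))%E.

(* Main.v *)
(** Put b_k = sqrt (F (k + 1) + E).  On each unit interval the solution is a
    combination of the two power-series Airy solutions, and R(n) is comparable
    to the Euclidean norm of the coordinates (A, B).  Up to a bounded factor,
    A^2 + B^2 is the adiabatic quantity (b^2 psi^2 + psi'^2) / b at the site n,
    because correcting this quantity by a multiple of psi psi' leaves a drift of
    order b^-3, which is summable; no Airy asymptotics are needed.

    The kick at the site k + 1 multiplies it by
    1 + c sin + c^2 (1 + cos) / 2 with c = g_(k+1) / b_k and sin, cos taken at
    the doubled phase before the kick, so the logarithm grows by
    c sin + c^2 (1 + cos - sin^2) / 2 + O(c^3).  The sum of the linear terms is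
    a martingale, controlled by a maximal inequality and Borel-Cantelli along
    the times 2^(2^m); the same argument replaces g^2 by lam^2 in the quadratic
    terms.  Between kicks the doubled phase rotates by 2 b_k up to o(1), and b_k
    varies slowly, so the oscillating factors have zero logarithmic mean.  What
    is left is lam^2 / 4 * sum_k b_k^-2 ~ lam^2 / (4 F) ln n for ln (A^2 + B^2),
    and half of it for ln R(n). *)
Require Import Defs.
From HB Require Import structures.
From mathcomp Require Import all_boot all_order all_algebra.
From mathcomp Require Import all_classical all_reals all_analysis.
From mathcomp Require Import complex.
From mathcomp Require Import measurable_realfun zify ring lra.
Import Order.TTheory GRing.Theory Num.Theory.
Import numFieldNormedType.Exports.
Local Open Scope classical_set_scope.
Local Open Scope ring_scope.
Set Implicit Arguments. Unset Strict Implicit. Unset Printing Implicit Defensive.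

(** * Sequences negligible against the logarithm *)

Section LogNegligible.
Variable R : realType.
Implicit Types (S a w : nat -> R).

(** The linear terms are not sums of independent variables, since the phase before a kick depends on
    all earlier couplings. It depends on nothing else, however, so multiplying it by the next
    centred coupling gives orthogonal increments of variance at most lam^2 / b_k^2, with total of
    order ln n. Hence every error is measured against ln n, and a relative error o(1) per step is
    harmless when its weight is b_k^-2 or c^2.

    The kicks only tend to 0, so the phase strays from the free one over long times and
    trigonometric sums along the orbit cannot be evaluated directly. They are averaged over windows
    of fixed length L, inside which the phase is asymptotically rotated by multiples of 2 b_k; near
    orthogonality of the L exponentials gains a factor of order L^(-1/2), and L grows last.

    The factor 1 / 4 is the mean of (1 + cos - sin^2) / 2, with cos of mean 0 and sin^2 of mean 1 /
    2. Besides (iv), probability enters through three almost sure limits; the rest concerns one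
    realization and covers every solution [psi] on the same event of full measure. *)

Definition olog S := (fun n => S n / ln n%:R) @ \oo --> 0.

Lemma near_le_ln (B : R) : \forall n \near \oo, B <= ln n%:R.
Proof.
have [N _ HN] := nbhs_infty_ger (expR B).
exists N => // n Nn; have := HN n Nn => /= hn.
by rewrite -[B]expRK ler_ln ?posrE ?expR_gt0// (lt_le_trans (expR_gt0 B)).
Qed.

Lemma ologP S : olog S <-> forall e : R, 0 < e -> \forall n \near \oo, `|S n| <= e * ln n%:R.
Proof.
split.
- move=> /cvgrPdist_le oS e e0; have := oS e e0 => {}oS.
  near=> n; have l1 : 1 <= ln n%:R :> R by near: n; exact: near_le_ln.
  have l0 : 0 < ln n%:R :> R by exact: lt_le_trans l1.
  have : `|0 - S n / ln n%:R| <= e by near: n.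
  by rewrite sub0r normrN normrM normfV (gtr0_norm l0) ler_pdivrMr.
- move=> H; apply/cvgrPdist_le => e e0; have := H e e0 => {}H.
  near=> n; have l1 : 1 <= ln n%:R :> R by near: n; exact: near_le_ln.
  have l0 : 0 < ln n%:R :> R by exact: lt_le_trans l1.
  rewrite sub0r normrN normrM normfV (gtr0_norm l0) ler_pdivrMr//.
  by near: n.
Unshelve. all: by end_near. Qed.

Lemma ologD S1 S2 : olog S1 -> olog S2 -> olog (fun n => S1 n + S2 n).
Proof.
move=> o1 o2.
have : S1 n / ln n%:R + S2 n / ln n%:R @[n --> \oo] --> 0 + 0 by exact: cvgD.
rewrite addr0 /olog; under eq_fun do rewrite -mulrDl.
by [].
Qed.

Lemma ologM c S : olog S -> olog (fun n => c * S n).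
Proof.
move=> oS; have : c * (S n / ln n%:R) @[n --> \oo] --> c * 0 by exact: cvgMl_tmp.
rewrite mulr0 /olog; under eq_fun do rewrite mulrA.
by [].
Qed.

Lemma ologB S1 S2 : olog S1 -> olog S2 -> olog (fun n => S1 n - S2 n).
Proof.
move=> o1 o2; apply: ologD => //.
rewrite (_ : (fun n => - _) = (fun n => -1 * S2 n)); first exact: ologM.
by apply/funext => n; rewrite mulN1r.
Qed.

Lemma olog_le S1 S2 : olog S2 -> (\forall n \near \oo, `|S1 n| <= `|S2 n|) -> olog S1.
Proof.
move=> /ologP o2 le12; apply/ologP => e e0; near=> n.
apply: (@le_trans _ _ `|S2 n|); first by near: n.
by near: n; exact: o2.
Unshelve. all: by end_near. Qed.

Lemma olog_bounded S (B : R) : (\forall n \near \oo, `|S n| <= B) -> olog S.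
Proof.
move=> SB; apply/ologP => e e0; near=> n.
apply: (@le_trans _ _ B); first by near: n.
rewrite mulrC -ler_pdivrMr//; near: n; exact: near_le_ln.
Unshelve. all: by end_near. Qed.

(** The remainder [B] may depend on [e], so a cutoff or a window length can be fixed before [n]
    tends to infinity. *)
Lemma olog_approx S (C : R) : (forall e : R, 0 < e -> exists2 B, olog B &
   \forall n \near \oo, `|S n| <= e * C * (1 + ln n%:R) + B n) -> olog S.
Proof.
move=> H; apply/ologP => e e0.
(* With this choice [e1 * C <= e / 3]; since [1 + ln n <= 2 ln n] the main term costs [2 e / 3], and
   [B] the remaining third. *)
pose e1 := e / (3 * (1 + `|C|)).
have C1 : 0 < 1 + `|C| by rewrite ltr_wpDr.
have e10 : 0 < e1 by rewrite divr_gt0// mulr_gt0.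
have [B /ologP oB SB] := H e1 e10.
have e3 : 0 < e / 3 by lra.
have := oB _ e3 => {}oB.
near=> n.
have l1 : 1 <= ln n%:R :> R by near: n; exact: near_le_ln.
have hB : `|B n| <= e / 3 * ln n%:R by near: n.
have hS : `|S n| <= e1 * C * (1 + ln n%:R) + B n by near: n.
apply: (le_trans hS).
have eC : e1 * C <= e / 3.
  rewrite /e1; have -> : e / 3 = e / (3 * (1 + `|C|)) * (1 + `|C|).
    by field; rewrite gt_eqF.
  by rewrite ler_wpM2l ?(ltW e10)//; have := ler_norm C; lra.
have := ler_norm (B n).
have : e1 * C * (1 + ln n%:R) <= e / 3 * (2 * ln n%:R).
  apply: (@le_trans _ _ (e / 3 * (1 + ln n%:R))).
    by rewrite ler_wpM2r//; lra.
  by rewrite ler_wpM2l ?(ltW e3)//; lra.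
by lra.
Unshelve. all: by end_near. Qed.

(** A Cesaro argument: terms that are [o(w k)], with partial sums of [w] of order [ln n], add up to
    [o(ln n)], because the head of the sum is a constant. *)
Lemma olog_sum_small a w (C : R) : (forall k, 0 <= w k) ->
  (\forall n \near \oo, \sum_(0 <= k < n) w k <= C * (1 + ln n%:R)) ->
  (forall e : R, 0 < e -> exists K, forall k, (K <= k)%N -> `|a k| <= e * w k) ->
  olog (fun n => \sum_(0 <= k < n) a k).
Proof.
move=> w0 wC small; apply: (@olog_approx _ C) => e e0.
have [K HK] := small e e0.
exists (fun=> \sum_(0 <= k < K) `|a k|).
  by apply: (@olog_bounded _ `|\sum_(0 <= k < K) `|a k| |); near=> n.
near=> n.
have Kn : (K <= n)%N by near: n; exact: nbhs_infty_ge.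
have hC : \sum_(0 <= k < n) w k <= C * (1 + ln n%:R) by near: n.
rewrite (big_cat_nat (leq0n K) Kn)//=.
apply: (le_trans (ler_normD _ _)); rewrite addrC; apply: lerD; last exact: ler_norm_sum.
apply: (le_trans (ler_norm_sum _ _ _)).
apply: (@le_trans _ _ (e * \sum_(K <= k < n) w k)).
  rewrite mulr_sumr; apply: ler_sum_nat => k /andP[Kk _]; exact: HK.
rewrite -mulrA ler_wpM2l ?(ltW e0)//; apply: le_trans hC.
by rewrite [leRHS](big_cat_nat (leq0n K) Kn)//= lerDr sumr_ge0.
Unshelve. all: by end_near. Qed.

Lemma sum_harmonic_le n : \sum_(0 <= k < n.+1) (k.+1%:R : R)^-1 <= 1 + ln n.+1%:R.
Proof.
elim: n => [|n IH]; first by rewrite big_nat1 ln1 invr1 addr0.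
rewrite big_nat_recr//=; apply: (le_trans (lerD IH (lexx _))).
rewrite -addrA lerD2l.
have n0 : 0 < n.+1%:R :> R by rewrite ltr0n.
have m0 : 0 < n.+2%:R :> R by rewrite ltr0n.
(* The bound [ln (1 + x) <= x] at [x = - 1 / (n + 2)] says that [1 / (n + 2)] is at most the
   increment of [ln] from [n + 1] to [n + 2]. *)
have : ln (1 + - (n.+2%:R)^-1) <= - (n.+2%:R : R)^-1.
  by apply: le_ln1Dx; rewrite ltrN2 invf_lt1// ltr1n.
have -> : 1 - n.+2%:R^-1 = n.+1%:R / n.+2%:R :> R.
  by rewrite -[n.+2%:R]natr1; move: (n.+1%:R : R) n0 => a a0; field; rewrite gt_eqF// addr_gt0.
rewrite ln_div ?posrE// => h; rewrite -lerBrDl -[leRHS]opprB lerNr; exact: h.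
Qed.

End LogNegligible.

(** * Expectation of a product of independent variables *)

Section ProductExpectation.
Local Open Scope ereal_scope.
Context {d d1 d2} {T : measurableType d} {T1 : measurableType d1}
  {T2 : measurableType d2} {R : realType} (P : probability T R).

(** The product rule on rectangles identifies the joint law with the product of the marginals, and
    Fubini separates the factors. The target of [Y] is arbitrary, so that [Y] can later be the
    identity into the sample space with a coarser sigma-algebra. *)
Lemma expectation_indep_comp (Y : T -> T1) (X : T -> T2) (u : T1 -> R) (v : T2 -> R) :
  measurable_fun setT Y -> measurable_fun setT X ->
  measurable_fun setT u -> measurable_fun setT v ->
  (forall A B, measurable A -> measurable B ->
     P (Y @^-1` A `&` X @^-1` B) = P (Y @^-1` A) * P (X @^-1` B)) ->
  u \o Y \in Lfun P 1 -> v \o X \in Lfun P 1 ->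
  ((u \o Y) \* (v \o X))%R \in Lfun P 1 ->
  'E_P[((u \o Y) \* (v \o X))%R] = 'E_P[u \o Y] * 'E_P[v \o X].
Proof.
move=> mY mX mu mv ind /Lfun1_integrable iY /Lfun1_integrable iX /Lfun1_integrable iYX.
pose Y' := mfun_Sub (mem_set mY); pose X' := mfun_Sub (mem_set mX).
pose mu1 : probability T1 R := distribution P Y'.
pose mu2 : probability T2 R := distribution P X'.
pose YX := fun w : T => (Y w, X w).
have mYXf : measurable_fun setT YX by exact: measurable_fun_pair.
pose m' : probability (T1 * T2)%type R := distribution P (mfun_Sub (mem_set mYXf)).
have prodE : forall A, measurable A -> (mu1 \x mu2) A = m' A.
  by apply: product_measure_unique => A B mA mB; exact: ind.
pose f (z : T1 * T2) : \bar R := (u z.1 * v z.2)%:E.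
have mf : measurable_fun setT f.
  apply/measurable_EFinP; apply: measurable_funM.
    by apply: (measurableT_comp mu); exact: measurable_fst.
  by apply: (measurableT_comp mv); exact: measurable_snd.
have if' : m'.-integrable setT f.
  by apply: integrable_pushforward => //.
have if2 : (mu1 \x mu2).-integrable setT f.
  apply/integrableP; split => //.
  have /integrableP[_] := if'; apply: le_lt_trans.
  rewrite (eq_measure_integral m')// => A mA _.
  exact: prodE.
rewrite unlock.
have -> : \int[P]_w (((u \o Y) \* (v \o X)) w)%R%:E = \int[m']_z f z.
  by rewrite integral_pushforward.
have -> : \int[m']_z f z = \int[mu1 \x mu2]_z f z.
  by apply: eq_measure_integral => A mA _; apply/esym; exact: prodE.
rewrite -integral12_prod_meas1//.
have iy : mu1.-integrable setT (EFin \o u).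
  by apply: integrable_pushforward => //; exact/measurable_EFinP.
have ix : mu2.-integrable setT (EFin \o v).
  by apply: integrable_pushforward => //; exact/measurable_EFinP.
have e2 : \int[P]_w ((v \o X) w)%:E = \int[mu2]_x (v x)%:E.
  by rewrite /mu2 /distribution integral_pushforward//; exact/measurable_EFinP.
have e1 : \int[P]_w ((u \o Y) w)%:E = \int[mu1]_x (u x)%:E.
  by rewrite /mu1 /distribution integral_pushforward//; exact/measurable_EFinP.
rewrite e1 e2.
have fin2 : \int[mu2]_x (v x)%:E \is a fin_num by exact: integrable_fin_num.
rewrite -[X in _ * X]fineK// -integralZr//.
apply: eq_integral => y _.
rewrite /fubini_F /f /= fineK//.
by under eq_integral do rewrite EFinM; rewrite integralZl.
Qed.
End ProductExpectation.

(** * The filtration of the couplings *)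

Section Independence.
Local Open Scope ereal_scope.
Context {d} {T : measurableType d} {R : realType} (P : probability T R).
Variable h : nat -> {RV P >-> R}.

(** A pi-system generating the sigma-algebra of the first [k] couplings. The coupling [h k] is
    excluded, so level [k] is the past of the kick [h k]. *)
Definition cyl (k : nat) : set (set T) :=
  [set A | exists2 B : nat -> set R, (forall i, measurable (B i)) &
           A = \big[setI/setT]_(i <- iota 0 k) (h i @^-1` B i)].

Definition adapted (k : nat) (Y : T -> R) :=
  measurable_fun setT (Y : g_sigma_algebraType (cyl k) -> R).

Lemma measurable_cyl_big k (B : nat -> set R) : (forall i, measurable (B i)) ->
  measurable (\big[setI/setT]_(i <- iota 0 k) (h i @^-1` B i)).
Proof.
move=> mB; apply: bigsetI_measurable => i _.
by rewrite -[X in measurable X]setTI; exact: measurable_funP.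
Qed.

Lemma cyl_measurable k : cyl k `<=` measurable.
Proof. by move=> A [B mB ->]; exact: measurable_cyl_big. Qed.

Lemma cyl_setI k : setI_closed (cyl k).
Proof.
move=> A B [U mU ->] [V mV ->]; exists (fun i => U i `&` V i).
  by move=> i; exact: measurableI.
by rewrite -big_split.
Qed.

Lemma g_cyl_measurable k : <<s cyl k >> `<=` measurable.
Proof.
apply: smallest_sub; last exact: cyl_measurable.
exact: sigma_algebra_measurable.
Qed.

Lemma adapted_measurable k (Y : T -> R) : adapted k Y -> measurable_fun setT Y.
Proof.
by move=> mY _ B mB; apply: (@g_cyl_measurable k); exact: mY.
Qed.

Lemma adapted_coord k i : (i < k)%N -> adapted k (h i).
Proof.
move=> ik _ B mB; rewrite setTI; apply: sub_sigma_algebra.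
exists (fun j => if j == i then B else setT); first by move=> j; case: ifP.
rewrite (bigD1_seq i) ?mem_iota ?iota_uniq//= eqxx big1 ?setIT// => j /negbTE ->.
exact: preimage_setT.
Qed.

Hypothesis hind : forall (k : nat) (B : nat -> set R), (forall i, measurable (B i)) ->
  P (\big[setI/setT]_(i <- iota 0 k.+1) (h i @^-1` B i)) =
  P (\big[setI/setT]_(i <- iota 0 k) (h i @^-1` B i)) * P (h k @^-1` B k).

(** Dynkin's argument: [A |-> P (A n {h k in B})] and [P (h k in B) P] are finite measures that
    agree on the pi-system [cyl k] and on the whole space. *)
Lemma indep_g_cyl k (A : set T) (B : set R) : <<s cyl k >> A -> measurable B ->
  P (A `&` h k @^-1` B) = P A * P (h k @^-1` B).
Proof.
move=> sA mB.
have mhB : measurable (h k @^-1` B).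
  by rewrite -[X in measurable X]setTI; exact: measurable_funP.
have r0 : (0 <= fine (P (h k @^-1` B)))%R by exact: fine_ge0.
pose r := NngNum r0.
have rE : P (h k @^-1` B) = (r%:num)%:E by rewrite /= fineK// fin_num_measure.
pose m1 := mrestr P mhB.
pose m2 := mscale r P.
have m1m2 (X : set T) : cyl k X -> m1 X = m2 X.
  move=> [U mU ->]; rewrite /m1 /m2 /mrestr /mscale -rE.
  pose U' i := if i == k then B else U i.
  have mU' i : measurable (U' i) by rewrite /U'; case: ifP.
  have e : \big[setI/setT]_(i <- iota 0 k) (h i @^-1` U i) =
           \big[setI/setT]_(i <- iota 0 k) (h i @^-1` U' i).
    apply: eq_big_seq => i; rewrite mem_iota /= add0n /U' => ik.
    by rewrite ltn_eqF.
  rewrite e; have := hind k mU'.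
  have U'k : U' k = B by rewrite /U' eqxx.
  rewrite -addn1 iotaD big_cat big_seq1 /= add0n U'k => ->.
  by rewrite muleC.
suff : m1 A = m2 A by rewrite /m1 /m2 /mrestr /mscale -rE muleC.
apply: (@g_sigma_algebra_measure_unique_trace _ R T (cyl k) setT) => //.
- by move=> X [] /cyl_measurable.
- by move=> X Y [cX _] [cY _]; split => //; exact: cyl_setI.
- have -> : [set: T] = \big[setI/setT]_(i <- iota 0 k) (h i @^-1` setT).
    by rewrite big1// => i _; exact: preimage_setT.
  by apply: m1m2; exists (fun=> setT).
- by move=> X [? _]; exact: m1m2.
- rewrite /= /mrestr setTI; exact: le_lt_trans (probability_le1 P mhB) (ltry _).
- suff -> : [set X | cyl k X /\ X `<=` [set: T]] = cyl k by [].
  by apply/seteqP; split => X //= []//.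
Qed.

Lemma expectation_indep k (Y : T -> R) (phi : R -> R) :
  adapted k Y -> measurable_fun setT phi ->
  Y \in Lfun P 1 -> phi \o h k \in Lfun P 1 ->
  (Y \* (phi \o h k))%R \in Lfun P 1 ->
  'E_P[(Y \* (phi \o h k))%R] = 'E_P[Y] * 'E_P[phi \o h k].
Proof.
move=> aY mphi iY iX iYX.
(* The variable [Y] is composed with the identity into the sample space carrying the sigma-algebra
   generated by [cyl k]; it never has to be written as a function of the couplings. *)
apply: (@expectation_indep_comp _ _ _ T (g_sigma_algebraType (cyl k)) R R P
  idfun (h k) Y phi) => //.
  move=> _ A mA; rewrite setTI. exact: (g_cyl_measurable (mA : <<s cyl k >> A)).
by move=> A B mA mB; exact: indep_g_cyl.
Qed.
End Independence.

(** * Square-integrable variables *)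

Section SquareIntegrable.
Local Open Scope ereal_scope.
Context {d} {T : measurableType d} {R : realType} (P : probability T R).

Definition sqint (Y : T -> R) :=
  measurable_fun setT Y /\ P.-integrable setT (fun w => (Y w ^+ 2)%:E).

Lemma sqint_cst (c : R) : sqint (fun=> c).
Proof.
split; first exact: measurable_cst.
exact: (finite_measure_integrable_cst P (c ^+ 2)).
Qed.

Lemma sqint_mul (X Y : T -> R) : sqint X -> sqint Y -> (X \* Y)%R \in Lfun P 1.
Proof.
move=> [mX iX] [mY iY]; apply/Lfun1_integrable.
apply: (@le_integrable _ _ _ P _ _ _ ((fun w => (X w ^+ 2)%:E) \+ (fun w => (Y w ^+ 2)%:E))) => //.
- by apply/measurable_EFinP; exact: measurable_funM.
- move=> w _ /=; rewrite lee_fin ler_normr; apply/orP; left.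
  by rewrite normrM -(real_normK (num_real (X w))) -(real_normK (num_real (Y w))); have := normr_ge0 (X w); have := normr_ge0 (Y w); move: (Num.norm (X w)) (Num.norm (Y w)) => a b; nra.
- exact: integrableD.
Qed.

Lemma sqint_Lfun1 (X : T -> R) : sqint X -> X \in Lfun P 1.
Proof.
move=> sX; have -> : X = (X \* cst 1%R)%R by apply/funext => w /=; rewrite mulr1.
by apply: sqint_mul => //; exact: sqint_cst.
Qed.

Lemma sqint_add (X Y : T -> R) : sqint X -> sqint Y -> sqint (X \+ Y)%R.
Proof.
move=> sX sY; have [mX iX] := sX; have [mY iY] := sY; split.
  exact: measurable_funD.
have /Lfun1_integrable iXY := sqint_mul sX sY.
have -> : (fun w => ((X \+ Y)%R w ^+ 2)%:E) =
  ((fun w => (X w ^+ 2)%:E) \+ (fun w => (Y w ^+ 2)%:E)) \+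
  (fun w => 2%:E * ((X \* Y)%R w)%:E).
  by apply/funext => w /=; rewrite -EFinM -!EFinD; congr EFin; ring.
by apply: integrableD => //; [exact: integrableD|exact: integrableZl].
Qed.

Lemma sqint_bounded_mul (V X : T -> R) : measurable_fun setT V ->
  (forall w, (`|V w| <= 1)%R) -> sqint X -> sqint (V \* X)%R.
Proof.
move=> mV V1 [mX iX]; split; first exact: measurable_funM.
apply: le_integrable iX => //.
  by apply/measurable_EFinP; apply: measurable_funX; exact: measurable_funM.
move=> w _ /=; rewrite lee_fin !ger0_norm ?sqr_ge0// exprMn.
rewrite ler_piMl ?sqr_ge0// -(real_normK (num_real (V w))) expr_le1//.
Qed.

End SquareIntegrable.

(** * Martingale transforms: variance and maximal inequality *)

Section MartingaleTransform.
Local Open Scope ereal_scope.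
Context {d} {T : measurableType d} {R : realType} (P : probability T R).
Variable h : nat -> {RV P >-> R}.
Hypothesis hind : forall (k : nat) (B : nat -> set R), (forall i, measurable (B i)) ->
  P (\big[setI/setT]_(i <- iota 0 k.+1) (h i @^-1` B i)) =
  P (\big[setI/setT]_(i <- iota 0 k) (h i @^-1` B i)) * P (h k @^-1` B k).
Variables (phi : nat -> R -> R) (sig : nat -> R).
Hypothesis mphi : forall k, measurable_fun setT (phi k).
Hypothesis phi2 : forall k, sqint P (phi k \o h k).
Hypothesis phi_mean : forall k, 'E_P[phi k \o h k] = 0.
Hypothesis phi_var : forall k, 'E_P[fun w => (phi k (h k w) ^+ 2)%R] <= (sig k)%:E.

Definition mart (V : nat -> T -> R) (n : nat) (w : T) : R :=
  (\sum_(0 <= k < n) V k w * phi k (h k w))%R.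

Lemma martS V n w : mart V n.+1 w = (mart V n w + V n w * phi n (h n w))%R.
Proof. by rewrite /mart big_nat_recr. Qed.

Definition predictable (V : nat -> T -> R) :=
  (forall k, adapted h k (V k)) /\ (forall k w, (`|V k w| <= 1)%R).

Lemma cyl_sub j k : (j <= k)%N -> cyl h j `<=` cyl h k.
Proof.
move=> jk _ [B mB ->]; exists (fun i => if (i < j)%N then B i else setT).
  by move=> i; case: ifP.
rewrite -(subnKC jk) iotaD big_cat /= [X in _ `&` X]big1_seq ?setIT.
  by apply: eq_big_seq => i; rewrite mem_iota /= add0n => ->.
move=> i; rewrite mem_iota /= add0n => /andP[ji _].
by rewrite ltnNge ji /=; exact: preimage_setT.
Qed.

Lemma adapted_le j k (Y : T -> R) : (j <= k)%N -> adapted h j Y -> adapted h k Y.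
Proof.
move=> jk aY _ B mB; have := aY measurableT B mB.
by apply: sub_sigma_algebra2; exact: cyl_sub.
Qed.

Lemma mart_adapted V n : predictable V -> adapted h n (mart V n).
Proof.
move=> [aV _]; rewrite /adapted.
have -> : mart V n = fun w => (\sum_(k < n) V k w * phi k (h k w))%R.
  by apply/funext => w; rewrite /mart big_mkord.
apply: measurable_sum => k.
apply: measurable_funM; first by apply: adapted_le (aV k); exact: ltnW.
by apply: (measurableT_comp (mphi k)); apply: adapted_coord.
Qed.

Lemma term_sqint V k : predictable V ->
  sqint P (fun w => V k w * phi k (h k w))%R.
Proof.
move=> [aV V1]; apply: (@sqint_bounded_mul _ _ _ P (V k) (phi k \o h k)) => //.
exact: adapted_measurable (aV k).
Qed.

Lemma mart_sqint V n : predictable V -> sqint P (mart V n).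
Proof.
move=> pV; elim: n => [|n IH].
  rewrite (_ : mart V 0 = fun=> 0%R); first exact: sqint_cst.
  by apply/funext => w; rewrite /mart big_geq.
rewrite (_ : mart V n.+1 = mart V n \+ (fun w => V n w * phi n (h n w)))%R.
  by apply: sqint_add => //; exact: term_sqint.
by apply/funext => w; rewrite martS.
Qed.

(** Orthogonality of increments: [V n * mart V n] is measurable with respect to the past of [h n],
    hence independent of the centred [phi n (h n)], and the cross term vanishes. *)
Lemma mart_variance V n : predictable V ->
  'E_P[fun w => (mart V n w ^+ 2)%R] <= (\sum_(0 <= k < n) sig k)%:E.
Proof.
move=> pV; elim: n => [|n IH].
  rewrite big_geq// (_ : (fun _ => _) = cst 0%R) ?expectation_cst//.
  by apply/funext => w /=; rewrite /mart big_geq// expr0n.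
have sS := mart_sqint n pV; have sX := term_sqint n pV.
have [aV V1] := pV.
have sVS : sqint P (V n \* mart V n)%R.
  by apply: sqint_bounded_mul => //; exact: adapted_measurable (aV n).
have cross : 'E_P[((V n \* mart V n) \* (phi n \o h n))%R] = 0.
  rewrite (expectation_indep hind) ?phi_mean ?mule0//.
  - by apply: measurable_funM; [exact: aV|exact: mart_adapted].
  - exact: sqint_Lfun1.
  - exact: sqint_Lfun1.
  - exact: sqint_mul.
have i1 := sS.2; have i2 := sX.2.
have /Lfun1_integrable i3 := sqint_mul sVS (phi2 n).
have -> : 'E_P[fun w => (mart V n.+1 w ^+ 2)%R] =
    'E_P[fun w => (mart V n w ^+ 2)%R] +
    2%:E * 'E_P[((V n \* mart V n) \* (phi n \o h n))%R] +
    'E_P[fun w => ((V n w * phi n (h n w)) ^+ 2)%R].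
  rewrite unlock -integralZl// -integralD//; last exact: integrableZl.
  rewrite -integralD//; last by apply: integrableD => //; exact: integrableZl.
  apply: eq_integral => w _; rewrite martS -EFinM -!EFinD; congr EFin.
  by rewrite /=; ring.
rewrite cross mule0 adde0 big_nat_recr//= EFinD; apply: leeD => //.
apply: le_trans (phi_var n).
apply: expectation_le => //.
- by apply: measurable_funX; exact: sX.1.
- by apply: measurable_funX; exact: (phi2 n).1.
- by move=> w; exact: sqr_ge0.
- by move=> w; exact: sqr_ge0.
- apply: aeW => w; rewrite exprMn ler_piMl ?sqr_ge0//.
  by rewrite -(real_normK (num_real (V n w))) expr_le1.
Qed.

(* Stopping the transform when it first leaves ]-a, a[ turns the variance bound
   into a maximal inequality. *)
Lemma mart_maximal V n a : predictable V -> (0 < a)%R ->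
  exists2 A : set T, measurable A /\ P A <= ((\sum_(0 <= k < n) sig k) / a ^+ 2)%:E
    & forall w, ~ A w -> forall j, (j <= n)%N -> (`|mart V j w| < a)%R.
Proof.
move=> pV a0.
pose ok k w := all (fun j => `|mart V j w| < a)%R (iota 0 k.+1).
pose V' k w := if ok k w then V k w else 0%R.
have [aV V1] := pV.
have pV' : predictable V'.
  split=> k; last by move=> w; rewrite /V'; case: ifP; rewrite ?normr0.
  (* Stopping is predictable: whether the level [a] has been reached by time [k] is decided by
     values of the transform up to time [k], all measurable at level [k]. *)
  have mok : forall m s, (forall j, j \in s -> (j <= m)%N) ->
      measurable_fun setT
        ((fun w => all (fun j => `|mart V j w| < a)%R s) : g_sigma_algebraType (cyl h m) -> bool).
    move=> m; elim=> [|j s IH] ms; first exact: measurable_cst.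
    apply: measurable_and; last by apply: IH => i si; apply: ms; rewrite inE si orbT.
    apply: measurable_fun_ltr; last exact: measurable_cst.
    apply: measurableT_comp => //.
    by apply: (@adapted_le j m); [apply: ms; exact: mem_head|exact: mart_adapted].
  apply: measurable_fun_ifT; last exact: measurable_cst.
    by apply: mok => j; rewrite mem_iota.
  exact: aV.
have okS k w : ok k.+1 w = ok k w && (`|mart V k.+1 w| < a)%R.
  by rewrite /ok -(addn1 k.+1) iotaD all_cat [all _ (iota (0 + _) 1)]/= add0n andbT.
(* Before the exit the two transforms agree; afterwards the stopped one is frozen at a value of
   modulus at least [a]. Its value at time [n] alone therefore detects any earlier exit. *)
have key k w : if ok k w then mart V' k w = mart V k w else (a <= `|mart V' k w|)%R.
  elim: k => [|k IH].
    rewrite /ok /= /mart !big_geq// normr0 a0 andbT //.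
  have eV : V' k w = if ok k w then V k w else 0%R by [].
  rewrite okS (martS V') eV; move: IH; case: (ok k w) => /= IH; last first.
    by rewrite mul0r addr0.
  rewrite IH -martS; case: ltP => //.
exists [set w | (a <= `|mart V' n w|)%R]; first split.
- have mS := (mart_sqint n pV').1.
  rewrite -[X in measurable X]setTI.
  rewrite (_ : _ `&` _ = setT `&` (fun w => a <= `|mart V' n w|)%R @^-1` [set true])//.
  apply: measurable_fun_ler => //.
  exact: measurableT_comp.
- have mS := (mart_sqint n pV').1.
  have := @markov _ _ _ P (mfun_Sub (mem_set mS)) (fun x => x ^+ 2)%R a a0.
  move=> h2; rewrite [leRHS](EFinM _ (a ^+ 2)^-1) lee_pdivlMr ?exprn_gt0// muleC.
  apply: le_trans (mart_variance n pV').
  apply: le_trans (h2 _ _ _) _.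
  + exact: measurable_funX.
  + by move=> r _; exact: sqr_ge0.
  + by move=> x y; rewrite !nnegrE => x0 y0 xy; rewrite lerXn2r ?nnegrE.
  + rewrite le_eqVlt; apply/orP; left; apply/eqP; congr expectation.
    by apply/funext => w /=; rewrite real_normK// num_real.
move=> w /negP; rewrite -ltNge => nA j jn; have := key n w.
case: ifP => [okn _|_]; last by move=> h3; have := le_lt_trans h3 nA; rewrite ltxx.
by move/allP: okn; apply; rewrite mem_iota.
Qed.
End MartingaleTransform.

(** * Almost sure smallness of martingale transforms *)

Section BorelCantelli.
Context {d} {T : measurableType d} {R : realType} (P : probability T R).
Variable h : nat -> {RV P >-> R}.
Hypothesis hind : forall (k : nat) (B : nat -> set R), (forall i, measurable (B i)) ->
  P (\big[setI/setT]_(i <- iota 0 k.+1) (h i @^-1` B i)) =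
  (P (\big[setI/setT]_(i <- iota 0 k) (h i @^-1` B i)) * P (h k @^-1` B k))%E.
Variables (phi : nat -> R -> R) (sig : nat -> R).
Hypothesis mphi : forall k, measurable_fun setT (phi k).
Hypothesis phi2 : forall k, sqint P (phi k \o h k).
Hypothesis phi_mean : forall k, ('E_P[phi k \o h k] = 0)%E.
Hypothesis phi_var : forall k, ('E_P[fun w => (phi k (h k w) ^+ 2)%R] <= (sig k)%:E)%E.

(** Along these times the logarithm doubles: it is known up to a factor 2 between consecutive ones,
    and it grows fast enough for Chebyshev's bound to be geometric in [k]. *)
Let dbl (k : nat) := (2 ^ (2 ^ k))%N.

Let ln_dbl k : ln (dbl k)%:R = 2 ^+ k * ln 2 :> R.
Proof. by rewrite /dbl natrX lnXn ?ltr0n// -[ln _ *+ _]mulr_natl natrX. Qed.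

(** Up to time [dbl k.+1] the variance is of order [2^k], so an excursion above [2^k / (m + 1)] has
    probability of order [(m + 1)^2 / 2^k], summable in [k]. Borel-Cantelli is applied for each [m],
    and the countably many exceptional sets are discarded together. *)
Lemma mart_olog (V : nat -> T -> R) (C : R) : predictable h V -> 0 <= C ->
  (forall n, (0 < n)%N -> \sum_(0 <= k < n) sig k <= C * (1 + ln n%:R)) ->
  {ae P, forall w, olog (mart h phi V ^~ w)}.
Proof.
move=> pV C0 sigC.
have ln2_gt0 : 0 < ln (2 : R) by apply: ln_gt0; rewrite ltr1n.
have ln2_le1 : ln (2 : R) <= 1.
  by apply: (@le_ln1Dx R 1); lra.
pose a (m k : nat) : R := 2 ^+ k / m.+1%:R.
have a0 m k : 0 < a m k by rewrite divr_gt0// exprn_gt0.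
have AA m k := mart_maximal hind mphi phi2 phi_mean phi_var (dbl k.+1) pV (a0 m k).
pose A m k := s2val (cid2 (AA m k)).
have [mA PA] : (forall m k, measurable (A m k)) /\
   (forall m k, (P (A m k) <= ((\sum_(0 <= i < dbl k.+1) sig i) / a m k ^+ 2)%:E)%E).
  by split=> m k; have [] := s2valP (cid2 (AA m k)).
have nA m k w : ~ A m k w -> forall j, (j <= dbl k.+1)%N -> `|mart h phi V j w| < a m k.
  exact: (s2valP' (cid2 (AA m k))).
(* The variance is at most [C (1 + 2^(k+1) ln 2) <= 3 C 2^k]; dividing by [a m k ^+ 2] gives
   [3 C (m + 1)^2 / 2^k], written with [2^(k+1)] to match the geometric series used below. *)
have PA' m k : (P (A m k) <= (6 * C * m.+1%:R ^+ 2 / (2 ^ k.+1)%:R)%:E)%E.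
  apply: le_trans (PA m k) _; rewrite lee_fin.
  rewrite ler_pdivrMr ?exprn_gt0//.
  apply: le_trans (sigC _ _) _; first by rewrite /dbl expn_gt0.
  rewrite ln_dbl /a natrX exprS.
  have x1 : 1 <= (2 : R) ^+ k by rewrite exprn_ege1// ler1n.
  move: (2 ^+ k) x1 => x x1.
  have x0 : 0 < x by exact: lt_le_trans x1.
  have m0 : m.+1%:R != 0 :> R by rewrite pnatr_eq0.
  have -> : 6 * C * m.+1%:R ^+ 2 / (2 * x) * (x / m.+1%:R) ^+ 2 = C * (3 * x).
    by field; rewrite nat1r m0 gt_eqF.
  rewrite ler_wpM2l//.
  have : 2 * x * ln 2 <= 2 * x * 1 by rewrite ler_wpM2l// mulr_ge0// ltW.
  by lra.
have lim0 m : P (lim_sup_set (A m)) = 0%E.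
  apply: lim_sup_set_cvg0 => //.
  apply: (@le_lt_trans _ _ (\sum_(0 <= k <oo) ((6 * C * m.+1%:R ^+ 2) / (2 ^ k.+1)%:R)%:E)%E).
    by apply: lee_nneseries => // k _; exact: PA'.
  apply: (@le_lt_trans _ _ (6 * C * m.+1%:R ^+ 2)%:E); last exact: ltry.
  by apply: epsilon_trick0; rewrite mulr_ge0 ?sqr_ge0// mulr_ge0.
have mlim m : measurable (lim_sup_set (A m)).
  by apply: bigcap_measurable => // k _; exact: bigcup_measurable.
exists (\bigcup_m lim_sup_set (A m)); split.
- exact: bigcup_measurable.
- apply/negligibleP; first exact: bigcup_measurable.
  apply: negligible_bigcup => m; apply/negligibleP; first exact: mlim.
  exact: lim0.
move=> w; apply: contra_notP => nw.
apply/cvgrPdist_lt => e e0.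
have /ltr_add_invr[m] : 0 < e * ln 2 by rewrite mulr_gt0.
rewrite add0r => me.
have [K HK] : exists K, forall k, (K <= k)%N -> ~ A m k w.
  apply: contrapT => nK; apply: nw; exists m => // K _.
  apply: contrapT => nx; apply: nK; exists K => k Kk Ak; apply: nx; by exists k.
exists (dbl K) => // n /= Kn.
have n0 : (0 < n)%N by apply: leq_trans Kn; rewrite /dbl expn_gt0.
(* Two successive binary logarithms locate [n] between [dbl k] and [dbl k.+1]. *)
pose L := trunc_log 2 n; pose k := trunc_log 2 L.
have KL : (2 ^ K <= L)%N by apply: trunc_log_max.
have L0 : (0 < L)%N by apply: leq_trans KL; rewrite expn_gt0.
have Kk : (K <= k)%N by apply: trunc_log_max.
have kn : (dbl k <= n)%N.
  apply: leq_trans (trunc_logP (isT : (1 < 2)%N) n0).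
  by rewrite leq_exp2l//; exact: trunc_logP.
have nk : (n <= dbl k.+1)%N.
  apply: ltnW; apply: leq_trans (trunc_log_ltn n (isT : (1 < 2)%N)) _.
  by rewrite leq_exp2l//; exact: trunc_log_ltn.
have H := nA _ _ _ (HK _ Kk) _ nk.
have lnn : 2 ^+ k * ln 2 <= ln n%:R :> R.
  by rewrite -ln_dbl ler_ln ?posrE ?ltr0n ?ler_nat// /dbl expn_gt0.
have p0 : 0 < 2 ^+ k * ln 2 :> R by rewrite mulr_gt0// exprn_gt0.
have l0 : 0 < ln n%:R :> R by exact: lt_le_trans lnn.
rewrite sub0r normrN normrM normfV (gtr0_norm l0) ltr_pdivrMr//.
apply: lt_le_trans H _; rewrite /a.
apply: le_trans (_ : e * (2 ^+ k * ln 2) <= _); last by rewrite ler_wpM2l// ltW.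
by rewrite mulrCA ler_wpM2l ?exprn_ge0// ltW.
Qed.
End BorelCantelli.

(** * Averaging a slowly varying rotation *)

Section Averaging.
Variable R : realType.
Variable w : nat -> R.
Hypothesis w0 : forall k, 0 <= w k.
Hypothesis w1 : forall k, w k <= 1.
Hypothesis wdec : forall k, w k.+1 <= w k.
Variable C : R.
Hypothesis wC : \forall n \near \oo, \sum_(0 <= k < n) w k <= C * (1 + ln n%:R).

Definition wsum (a : nat -> R) (n : nat) := \sum_(0 <= k < n) w k * a k.
Definition lognull (a : nat -> R) := olog (wsum a).

Lemma lognullD a b : lognull a -> lognull b -> lognull (fun k => a k + b k).
Proof.
move=> na nb; have := ologD na nb; rewrite /lognull; congr olog; apply/funext => n.
by rewrite /wsum -big_split; apply: eq_bigr => k _; rewrite mulrDr.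
Qed.

Lemma lognullM c a : lognull a -> lognull (fun k => c * a k).
Proof.
move=> na; have := ologM c na; rewrite /lognull; congr olog; apply/funext => n.
by rewrite /wsum mulr_sumr; apply: eq_bigr => k _; rewrite mulrCA.
Qed.

Lemma lognull_sum (I : finType) (a : I -> nat -> R) :
  (forall i, lognull (a i)) -> lognull (fun k => \sum_i a i k).
Proof.
move=> na; have : forall s : seq I, lognull (fun k => \sum_(i <- s) a i k).
  elim=> [|i s IH].
    under eq_fun do rewrite big_nil; rewrite /lognull.
    apply: (@olog_bounded _ _ 0); near=> n.
    by rewrite /wsum big1 ?normr0// => k _; rewrite mulr0.
  by under eq_fun do rewrite big_cons; apply: lognullD.
exact.
Unshelve. all: by end_near. Qed.

Lemma lognull_null (a : nat -> R) : a @ \oo --> 0 -> lognull a.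
Proof.
move=> /cvgrPdist_le a0; apply: (olog_sum_small w0 wC) => e e0.
have [K _ HK] := a0 e e0; exists K => k Kk; have := HK k Kk => /=.
rewrite sub0r normrN normrM (ger0_norm (w0 k)) mulrC => h.
by rewrite ler_wpM2r.
Qed.

(** Summation by parts. As [w] decreases within the unit interval its total variation is at most 1;
    the bound 3 counts two boundary terms and the variation. *)
Lemma lognull_shift (a : nat -> R) : (forall k, `|a k| <= 1) ->
  lognull (fun k => a k.+1 - a k).
Proof.
move=> a1; apply: (@olog_bounded _ _ 3); near=> n.
have -> : wsum (fun k => a k.+1 - a k) n =
    (w n * a n - w 0%N * a 0%N) + \sum_(0 <= k < n) (w k - w k.+1) * a k.+1.
  rewrite /wsum; elim: (n) => [|m IH]; first by rewrite !big_geq// subrr addr0.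
  by rewrite !big_nat_recr//= IH; ring.
have t1 : `|w n * a n| <= 1.
  by rewrite normrM (ger0_norm (w0 n)) mulr_ile1.
have t2 : `|w 0%N * a 0%N| <= 1.
  by rewrite normrM (ger0_norm (w0 0)) mulr_ile1.
have t3 : `|\sum_(0 <= k < n) (w k - w k.+1) * a k.+1| <= 1.
  apply: (le_trans (ler_norm_sum _ _ _)).
  apply: (@le_trans _ _ (\sum_(0 <= k < n) (w k - w k.+1))).
    apply: ler_sum => k _; rewrite normrM ger0_norm ?subr_ge0//.
    by rewrite ler_piMr// subr_ge0.
  rewrite (_ : \sum_(0 <= k < n) _ = w 0%N - w n).
    by have := w0 n; have := w1 0; lra.
  elim: (n) => [|m IH]; first by rewrite big_geq// subrr.
  by rewrite big_nat_recr//= IH; ring.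
apply: (le_trans (ler_normD _ _)).
by have := ler_normB (w n * a n) (w 0%N * a 0%N); lra.
Unshelve. all: by end_near. Qed.

Lemma lognull_shiftn (a : nat -> R) j : (forall k, `|a k| <= 1) ->
  lognull (fun k => a (k + j)%N - a k).
Proof.
move=> a1; elim: j => [|j IH].
  under eq_fun do rewrite addn0 subrr.
  apply: lognull_null; exact: cvg_cst.
have := lognullD (lognull_shift (a := fun k => a (k + j)%N) (fun k => a1 _)) IH.
congr lognull; apply/funext => k; rewrite addnS addSn; ring.
Qed.

(** The pair [(x, y)] stands for the cosine and sine of a multiple of the phase, and [th] for the
    free rotation angle. The rotation is only asymptotic, which leaves room for the kicks. *)
Variables x y th : nat -> R.
Hypothesis xy1 : forall k, x k ^+ 2 + y k ^+ 2 <= 1.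
Hypothesis dth : th k.+1 - th k @[k --> \oo] --> 0.
Hypothesis rotx : x k.+1 - (x k * cos (th k) + y k * sin (th k)) @[k --> \oo] --> 0.
Hypothesis roty : y k.+1 - (y k * cos (th k) - x k * sin (th k)) @[k --> \oo] --> 0.
Hypothesis costh : forall m, (0 < m)%N -> lognull (fun k => cos (m%:R * th k)).

Let x1 k : `|x k| <= 1.
Proof. by rewrite -(@expr_le1 _ 2)// real_normK ?num_real//; have := xy1 k; have := sqr_ge0 (y k); lra. Qed.
Let y1 k : `|y k| <= 1.
Proof. by rewrite -(@expr_le1 _ 2)// real_normK ?num_real//; have := xy1 k; have := sqr_ge0 (x k); lra. Qed.

Let null (a : nat -> R) := a @ \oo --> (0 : R).

Let null_eq a b : null a -> a =1 b -> null b.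
Proof. by move=> na /funext <-. Qed.

Let nullD a b : null a -> null b -> null (fun k => a k + b k).
Proof. by move=> na nb; rewrite /null -(addr0 0); exact: cvgD. Qed.

Let nullM a b : null a -> (forall k, `|b k| <= 1) -> null (fun k => a k * b k).
Proof.
move=> /cvgrPdist_le na b1; apply/cvgrPdist_le => e e0.
have [K _ HK] := na e e0; exists K => // k Kk; have := HK k Kk => /=.
rewrite !sub0r !normrN normrM; apply: le_trans.
by rewrite ler_piMr.
Qed.

Let cos1 (z : R) : `|cos z| <= 1. Proof. by rewrite ler_norml cos_geN1 cos_le1. Qed.
Let sin1 (z : R) : `|sin z| <= 1. Proof. by rewrite ler_norml sin_geN1 sin_le1. Qed.

Let null_shift (a : nat -> R) j : null a -> null (fun k => a (k + j)%N).
Proof. by rewrite /null -(cvg_shiftn j). Qed.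

Let dthn j : null (fun k => th (k + j)%N - th k).
Proof.
elim: j => [|j IH].
  by rewrite /null; under eq_fun do rewrite addn0 subrr; exact: cvg_cst.
have shf := null_shift j dth.
have := nullD shf IH; rewrite /null; under eq_fun do rewrite addrA subrK -addSn addSnnS.
by [].
Qed.

Let null_cos1 (a : nat -> R) : null a -> null (fun k => cos (a k) - 1).
Proof.
move=> na; rewrite /null -(subrr 1) -{2}(@cos0 R); apply: cvgB; last exact: cvg_cst.
by apply: continuous_cvg => //; exact: continuous_cos.
Qed.

Let null_sin (a : nat -> R) : null a -> null (fun k => sin (a k)).
Proof.
move=> na; rewrite /null -(@sin0 R).
by apply: continuous_cvg => //; exact: continuous_sin.
Qed.

Let null_dcos j : null (fun k => cos (th (k + j)%N) - cos (th k)).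
Proof.
have n1 := nullM (null_cos1 (dthn j)) (fun k => cos1 (th k)).
have n2 := nullM (null_sin (dthn j)) (b := fun k => - sin (th k)) _.
have := nullD n1 (n2 _); rewrite /null.
under eq_fun => k.
  have -> : (cos (th (k + j)%N - th k) - 1) * cos (th k) +
      sin (th (k + j)%N - th k) * - sin (th k) =
      cos ((th (k + j)%N - th k) + th k) - cos (th k) by rewrite [in RHS]cosD; ring.
  rewrite subrK; over.
by apply => k; rewrite normrN.
Qed.

Let null_dsin j : null (fun k => sin (th (k + j)%N) - sin (th k)).
Proof.
have n1 := nullM (null_cos1 (dthn j)) (fun k => sin1 (th k)).
have n2 := nullM (null_sin (dthn j)) (fun k => cos1 (th k)).
have := nullD n1 n2; rewrite /null.
under eq_fun => k.
  have -> : (cos (th (k + j)%N - th k) - 1) * sin (th k) +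
      sin (th (k + j)%N - th k) * cos (th k) =
      sin ((th (k + j)%N - th k) + th k) - sin (th k) by rewrite [in RHS]sinD; ring.
  rewrite subrK; over.
by [].
Qed.

Let X j k := x k * cos (j%:R * th k) + y k * sin (j%:R * th k).
Let Y j k := y k * cos (j%:R * th k) - x k * sin (j%:R * th k).

Let X1 j k : `|X j k| <= 1.
Proof.
rewrite -(@expr_le1 _ 2)// real_normK ?num_real//; apply: le_trans (xy1 k).
rewrite -[leRHS]mulr1 -(cos2Dsin2 (j%:R * th k)) -subr_ge0.
by rewrite (_ : _ - _ = Y j k ^+ 2) ?sqr_ge0// /X /Y; ring.
Qed.

Let Y1 j k : `|Y j k| <= 1.
Proof.
rewrite -(@expr_le1 _ 2)// real_normK ?num_real//; apply: le_trans (xy1 k).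
rewrite -[leRHS]mulr1 -(cos2Dsin2 (j%:R * th k)) -subr_ge0.
by rewrite (_ : _ - _ = X j k ^+ 2) ?sqr_ge0// /X /Y; ring.
Qed.

(** For fixed [j] only finitely many one-step errors accumulate, and the angles [th (k + i)] with
    [i < j] may all be replaced by [th k]. *)
Let rotn j : null (fun k => x (k + j)%N - X j k) /\ null (fun k => y (k + j)%N - Y j k).
Proof.
elim: j => [|j [IHx IHy]].
  split; rewrite /null.
    under eq_fun do rewrite /X addn0 mul0r cos0 sin0 mulr0 mulr1 addr0 subrr.
    exact: cvg_cst.
  under eq_fun do rewrite /Y addn0 mul0r cos0 sin0 mulr0 mulr1 subr0 subrr.
  exact: cvg_cst.
have cosS k : cos (j.+1%:R * th k) = cos (j%:R * th k) * cos (th k) - sin (j%:R * th k) * sin (th k).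
  by rewrite -cosD -natr1 mulrDl mul1r.
have sinS k : sin (j.+1%:R * th k) = sin (j%:R * th k) * cos (th k) + cos (j%:R * th k) * sin (th k).
  by rewrite -sinD -natr1 mulrDl mul1r.
split.
(* Five errors: the new step, the inherited errors in [x] and in [y], and the replacement of
   [th (k + j)] by [th k] in the cosine and in the sine. *)
- apply: (null_eq (nullD (nullD (nullD (nullD (null_shift j rotx)
    (nullM IHx (fun k => cos1 (th (k + j)%N)))) (nullM IHy (fun k => sin1 (th (k + j)%N))))
    (nullM (null_dcos j) (X1 j))) (nullM (null_dsin j) (Y1 j)))) => k.
  by rewrite /X /Y cosS sinS addnS; ring.
- have b2 k : `|- sin (th (k + j)%N)| <= 1 by rewrite normrN.
  have b3 k : `|- X j k| <= 1 by rewrite normrN.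
  apply: (null_eq (nullD (nullD (nullD (nullD (null_shift j roty)
    (nullM IHy (fun k => cos1 (th (k + j)%N)))) (nullM IHx b2))
    (nullM (null_dcos j) (Y1 j))) (nullM (null_dsin j) b3))) => k.
  by rewrite /X /Y cosS sinS addnS; ring.
Qed.

Let lognull_cosB (i j : nat) : i != j -> lognull (fun k => cos ((i%:R - j%:R) * th k)).
Proof.
have H (a b : nat) : (a < b)%N -> lognull (fun k => cos ((b%:R - a%:R) * th k)).
  move=> ab; under eq_fun do rewrite -natrB ?(ltnW ab)//.
  by apply: costh; rewrite subn_gt0.
rewrite neq_ltn => /orP[]; last exact: H.
by move=> /H; under eq_fun do rewrite -cosN -mulNr opprB.
Qed.

(* Averaging x over L consecutive indices replaces it by (x, y) paired with a
   Fejer-type vector, whose squared length has logarithmic mean L. *)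
Theorem rot_lognull : lognull x.
Proof.
apply: (@olog_approx _ _ C) => e e0.
(* The choice [L e^2 >= 1] absorbs the diagonal of the double sum: its contribution [L] is at most
   [(L e)^2]. *)
pose L := (Num.truncn (e ^- 2)).+1.
have L0 : 0 < L%:R :> R by rewrite ltr0n.
have Le : 1 <= L%:R * e ^+ 2.
  by rewrite -ler_pdivrMr ?exprn_gt0// mul1r ltW// Num.Theory.truncnS_gt.
pose Ck k := \sum_(j < L) cos (j%:R * th k).
pose Sk k := \sum_(j < L) sin (j%:R * th k).
(* The off-diagonal part of the squared modulus of [\sum_j exp (i j th)]; each term is a cosine of a
   nonzero integer multiple of [th], hence of zero logarithmic mean. *)
pose q k := \sum_(i < L) \sum_(j < L) (if i == j then 0 else cos ((i%:R - j%:R) * th k)).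
pose m k := L%:R^-1 * (x k * Ck k + y k * Sk k).
pose r k := x k - m k.
have nr : lognull r.
  have n1 : lognull (fun k => \sum_(j < L) (x (k + j)%N - x k)).
    by apply: (lognull_sum (a := fun (j : 'I_L) k => x (k + j)%N - x k)) => j; exact: lognull_shiftn.
  have n2 : lognull (fun k => \sum_(j < L) (x (k + j)%N - X j k)).
    apply: (lognull_sum (a := fun (j : 'I_L) k => x (k + j)%N - X j k)) => j.
    by apply: lognull_null; have [] := rotn j.
  have := lognullM L%:R^-1 (lognullD n2 (lognullM (-1) n1)).
  congr lognull; apply/funext => k; rewrite /r /m.
  have -> : x k * Ck k + y k * Sk k = \sum_(j < L) X j k.
    by rewrite !mulr_sumr -big_split.
  rewrite !sumrB sumr_const card_ord -mulr_natr.
  by field; rewrite gt_eqF.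
have nq : lognull q.
  apply: (lognull_sum (a := fun (i : 'I_L) k => \sum_(j < L) (if i == j then 0 else cos ((i%:R - j%:R) * th k)))) => i.
  apply: (lognull_sum (a := fun (j : 'I_L) k => (if i == j then 0 else cos ((i%:R - j%:R) * th k)))) => j.
  case: eqVneq => [_|ij]; last exact: lognull_cosB.
  by apply: lognull_null; exact: cvg_cst.
have CS k : Ck k ^+ 2 + Sk k ^+ 2 = L%:R + q k.
  rewrite !expr2 /Ck /Sk /q !big_distrlr /= -big_split /=.
  rewrite -[L in L%:R]card_ord -sumr_const -big_split /=; apply: eq_bigr => i _.
  rewrite -big_split /= (bigD1 i)//= [in RHS](bigD1 i)//= eqxx add0r.
  rewrite -!expr2 cos2Dsin2; congr (1 + _); apply: eq_bigr => j ij.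
  rewrite eq_sym (negbTE ij) mulrBl cosD sinN cosN; ring.
pose B n := (2 * L%:R ^+ 2 * e)^-1 * wsum q n + `|wsum r n|.
exists B.
  apply: ologD; first exact: ologM.
  by apply: (olog_le nr); near=> n; rewrite normr_id.
(* Cauchy-Schwarz gives [v^2 <= L + q], and [2 (L e) |v| <= (L e)^2 + v^2] turns this into a bound
   on [|v|] that is linear in [q], so that the logarithmic mean of [q] can be used. *)
have me k : `|m k| <= e + (2 * L%:R ^+ 2 * e)^-1 * q k.
  pose v := x k * Ck k + y k * Sk k.
  have v2 : v ^+ 2 <= L%:R + q k.
    rewrite -CS; apply: (@le_trans _ _ ((x k ^+ 2 + y k ^+ 2) * (Ck k ^+ 2 + Sk k ^+ 2))).
      rewrite -subr_ge0 (_ : _ - _ = (x k * Sk k - y k * Ck k) ^+ 2) ?sqr_ge0//.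
      by rewrite /v; ring.
    by rewrite ler_piMl ?xy1// addr_ge0 ?sqr_ge0.
  have -> : e + (2 * L%:R ^+ 2 * e)^-1 * q k =
      (2 * L%:R ^+ 2 * e)^-1 * (2 * (L%:R * e) ^+ 2 + q k).
    by field; rewrite !gt_eqF.
  rewrite /m normrM ger0_norm ?invr_ge0 ?ler0n// -/v.
  have -> : L%:R^-1 * `|v| = (2 * L%:R ^+ 2 * e)^-1 * (2 * (L%:R * e) * `|v|).
    by field; rewrite !gt_eqF.
  rewrite ler_wpM2l ?invr_ge0 ?mulr_ge0 ?exprn_ge0 ?(ltW L0) ?(ltW e0)//.
  have : 0 <= (L%:R * e - `|v|) ^+ 2 by exact: sqr_ge0.
  have : L%:R <= (L%:R * e) ^+ 2.
    rewrite exprMn expr2 -mulrA -[leLHS]mulr1 ler_wpM2l// ltW//.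
  by rewrite sqrrB real_normK ?num_real//; lra.
near=> n.
have hC : \sum_(0 <= k < n) w k <= C * (1 + ln n%:R) by near: n.
have -> : wsum x n = wsum m n + wsum r n.
  by rewrite /wsum -big_split; apply: eq_bigr => k _ /=; rewrite -mulrDr /r addrC subrK.
apply: (le_trans (ler_normD _ _)); rewrite /B addrA lerD2r.
apply: (@le_trans _ _ (e * (\sum_(0 <= k < n) w k) + (2 * L%:R ^+ 2 * e)^-1 * wsum q n)).
  rewrite /wsum !mulr_sumr -big_split; apply: (le_trans (ler_norm_sum _ _ _)).
  apply: ler_sum => k _; rewrite normrM (ger0_norm (w0 k)) /=.
  apply: (le_trans (ler_wpM2l (w0 k) (me k))).
  by rewrite le_eqVlt; apply/orP; left; apply/eqP; ring.
by rewrite lerD2r -mulrA ler_wpM2l ?(ltW e0).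
Unshelve. all: by end_near. Qed.
End Averaging.

(** * Increments of sine and cosine *)

Section SinCos.
Variable R : realType.

Lemma sin_increment (a b : R) : a <= b ->
  exists2 c, a <= c <= b & sin b - sin a = cos c * (b - a).
Proof.
move=> ab.
have h1 x : x \in `]a, b[ -> is_derive x 1 sin (cos x) by move=> _; exact: is_derive_sin.
have h2 : {within `[a, b], continuous (@sin R)}.
  by apply: continuous_subspaceT => x; exact: continuous_sin.
by have [c] := MVT_segment ab h1 h2; rewrite in_itv /= => cab ->; exists c.
Qed.

Lemma cos_lipschitz (a b : R) : a <= b -> `|cos b - cos a| <= b - a.
Proof.
move=> ab.
have h1 x : x \in `]a, b[ -> is_derive x 1 cos (- sin x) by move=> _; exact: is_derive_cos.
have h2 : {within `[a, b], continuous (@cos R)}.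
  by apply: continuous_subspaceT => x; exact: continuous_cos.
have [c _ ->] := MVT_segment ab h1 h2.
rewrite normrM normrN (@ger0_norm _ (b - a)) ?subr_ge0//.
by rewrite ler_piMl ?subr_ge0// ler_norml sin_geN1 sin_le1.
Qed.

End SinCos.

(** * Local frequencies and logarithmic weights *)

Section Weights.
Variable R : realType.
Variables (F E : R).
Hypothesis F0 : 0 < F.

(* The local potential F (k + 1) + E at the site k + 1, truncated below by 1 so
   that it is a nondecreasing positive sequence; [bw] is the local frequency. *)
Definition bq (k : nat) : R := Num.max 1 (F * k.+1%:R + E).
Definition bw (k : nat) : R := Num.sqrt (bq k).
Definition wt (k : nat) : R := (bq k)^-1.

Lemma bq_ge1 k : 1 <= bq k.
Proof. by rewrite /bq le_max lexx. Qed.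

Lemma bq_gt0 k : 0 < bq k.
Proof. exact: lt_le_trans (bq_ge1 k). Qed.

Lemma bw_ge1 k : 1 <= bw k.
Proof. by rewrite -sqrtr1 ler_wsqrtr// bq_ge1. Qed.

Lemma bw_gt0 k : 0 < bw k.
Proof. exact: lt_le_trans (bw_ge1 k). Qed.

Lemma bw_sqr k : bw k ^+ 2 = bq k.
Proof. by rewrite sqr_sqrtr// ltW// bq_gt0. Qed.

Lemma bqS k : bq k <= bq k.+1.
Proof.
rewrite /bq ge_max !le_max lexx /=; apply/orP; right.
by rewrite lerD2r ler_wpM2l ?(ltW F0)// ler_nat.
Qed.

Lemma bwS k : bw k <= bw k.+1.
Proof. by rewrite ler_wsqrtr// bqS. Qed.

Lemma wt_ge0 k : 0 <= wt k.
Proof. by rewrite invr_ge0 ltW// bq_gt0. Qed.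

Lemma wt_le1 k : wt k <= 1.
Proof. by rewrite invf_le1 ?bq_gt0// bq_ge1. Qed.

Lemma wt_dec k : wt k.+1 <= wt k.
Proof. by rewrite lef_pV2 ?posrE ?bq_gt0// bqS. Qed.

(** The truncation makes this hold for all [k]: [F (k + 1) <= bq k + |E| <= (1 + |E|) bq k] because
    [bq k >= 1]. *)
Lemma wt_le_harmonic k : wt k <= (1 + `|E|) / F * k.+1%:R^-1.
Proof.
have k0 : 0 < k.+1%:R :> R by rewrite ltr0n.
rewrite /wt -[leLHS]mul1r -mulrA -invfM ler_pdivrMr ?bq_gt0//.
rewrite mulrAC ler_pdivlMr ?mulr_gt0// mul1r.
have h1 := bq_ge1 k.
have h2 : F * k.+1%:R + E <= bq k by rewrite /bq le_max lexx orbT.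
have := normr_ge0 E; have := ler_norm (- E); rewrite normrN => h3 h4.
rewrite mulrDl mul1r.
have : `|E| <= `|E| * bq k by rewrite ler_peMr.
by lra.
Qed.

Lemma wt_sum_all n : (0 < n)%N -> \sum_(0 <= k < n) wt k <= (1 + `|E|) / F * (1 + ln n%:R).
Proof.
move=> n0; apply: (@le_trans _ _ (\sum_(0 <= k < n) (1 + `|E|) / F * k.+1%:R^-1)).
  by apply: ler_sum => k _; exact: wt_le_harmonic.
rewrite -mulr_sumr ler_wpM2l ?divr_ge0 ?addr_ge0 ?(ltW F0)//.
by rewrite -(prednK n0); exact: sum_harmonic_le.
Qed.

Lemma wt_sum : \forall n \near \oo, \sum_(0 <= k < n) wt k <= (1 + `|E|) / F * (1 + ln n%:R).
Proof. by near=> n; apply: wt_sum_all; near: n; exact: nbhs_infty_gt.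
Unshelve. all: by end_near. Qed.

Lemma bq_large : exists K, forall k, (K <= k)%N -> bq k = F * k.+1%:R + E.
Proof.
have [K _ HK] := nbhs_infty_ger ((1 - E) / F).
exists K => k Kk; rewrite /bq; apply/max_idPr.
have := HK k Kk => /=; rewrite ler_pdivrMr// mulrC => h.
rewrite -lerBlDr (le_trans h)// ler_wpM2l ?(ltW F0)// ler_nat//.
Qed.

Lemma bq_step : exists K, forall k, (K <= k)%N -> bq k.+1 = bq k + F.
Proof.
have [K HK] := bq_large; exists K => k Kk.
by rewrite !HK ?(leqW Kk)// -[k.+2%:R]natr1 mulrDr mulr1; ring.
Qed.

Lemma bq_unbounded (B : R) : exists K, forall k, (K <= k)%N -> B <= bq k.
Proof.
have [K _ HK] := nbhs_infty_ger ((B - E) / F).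
exists K => k Kk; rewrite /bq le_max; apply/orP; right.
have := HK k Kk => /=; rewrite ler_pdivrMr// mulrC => h.
rewrite -lerBlDr (le_trans h)// ler_wpM2l ?(ltW F0)// ler_nat//.
Qed.

Lemma invbw_small (e : R) : 0 < e -> exists K, forall k, (K <= k)%N -> (bw k)^-1 <= e.
Proof.
move=> e0; have [K HK] := bq_unbounded (e ^- 2); exists K => k Kk.
rewrite -[e]invrK lef_pV2 ?posrE ?bw_gt0 ?invr_gt0//.
rewrite -(@ler_pXn2r _ 2) ?nnegrE ?invr_ge0 ?(ltW e0) ?(ltW (bw_gt0 k))//.
by rewrite bw_sqr exprVn HK.
Qed.

Lemma wt_bw k : wt k = (bw k)^-1 ^+ 2.
Proof. by rewrite /wt exprVn bw_sqr. Qed.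

(** Eventually [bq] increases by [F], so the increment of [ln (bq k)] is [ln (1 + F wt)], equal to
    [F wt] up to a term of order [wt^2]. The increments telescope, and [bq n / n] stays between
    positive constants. *)
Lemma wt_log_mean : olog (fun n => \sum_(0 <= k < n) wt k - F^-1 * ln n%:R).
Proof.
have o1 : olog (fun n => \sum_(0 <= k < n) (F * wt k - (ln (bq k.+1) - ln (bq k)))).
  apply: (olog_sum_small wt_ge0 wt_sum) => e e0.
  have [K HK] := bq_step.
  have [K2 HK2] := bq_unbounded (F ^+ 2 / e).
  exists (maxn K K2) => k; rewrite geq_max => /andP[Kk K2k].
  have b0 := bq_gt0 k.
  have be : F ^+ 2 * wt k <= e.
    by rewrite /wt ler_pdivrMr// mulrC -ler_pdivrMr// HK2.
  set t := F * wt k.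
  have t0 : 0 < t by rewrite mulr_gt0// invr_gt0.
  have lE : ln (bq k.+1) - ln (bq k) = ln (1 + t).
    rewrite -ln_div ?posrE ?bq_gt0// HK//; congr ln.
    by rewrite /t /wt mulrDl mulfV// gt_eqF.
  have up : ln (1 + t) <= t by apply: le_ln1Dx; lra.
  have lo : t - t ^+ 2 <= ln (1 + t).
    have l2 : ln (1 + - (t / (1 + t))) <= - (t / (1 + t)).
      by apply: le_ln1Dx; rewrite ltrN2 ltr_pdivrMr; lra.
    have e1 : 1 + - (t / (1 + t)) = (1 + t)^-1 by field; rewrite gt_eqF//; lra.
    rewrite e1 lnV ?posrE in l2; last by lra.
    have e2 : t / (1 + t) = t - t ^+ 2 + t ^+ 3 / (1 + t) by field; rewrite gt_eqF//; lra.
    have : 0 <= t ^+ 3 / (1 + t) by rewrite divr_ge0 ?exprn_ge0//; lra.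
    by lra.
  rewrite lE ger0_norm ?subr_ge0//.
  apply: (@le_trans _ _ (t ^+ 2)); first by lra.
  rewrite (_ : t ^+ 2 = F ^+ 2 * wt k * wt k); last by rewrite /t; ring.
  by rewrite ler_wpM2r ?wt_ge0.
have o2 : olog (fun n => ln (bq n) - ln n%:R).
  have F0' := F0.
  have F2 : 0 < F + F + `|E| by rewrite ltr_wpDr// addr_gt0.
  apply: (@olog_bounded _ _ (`|ln (F + F + `|E|)| + `|ln (F / 2)|)).
  have [K HK] := bq_large.
  near=> n; have n1 : (0 < n)%N by near: n; exact: nbhs_infty_gt.
  have n0 : 1 <= n%:R :> R by rewrite ler1n.
  have nn0 : 0 < n%:R :> R by rewrite ltr0n.
  have Kn : (K <= n)%N by near: n; exact: nbhs_infty_ge.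
  have nE : 2 * `|E| / F <= n%:R by near: n; exact: nbhs_infty_ger.
  rewrite ler_pdivrMr// in nE.
  have h1 := ler_norm E; have h2 := ler_norm (- E); rewrite normrN in h2.
  rewrite -ln_div ?posrE ?bq_gt0//.
  have bE := HK n Kn; rewrite -natr1 mulrDr mulr1 in bE.
  have q1 : F / 2 <= bq n / n%:R by rewrite ler_pdivlMr// bE; lra.
  have q2 : bq n / n%:R <= F + F + `|E|.
    rewrite ler_pdivrMr// bE !mulrDl.
    have : F <= F * n%:R by rewrite ler_peMr// ltW.
    have : `|E| <= `|E| * n%:R by rewrite ler_peMr.
    by lra.
  have q0 : 0 < bq n / n%:R by rewrite divr_gt0// bq_gt0.
  have l1 : ln (F / 2) <= ln (bq n / n%:R) by rewrite ler_ln ?posrE// divr_gt0.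
  have l2 : ln (bq n / n%:R) <= ln (F + F + `|E|) by rewrite ler_ln ?posrE.
  have := ler_norm (ln (F + F + `|E|)); have := ler_norm (- ln (F / 2)); rewrite normrN.
  have := normr_ge0 (ln (F + F + `|E|)); have := normr_ge0 (ln (F / 2)).
  by rewrite ler_norml; lra.
have o3 : olog (fun n => \sum_(0 <= k < n) (F * wt k - (ln (bq k.+1) - ln (bq k))) +
    (ln (bq n) - ln n%:R) - ln (bq 0)).
  apply: ologB; first exact: ologD.
  by apply: (@olog_bounded _ _ `|ln (bq 0)|); near=> n.
have := ologM F^-1 o3; congr olog; apply/funext => n.
rewrite sumrB -mulr_sumr telescope_sumr//.
by field; rewrite gt_eqF.
Unshelve. all: by end_near. Qed.

Lemma bw_step : exists K, forall k, (K <= k)%N ->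
  0 <= bw k.+1 - bw k /\ F = (bw k.+1 - bw k) * (2 * bw k + (bw k.+1 - bw k)).
Proof.
have [K HK] := bq_step; exists K => k Kk; rewrite subr_ge0 bwS; split => //.
have := HK k Kk; rewrite -!bw_sqr => h.
by transitivity (bw k.+1 ^+ 2 - bw k ^+ 2); [rewrite h; ring|ring].
Qed.

Lemma bw_step_le : exists K, forall k, (K <= k)%N ->
  0 <= bw k.+1 - bw k <= F * (bw k)^-1.
Proof.
have [K HK] := bw_step; exists K => k Kk; have [d0 dF] := HK k Kk.
rewrite d0 /= ler_pdivlMr ?bw_gt0//.
have key (z b : R) : 0 <= z -> 0 < b -> z * b <= z * (2 * b + z).
  by move=> z0 b0; rewrite ler_wpM2l//; lra.
by apply: le_trans (key _ _ d0 (bw_gt0 k)) _; rewrite -dF.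
Qed.

Lemma bw_step_null (c : R) : 0 <= c -> c * bw k.+1 - c * bw k @[k --> \oo] --> 0.
Proof.
move=> c0; apply/cvgrPdist_le => e e0.
have [K HK] := bw_step_le.
have e1 : 0 < e / (F * (1 + c)) by rewrite divr_gt0 ?mulr_gt0// ltr_wpDr.
have [K2 HK2] := invbw_small e1.
exists (maxn K K2) => // k /=; rewrite geq_max => /andP[/HK /andP[d0 d1] /HK2 d2].
rewrite sub0r normrN -mulrBr ger0_norm ?mulr_ge0//.
rewrite ler_pdivlMr ?mulr_gt0 ?ltr_wpDr// in d2.
apply: (@le_trans _ _ (c * (F * (bw k)^-1))); first by rewrite ler_wpM2l.
apply: le_trans d2.
have : 0 <= F * (bw k)^-1 by rewrite mulr_ge0 ?invr_ge0 ?(ltW F0) ?(ltW (bw_gt0 k)).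
move: (bw k)^-1 => b; nra.
Qed.

(* [cos (mu b_k) (b_{k+1} - b_k)] is nearly a telescoping difference of
   [sin (mu b_k) / mu], and [b_{k+1} - b_k ~ F / (2 b_k)]. *)
Lemma lognull_cos_bw (mu : R) : 0 < mu -> lognull wt (fun k => cos (mu * bw k)).
Proof.
move=> mu0.
pose v k := (bw k)^-1.
have v0 k : 0 <= v k by rewrite invr_ge0 ltW// bw_gt0.
have v1 k : v k <= 1 by rewrite invf_le1 ?bw_gt0// bw_ge1.
have vd k : v k.+1 <= v k by rewrite lef_pV2 ?posrE ?bw_gt0// bwS.
(* The weight here is [v = 1 / b], not [wt = v^2]: the other factor [v] is supplied by
   [b_(k+1) - b_k]. *)
have o1 : lognull v (fun k => sin (mu * bw k.+1) - sin (mu * bw k)).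
  apply: (lognull_shift v0 v1 vd (a := fun k => sin (mu * bw k))) => k.
  by rewrite ler_norml sin_geN1 sin_le1.
pose err k := cos (mu * bw k) * (mu * F / 2 * v k) - (sin (mu * bw k.+1) - sin (mu * bw k)).
(* The error is of order [z^2 <= F^2 wt]; the additional factor [v], which tends to 0, makes the sum
   [o(ln n)]. *)
have o2 : olog (fun n => \sum_(0 <= k < n) v k * err k).
  apply: (olog_sum_small wt_ge0 wt_sum) => e e0.
  have [K HK] := bw_step; have [K1 HK1] := bw_step_le.
  have m1 : 0 < (mu ^+ 2 + mu) * F ^+ 2 by rewrite mulr_gt0 ?exprn_gt0// addr_gt0// exprn_gt0.
  have [K2 HK2] := @invbw_small (e / ((mu ^+ 2 + mu) * F ^+ 2)) (divr_gt0 e0 m1).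
  exists (maxn K (maxn K1 K2)) => k.
  rewrite !geq_max => /and3P[/HK[d0 dF] /HK1 /andP[_ d1] /HK2 ve].
  have b0 := bw_gt0 k; have b1 := bw_ge1 k.
  rewrite ler_pdivlMr// in ve.
  set z := bw k.+1 - bw k in d0 d1 dF.
  have mz : mu * bw k <= mu * bw k.+1 by rewrite ler_wpM2l ?(ltW mu0)// bwS.
  have [c /andP[c1 c2] sE] := sin_increment mz.
  have cl : `|cos c - cos (mu * bw k)| <= mu * z.
    apply: le_trans (cos_lipschitz c1) _.
    by rewrite /z mulrBr lerB.
  (* Substituting [F = z (2 b + z)] gives [mu F v / 2 = mu z + mu z^2 v / 2]; the first summand
     cancels against the mean value form of the sine increment, up to moving the intermediate point
     [c]. *)
  have eE : err k = cos (mu * bw k) * (mu / 2 * z ^+ 2 * v k) - (cos c - cos (mu * bw k)) * (mu * z).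
    rewrite /err sE -mulrBr -/z {1}dF /v; field; by rewrite gt_eqF.
  have hv : v k * v k = wt k by rewrite -expr2 wt_bw.
  have z2 : z ^+ 2 <= F ^+ 2 * wt k.
    by rewrite wt_bw -exprMn lerXn2r ?nnegrE// mulr_ge0 ?(ltW F0) ?invr_ge0 ?(ltW b0).
  have errle : `|err k| <= (mu ^+ 2 + mu) * z ^+ 2.
    have t1 : `|(cos c - cos (mu * bw k)) * (mu * z)| <= mu ^+ 2 * z ^+ 2.
      rewrite normrM (ger0_norm (mulr_ge0 (ltW mu0) d0)) -exprMn expr2.
      by rewrite ler_wpM2r// mulr_ge0// ltW.
    have t2 : `|cos (mu * bw k) * (mu / 2 * z ^+ 2 * v k)| <= mu * z ^+ 2.
      have p0 : 0 <= mu / 2 * z ^+ 2 * v k by rewrite !mulr_ge0 ?sqr_ge0 ?invr_ge0// ltW.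
      rewrite normrM (ger0_norm p0).
      apply: (@le_trans _ _ (1 * (mu / 2 * z ^+ 2 * v k))).
        by rewrite ler_wpM2r// ler_norml cos_geN1 cos_le1.
      have hz : 0 <= mu * z ^+ 2 by rewrite mulr_ge0 ?sqr_ge0// ltW.
      by have := v0 k; have := v1 k; move: (v k) => u u1 u0; nra.
    rewrite eE (mulrDl (mu ^+ 2)); apply: (le_trans (ler_normB _ _)).
    by rewrite [leLHS]addrC; exact: lerD.
  rewrite normrM (ger0_norm (v0 k)).
  apply: (@le_trans _ _ (v k * ((mu ^+ 2 + mu) * (F ^+ 2 * wt k)))).
    rewrite ler_wpM2l// (le_trans errle)// ler_wpM2l// addr_ge0 ?sqr_ge0// ltW//.
  by rewrite mulrA mulrA ler_wpM2r ?wt_ge0// -mulrA.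
have := ologM (2 / (mu * F)) (ologD o1 o2); rewrite /lognull; congr olog.
apply/funext => n; rewrite /wsum -big_split mulr_sumr; apply: eq_bigr => k _ /=.
by rewrite wt_bw /err -/(v k); field; rewrite !gt_eqF.
Qed.
End Weights.

(** * Derivative rules and bounds for the logarithm near 1 *)

Section RealDerivatives.
Variable R : realType.
Implicit Types (f g : R -> R) (x a b : R).

Lemma dcst c x : is_derive x 1 (fun=> c : R) 0.
Proof. exact: is_derive_cst. Qed.

Lemma did x : is_derive x 1 (fun t : R => t) 1.
Proof. exact: is_derive_id. Qed.

Lemma dadd f g x a b : is_derive x 1 f a -> is_derive x 1 g b ->
  is_derive x 1 (fun t => f t + g t) (a + b).
Proof. by move=> hf hg; exact: is_deriveD. Qed.

Lemma dsub f g x a b : is_derive x 1 f a -> is_derive x 1 g b ->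
  is_derive x 1 (fun t => f t - g t) (a - b).
Proof. by move=> hf hg; exact: is_deriveB. Qed.

Lemma dmul f g x a b : is_derive x 1 f a -> is_derive x 1 g b ->
  is_derive x 1 (fun t => f t * g t) (f x * b + g x * a).
Proof. by move=> hf hg; exact: is_deriveM. Qed.

Lemma dinv f x a : f x != 0 -> is_derive x 1 f a ->
  is_derive x 1 (fun t => (f t)^-1) (- (f x) ^- 2 * a).
Proof. by move=> f0 hf; exact: is_deriveV. Qed.

Lemma dcomp f g x a b : is_derive (g x) 1 f a -> is_derive x 1 g b ->
  is_derive x 1 (fun t => f (g t)) (a * b).
Proof. by move=> hf hg; exact: is_derive1_comp. Qed.

Lemma deq f x a b : is_derive x 1 f a -> a = b -> is_derive x 1 f b.
Proof. exact: is_derive_eq. Qed.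

Lemma mvt_bound f f' (C : R) a b : a <= b ->
  (forall x, a <= x <= b -> is_derive x 1 f (f' x)) ->
  (forall x, a <= x <= b -> `|f' x| <= C) -> `|f b - f a| <= C * (b - a).
Proof.
move=> ab fd fC.
have h1 x : x \in `]a, b[ -> is_derive x 1 f (f' x).
  by rewrite in_itv /= => /andP[xa xb]; apply: fd; rewrite !ltW.
have h2 : {within `[a, b], continuous f}.
  apply: derivable_within_continuous => x; rewrite in_itv /= => xab.
  by have [] := fd x xab.
have [c] := MVT_segment ab h1 h2; rewrite in_itv /= => cab ->.
by rewrite normrM (@ger0_norm _ (b - a)) ?subr_ge0// ler_wpM2r ?subr_ge0// fC.
Qed.

Lemma derive0_const_oo (f : R -> R) (a b x y : R) :
  (forall z : R, a < z < b -> is_derive z 1 f 0) -> a < x < b -> a < y < b -> f x = f y.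
Proof.
move=> df; wlog xy : x y / x <= y => [H xab yab|/andP[ax xb] /andP[ay yb]].
  by have [xy|/ltW yx] := leP x y; [exact: H|rewrite (H y x)].
have h : `|f y - f x| <= 0 * (y - x).
  apply: (@mvt_bound f (fun=> 0)) => //; last by move=> z _; rewrite normr0.
  move=> z /andP[xz zy]; apply: df.
  by rewrite (lt_le_trans ax xz) (le_lt_trans zy yb).
by apply/esym/eqP; rewrite -subr_eq0 -normr_eq0 eq_le normr_ge0 andbT -(mul0r (y - x)).
Qed.

Lemma derive0_const f x y : (forall z : R, is_derive z 1 f 0) -> f x = f y.
Proof.
move=> df; apply: (@derive0_const_oo f (Num.min x y - 1) (Num.max x y + 1)) => //.
  by rewrite ltrBlDr ltr_pwDr ?ge_min ?lexx//= ltr_pwDr// le_max lexx.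
by rewrite ltrBlDr ltr_pwDr ?ge_min ?lexx ?orbT//= ltr_pwDr// le_max lexx orbT.
Qed.

Lemma ln1D_le (t : R) : `|t| <= 2^-1 -> `|ln (1 + t)| <= 2 * `|t|.
Proof.
move=> t2; have t1 : - 2^-1 <= t <= 2^-1 by rewrite -ler_norml.
have up : ln (1 + t) <= t by apply: le_ln1Dx; lra.
have i0 : 0 < 1 + t by lra.
have l2 : ln (1 + - (t / (1 + t))) <= - (t / (1 + t)).
  by apply: le_ln1Dx; rewrite ltrN2 ltr_pdivrMr; lra.
rewrite (_ : 1 + - (t / (1 + t)) = (1 + t)^-1) in l2; last by field; rewrite gt_eqF.
rewrite lnV ?posrE// in l2.
have lo : - (2 * `|t|) <= t / (1 + t).
  rewrite ler_pdivlMr//; have := ler_norm (- t); rewrite normrN => h.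
  have := normr_ge0 t; move: `|t| h t2 => n h t2 n0; nra.
by rewrite ler_norml; have := ler_norm t; have := normr_ge0 t; lra.
Qed.

(** The remainder vanishes at 0 and has derivative [z^2 / (1 + z)], at most [2 t^2] between 0 and
    [t] because [1 + z >= 1 / 2] there. *)
Lemma ln1D_taylor2 (t : R) : `|t| <= 2^-1 ->
  `|ln (1 + t) - (t - t ^+ 2 / 2)| <= 2 * `|t| ^+ 3.
Proof.
pose f (z : R) := ln (1 + z) - (z - z * z * 2^-1).
pose f' (z : R) := z * z / (1 + z).
have df (z : R) : `|z| <= 2^-1 -> is_derive z 1 f (f' z).
  rewrite ler_norml => z1; have i0 : 0 < 1 + z by lra.
  have := dsub (dcomp (is_derive1_ln i0) (dadd (dcst 1 z) (did z)))
    (dsub (did z) (dmul (dmul (did z) (did z)) (dcst 2^-1 z))).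
  by move=> /deq; apply; rewrite /f'; field; rewrite gt_eqF.
have f'le (z n : R) : `|z| <= n -> n <= 2^-1 -> `|f' z| <= 2 * n ^+ 2.
  move=> zn n2; have := zn; rewrite ler_norml => z1; have i0 : 0 < 1 + z by lra.
  have n0 : 0 <= n by exact: le_trans zn.
  rewrite /f' ger0_norm ?divr_ge0 -?expr2 ?sqr_ge0 ?(ltW i0)// ler_pdivrMr//.
  have : z ^+ 2 <= n ^+ 2 by rewrite -real_normK ?num_real// lerXn2r ?nnegrE.
  have := sqr_ge0 n; move: (z ^+ 2) (n ^+ 2) => z2 m2; nra.
have f0 : f 0 = 0 by rewrite /f addr0 ln1; ring.
move=> t2; have -> : ln (1 + t) - (t - t ^+ 2 / 2) = f t - f 0 by rewrite f0 /f; ring.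
have bd := t2; rewrite ler_norml in bd.
have [t0|t0] := leP 0 t.
  have -> : 2 * `|t| ^+ 3 = 2 * `|t| ^+ 2 * (t - 0) by rewrite (ger0_norm t0); ring.
  apply: (@mvt_bound _ f') => // z /andP[z0 zt]; first by apply: df; rewrite ger0_norm//; lra.
  by apply: f'le => //; rewrite !ger0_norm.
rewrite distrC.
have -> : 2 * `|t| ^+ 3 = 2 * `|t| ^+ 2 * (0 - t) by rewrite (ltr0_norm t0); ring.
apply: (@mvt_bound _ f'); first exact: ltW.
  by move=> z /andP[z0 zt]; apply: df; rewrite ler0_norm//; lra.
by move=> z /andP[z0 zt]; apply: f'le => //; rewrite (ler0_norm zt) (ltr0_norm t0) lerN2.
Qed.

Lemma norm_dot_le2 (x1 x2 y1 y2 : R) :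
  `|x1| <= 1 -> `|x2| <= 1 -> `|y1| <= 1 -> `|y2| <= 1 ->
  `|x1 * y1 + x2 * y2| <= 2.
Proof.
move=> h1 h2 h3 h4; apply: (le_trans (ler_normD _ _)).
rewrite (normrM x1) (normrM x2).
by rewrite (_ : 2 = 1 + 1)//; apply: lerD; rewrite mulr_ile1.
Qed.

End RealDerivatives.

(** * Energy and doubled phase; the effect of a kick *)

Section Oscillator.
Variable R : realType.
Implicit Types q u v : R.

(* With phase [phi], [u = r cos phi] and [v = - sqrt q * r sin phi], the three
   functions below are [q r^2], [cos (2 phi)] and [- sin (2 phi)]. *)
Definition osc_energy q u v := q * u ^+ 2 + v ^+ 2.
Definition osc_cos q u v := (q * u ^+ 2 - v ^+ 2) / osc_energy q u v.
Definition osc_sin q u v := 2 * Num.sqrt q * u * v / osc_energy q u v.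

Lemma osc_energy_gt0 q u v : 0 < q -> 0 < u ^+ 2 + v ^+ 2 -> 0 < osc_energy q u v.
Proof.
move=> q0 uv; rewrite /osc_energy.
have := sqr_ge0 u; rewrite le_eqVlt => /orP[/eqP u0|u0].
  by rewrite -u0 mulr0 add0r; rewrite -u0 add0r in uv.
by rewrite ltr_wpDr ?sqr_ge0// mulr_gt0.
Qed.

Lemma osc_cos2Dsin2 q u v : 0 < q -> 0 < u ^+ 2 + v ^+ 2 ->
  osc_cos q u v ^+ 2 + osc_sin q u v ^+ 2 = 1.
Proof.
move=> q0 uv; have m0 := osc_energy_gt0 q0 uv.
rewrite /osc_cos /osc_sin !expr_div_n !exprMn sqr_sqrtr ?ltW//.
have m2 : osc_energy q u v ^+ 2 != 0 by rewrite expf_neq0// gt_eqF.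
by apply: (mulIf m2); rewrite mulrDl !divfK// mul1r /osc_energy; ring.
Qed.

Lemma osc_cos_le1 q u v : 0 < q -> 0 < u ^+ 2 + v ^+ 2 -> `|osc_cos q u v| <= 1.
Proof.
move=> q0 /(osc_cos2Dsin2 q0) h.
by rewrite -(@expr_le1 _ 2)// real_normK ?num_real// -h lerDl sqr_ge0.
Qed.

Lemma osc_sin_le1 q u v : 0 < q -> 0 < u ^+ 2 + v ^+ 2 -> `|osc_sin q u v| <= 1.
Proof.
move=> q0 /(osc_cos2Dsin2 q0) h.
by rewrite -(@expr_le1 _ 2)// real_normK ?num_real// -h lerDr sqr_ge0.
Qed.

Section Kick.
Variables (b u v g : R).
Hypothesis b0 : 0 < b.
Hypothesis uv : 0 < u ^+ 2 + v ^+ 2.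
Let q := b ^+ 2.
Let gam := g / b.
Hypothesis gam4 : `|gam| <= 4^-1.
Let m := osc_energy q u v.
Let D := osc_cos q u v.
Let E := osc_sin q u v.
Let t := gam * E + gam ^+ 2 * (1 + D) / 2.

Let q0 : 0 < q. Proof. exact: exprn_gt0. Qed.
Let m0 : 0 < m. Proof. exact: osc_energy_gt0. Qed.
Let D1 : `|D| <= 1. Proof. exact: osc_cos_le1. Qed.
Let E1 : `|E| <= 1. Proof. exact: osc_sin_le1. Qed.
Let sqE : Num.sqrt q = b. Proof. by rewrite /q sqrtr_sqr gtr0_norm. Qed.
Let mn : q * u ^+ 2 + v ^+ 2 != 0. Proof. by rewrite gt_eqF. Qed.

(** Exact, because a kick is the shear [v |-> v + g u] and the energy is quadratic:
    [2 q u^2 = m (1 + D)] and [2 b u v = m E]. *)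
Let kick_energyE : osc_energy q u (v + g * u) = m * (1 + t).
Proof.
rewrite /t /E /D /osc_sin /osc_cos sqE /gam /m /osc_energy.
have := mn; rewrite /q => mn'; field; by rewrite exprMn mn' gt_eqF.
Qed.

Let t_le : `|t| <= 2 * `|gam|.
Proof.
have D2 : `|1 + D| <= 2.
  by apply: le_trans (ler_normD _ _) _; rewrite normr1; have := D1; lra.
rewrite /t; apply: le_trans (ler_normD _ _) _.
rewrite (normrM gam) (normrM _ 2^-1) (normrM (gam ^+ 2)) normrX (@ger0_norm _ 2^-1)//.
have t1 : `|gam| * `|E| <= `|gam| * 1 by rewrite ler_wpM2l.
have t2 : `|gam| ^+ 2 * `|1 + D| / 2 <= `|gam| ^+ 2.
  rewrite ler_pdivrMr// ler_wpM2l ?exprn_ge0//.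
have := gam4; have := normr_ge0 gam; move: `|gam| t1 t2 => x t1 t2 x0 x4; nra.
Qed.

Let t2 : `|t| <= 2^-1.
Proof. by apply: le_trans t_le _; have := gam4; lra. Qed.

Let t1_gt0 : 2^-1 <= 1 + t.
Proof. by have := t2; rewrite ler_norml; lra. Qed.

(** The term [- gam^2 E^2 / 2] is the leading part of [- t^2 / 2]. The constant is [18 = 16 + 2]:
    [2 |t|^3 <= 16 |gam|^3] from the Taylor remainder, and [2 |gam|^3] for the rest of [t^2 / 2]. *)
Lemma kick_energy : `|ln (osc_energy q u (v + g * u)) - ln m -
   (gam * E + gam ^+ 2 * ((1 + D - E ^+ 2) / 2))| <= 18 * `|gam| ^+ 3.
Proof.
have tp : 0 < 1 + t by have := t1_gt0; lra.
rewrite kick_energyE lnM ?posrE// (addrC (ln m)) addrK.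
have h := ln1D_taylor2 t2.
have -> : ln (1 + t) - (gam * E + gam ^+ 2 * ((1 + D - E ^+ 2) / 2)) =
   (ln (1 + t) - (t - t ^+ 2 / 2)) -
   gam ^+ 3 * (E * (1 + D) / 2 + gam * (1 + D) ^+ 2 / 8).
  by rewrite {3 4}/t; field.
apply: (le_trans (ler_normB _ _)).
have g0 : 0 <= `|gam| by [].
have r1 : 2 * `|t| ^+ 3 <= 16 * `|gam| ^+ 3.
  have : `|t| ^+ 3 <= (2 * `|gam|) ^+ 3 by rewrite lerXn2r ?nnegrE ?mulr_ge0.
  by rewrite exprMn; lra.
have r2 : `|gam ^+ 3 * (E * (1 + D) / 2 + gam * (1 + D) ^+ 2 / 8)| <= `|gam| ^+ 3 * 2.
  rewrite normrM normrX ler_wpM2l ?exprn_ge0//.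
  have := D1; have := E1; have := gam4; rewrite !ler_norml => /andP[g1 g2] /andP[e1 e2] /andP[d1 d2].
  have a1 : - 2 <= E * (1 + D) <= 2 by apply/andP; split; nra.
  have a2 : 0 <= (1 + D) ^+ 2 <= 4 by apply/andP; split; [exact: sqr_ge0|nra].
  move: a1 a2 => /andP[a1 a1'] /andP[a2 a2'].
  have a3 : - 1 <= gam * (1 + D) ^+ 2 <= 1 by apply/andP; split; nra.
  by move: a3 => /andP[a3 a3']; apply/andP; split; lra.
by move: r1 r2 h; lra.
Qed.

Lemma kick_cos : `|osc_cos q u (v + g * u) - D| <= 8 * `|gam|.
Proof.
have tp : 0 < 1 + t by have := t1_gt0; lra.
have e : osc_cos q u (v + g * u) - D = - t * (1 + D) / (1 + t).
  have k := kick_energyE; rewrite /osc_cos k.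
  (* The kick leaves [u] alone, so the sum of this quantity and the energy is [2 q u^2] before and
     after it. *)
  have -> : q * u ^+ 2 - (v + g * u) ^+ 2 = m * (D - t).
    have : osc_energy q u (v + g * u) + (q * u ^+ 2 - (v + g * u) ^+ 2) = m * (1 + D).
      rewrite /D /osc_cos -/m; have := gt_eqF m0 => mn0.
      by rewrite /m /osc_energy; field; rewrite mn.
    by rewrite k => h; apply: (addrI (m * (1 + t))); rewrite h; ring.
  by move: m m0 => n n0; field; rewrite !gt_eqF.
rewrite e (normrM _ (1 + t)^-1) (normrM (- t)) normfV normrN (gtr0_norm tp) ler_pdivrMr//.
have D2 : `|1 + D| <= 2.
  by apply: le_trans (ler_normD _ _) _; rewrite normr1; have := D1; lra.
have h1 : `|t| * `|1 + D| <= `|t| * 2 by rewrite ler_wpM2l.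
have h2 : 8 * `|gam| * 2^-1 <= 8 * `|gam| * (1 + t) by rewrite ler_wpM2l ?mulr_ge0.
apply: (le_trans h1); apply: le_trans h2; have := t_le; lra.
Qed.

Lemma kick_sin : `|osc_sin q u (v + g * u) - E| <= 8 * `|gam|.
Proof.
have tp : 0 < 1 + t by have := t1_gt0; lra.
have e : osc_sin q u (v + g * u) - E = (gam * (1 + D) - t * E) / (1 + t).
  have k := kick_energyE; rewrite /osc_sin k.
  have -> : 2 * Num.sqrt q * u * (v + g * u) = m * (E + gam * (1 + D)).
    rewrite /D /E /osc_cos /osc_sin sqE /gam /m /osc_energy.
    by have := mn; rewrite /q => mn'; field; rewrite exprMn mn' gt_eqF.
  by move: m m0 => n n0; field; rewrite !gt_eqF.
rewrite e (normrM _ (1 + t)^-1) normfV (gtr0_norm tp) ler_pdivrMr//.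
apply: (le_trans (ler_normB _ _)); rewrite (normrM gam) (normrM t).
have D2 : `|1 + D| <= 2.
  by apply: le_trans (ler_normD _ _) _; rewrite normr1; have := D1; lra.
have h1 : `|gam| * `|1 + D| <= `|gam| * 2 by rewrite ler_wpM2l.
have h2 : `|t| * `|E| <= `|t| * 1 by rewrite ler_wpM2l.
have h3 : 8 * `|gam| * 2^-1 <= 8 * `|gam| * (1 + t) by rewrite ler_wpM2l ?mulr_ge0.
apply: (le_trans (lerD h1 h2)); apply: le_trans h3; have := t_le; lra.
Qed.

End Kick.
End Oscillator.

(** * Free evolution over a unit interval *)

Section FreeEvolution.
Variable R : realType.
Variables (F En : R) (u v : R -> R).
Hypothesis F0 : 0 < F.
Hypothesis du : forall x : R, is_derive x 1 u (v x).
Hypothesis dv : forall x : R, is_derive x 1 v (- (F * x + En) * u x).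
Hypothesis uv0 : forall x, 0 < u x ^+ 2 + v x ^+ 2.

Let q x := F * x + En.
Let m x := q x * u x ^+ 2 + v x ^+ 2.
Let D x := (q x * u x ^+ 2 - v x ^+ 2) / m x.
Let Ee x := 2 * Num.sqrt (q x) * u x * v x / m x.

Let dq (x : R) : is_derive x 1 q F.
Proof. by apply: deq (dadd (dmul (dcst F x) (did x)) (dcst En x)) _; ring. Qed.

Let dm (x : R) : is_derive x 1 m (F * u x ^+ 2).
Proof.
have := dadd (dmul (dq x) (dmul (du x) (du x))) (dmul (dv x) (dv x)).
by move=> /deq; apply; rewrite -/(q x); ring.
Qed.

Section Interval.
Variable a : R.
Hypothesis qa : 1 <= F * a + En.

Let q1 x : a <= x -> 1 <= q x.
Proof.
move=> ax; apply: le_trans qa _; rewrite lerD2r ler_wpM2l ?(ltW F0)//.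
Qed.

Let q0 x : a <= x -> 0 < q x.
Proof. by move=> /q1; exact: lt_le_trans. Qed.

Let m0 x : a <= x -> 0 < m x.
Proof.
move=> ax; apply: lt_le_trans (uv0 x) _; rewrite lerD2r ler_peMl ?sqr_ge0//.
exact: q1.
Qed.

Let sq0 x : a <= x -> 0 < Num.sqrt (q x).
Proof. by move=> /q0; rewrite sqrtr_gt0. Qed.

Let sqK x : a <= x -> Num.sqrt (q x) ^+ 2 = q x.
Proof. by move=> /q0 /ltW; exact: sqr_sqrtr. Qed.

Let DE1 x : a <= x -> D x ^+ 2 + Ee x ^+ 2 = 1.
Proof.
move=> ax; rewrite /D /Ee !expr_div_n !exprMn sqK//.
have h := m0 ax; have : m x ^+ 2 != 0 by rewrite expf_neq0// gt_eqF.
by move=> h2; apply: (mulIf h2); rewrite mulrDl !divfK// mul1r /m; ring.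
Qed.

Let D1 x : a <= x -> `|D x| <= 1.
Proof.
by move=> /DE1 h; rewrite -(@expr_le1 _ 2)// real_normK ?num_real// -h lerDl sqr_ge0.
Qed.

Let E1 x : a <= x -> `|Ee x| <= 1.
Proof.
by move=> /DE1 h; rewrite -(@expr_le1 _ 2)// real_normK ?num_real// -h lerDr sqr_ge0.
Qed.

(** Together with the derivative of [Ee] this is motion on the unit circle with angular velocity
    [2 sqrt q + F Ee / (2 q)]: the local rotation plus a drift due to the change of [q]. *)
Let dD (x : R) : a <= x ->
  is_derive x 1 D (2 * Num.sqrt (q x) * Ee x + F / (2 * q x) * Ee x ^+ 2).
Proof.
move=> ax; have mx := m0 ax; have qx := q0 ax; have sx := sq0 ax.
have mn : m x != 0 by rewrite gt_eqF.
have := dmul (dsub (dmul (dq x) (dmul (du x) (du x))) (dmul (dv x) (dv x)))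
  (dinv mn (dm x)).
move=> /deq; apply; rewrite -/(q x) /Ee.
have e1 : q x = Num.sqrt (q x) ^+ 2 by rewrite sqK.
have mn2 : Num.sqrt (q x) ^+ 2 * u x ^+ 2 + v x ^+ 2 != 0 by rewrite -e1.
rewrite /m; move: (Num.sqrt (q x)) sx e1 mn2 => s s0 -> mn2.
by field; rewrite exprMn mn2 gt_eqF.
Qed.

Let dsqrt (x : R) : a <= x ->
  is_derive x 1 (fun t => Num.sqrt (q t)) (F / (2 * Num.sqrt (q x))).
Proof.
move=> ax; have := dcomp (is_derive1_sqrt (q0 ax)) (dq x).
by move=> /deq; apply; rewrite mulrC.
Qed.

Let dE (x : R) : a <= x ->
  is_derive x 1 Ee (- (2 * Num.sqrt (q x) * D x) - F / (2 * q x) * D x * Ee x).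
Proof.
move=> ax; have mx := m0 ax; have qx := q0 ax; have sx := sq0 ax.
have mn : m x != 0 by rewrite gt_eqF.
have := dmul (dmul (dmul (dmul (dcst 2 x) (dsqrt ax)) (du x)) (dv x)) (dinv mn (dm x)).
move=> /deq; apply; rewrite -/(q x) /Ee /D.
have e1 : q x = Num.sqrt (q x) ^+ 2 by rewrite sqK.
have mn2 : Num.sqrt (q x) ^+ 2 * u x ^+ 2 + v x ^+ 2 != 0 by rewrite -e1.
rewrite /m; move: (Num.sqrt (q x)) sx e1 mn2 => s s0 -> mn2.
by field; rewrite exprMn mn2 gt_eqF.
Qed.

Let s0 := Num.sqrt (q a).

Let s0_ge1 : 1 <= s0.
Proof. by rewrite /s0 -sqrtr1 ler_wsqrtr. Qed.

Let s0_gt0 : 0 < s0.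
Proof. exact: lt_le_trans s0_ge1. Qed.

Let s0_le x : a <= x -> s0 <= Num.sqrt (q x).
Proof. by move=> ax; rewrite ler_wsqrtr// lerD2r ler_wpM2l ?(ltW F0). Qed.

Let sq_drift x : a <= x <= a + 1 -> 0 <= Num.sqrt (q x) - s0 <= F / s0.
Proof.
move=> /andP[ax xa]; have h := s0_le ax; rewrite subr_ge0 h /=.
have e1 : Num.sqrt (q x) ^+ 2 - s0 ^+ 2 = F * (x - a).
  by rewrite sqK// /s0 sqK// /q; ring.
rewrite ler_pdivlMr//.
have e2 : F * (x - a) <= F by rewrite ler_piMr ?(ltW F0)//; lra.
rewrite -e1 in e2; have := s0_gt0; move: s0 (Num.sqrt (q x)) h e2 => b s h e2 b0.
nra.
Qed.

Let tau (x : R) := 2 * s0 * (x - a).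

Let dtau (x : R) : is_derive x 1 tau (2 * s0).
Proof. by apply: deq (dmul (dcst (2 * s0) x) (dsub (did x) (dcst a x))) _; ring. Qed.

(** The constant is [5 = 4 + 1]: the frequency moves by at most [F / s0] across the interval, and
    [q x >= s0]. *)
Let drift_bound x (A B : R) : a <= x <= a + 1 -> `|A| <= 2 -> `|B| <= 2 ->
  `|2 * (Num.sqrt (q x) - s0) * A + F / (2 * q x) * B| <= 5 * (F / s0).
Proof.
move=> xa hA hB; have /andP[d0 d1] := sq_drift xa; have [ax _] := andP xa.
apply: (le_trans (ler_normD _ _)); rewrite !normrM.
rewrite (@ger0_norm _ 2)// (ger0_norm d0) (@ger0_norm _ F) ?(ltW F0)//.
rewrite (@ger0_norm _ (2 * q x)^-1); last first.
  by rewrite invr_ge0 mulr_ge0// ltW// q0.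
have t1 : 2 * (Num.sqrt (q x) - s0) * `|A| <= 2 * (F / s0) * 2.
  by apply: ler_pM => //; [rewrite mulr_ge0|rewrite ler_wpM2l].
have t2 : F / (2 * q x) * `|B| <= F / s0.
  apply: (@le_trans _ _ (F / (2 * q x) * 2)).
    by rewrite ler_wpM2l// divr_ge0 ?mulr_ge0 ?(ltW F0) ?(ltW (q0 ax)).
  have -> : F / (2 * q x) * 2 = F / q x by field; rewrite gt_eqF// q0.
  rewrite ler_wpM2l ?(ltW F0)// lef_pV2 ?posrE ?q0//.
  rewrite -(sqK ax); have h := s0_le ax; have := s0_ge1.
  move: s0 (Num.sqrt (q x)) h => b z bz b1; nra.
by lra.
Qed.

Let cs1 (z : R) : `|cos z| <= 1. Proof. by rewrite ler_norml cos_geN1 cos_le1. Qed.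
Let sn1 (z : R) : `|sin z| <= 1. Proof. by rewrite ler_norml sin_geN1 sin_le1. Qed.

Let p x := D x * cos (tau x) - Ee x * sin (tau x).
Let r x := Ee x * cos (tau x) + D x * sin (tau x).

Let dp_le : `|p (a + 1) - p a| <= 5 * (F / s0).
Proof.
pose p' x := 2 * (Num.sqrt (q x) - s0) * (Ee x * cos (tau x) + D x * sin (tau x)) +
   F / (2 * q x) * ((Ee x * Ee x) * cos (tau x) + (D x * Ee x) * sin (tau x)).
have -> : 5 * (F / s0) = 5 * (F / s0) * (a + 1 - a) by ring.
apply: (@mvt_bound _ _ p'); first by rewrite lerDl.
- move=> x /andP[ax _]; apply: deq (dsub
   (dmul (dD ax) (dcomp (is_derive_cos (tau x)) (dtau x)))
   (dmul (dE ax) (dcomp (is_derive_sin (tau x)) (dtau x)))) _.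
  by rewrite /p'; field; rewrite gt_eqF// q0.
- move=> x xa; have [ax _] := andP xa; apply: drift_bound => //.
    by apply: norm_dot_le2; rewrite ?D1 ?E1.
  by apply: norm_dot_le2 => //; rewrite normrM mulr_ile1 ?D1 ?E1.
Qed.

Let dr_le : `|r (a + 1) - r a| <= 5 * (F / s0).
Proof.
pose r' x := 2 * (Num.sqrt (q x) - s0) * (Ee x * sin (tau x) + D x * - cos (tau x)) +
   F / (2 * q x) * ((Ee x * Ee x) * sin (tau x) + (D x * Ee x) * - cos (tau x)).
have -> : 5 * (F / s0) = 5 * (F / s0) * (a + 1 - a) by ring.
apply: (@mvt_bound _ _ r'); first by rewrite lerDl.
- move=> x /andP[ax _]; apply: deq (dadd
   (dmul (dE ax) (dcomp (is_derive_cos (tau x)) (dtau x)))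
   (dmul (dD ax) (dcomp (is_derive_sin (tau x)) (dtau x)))) _.
  by rewrite /r'; field; rewrite gt_eqF// q0.
- move=> x xa; have [ax _] := andP xa; apply: drift_bound => //.
    by apply: norm_dot_le2; rewrite ?D1 ?E1// normrN.
  by apply: norm_dot_le2; rewrite ?normrN// normrM mulr_ile1 ?D1 ?E1.
Qed.

Let free_rotation_ :
  `|D (a + 1) - (D a * cos (2 * s0) + Ee a * sin (2 * s0))| <= 10 * (F / s0) /\
  `|Ee (a + 1) - (Ee a * cos (2 * s0) - D a * sin (2 * s0))| <= 10 * (F / s0).
Proof.
have ta : tau a = 0 by rewrite /tau subrr mulr0.
have ta1 : tau (a + 1) = 2 * s0 by rewrite /tau; ring.
have pa : p a = D a by rewrite /p ta cos0 sin0 mulr1 mulr0 subr0.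
have ra : r a = Ee a by rewrite /r ta cos0 sin0 mulr1 mulr0 addr0.
have cs := cos2Dsin2 (2 * s0).
have hp := dp_le; have hr := dr_le; rewrite pa in hp; rewrite ra in hr.
have comb (P Q c s : R) : `|P| <= 5 * (F / s0) -> `|Q| <= 5 * (F / s0) -> `|c| <= 1 -> `|s| <= 1 ->
    `|P * c + Q * s| <= 10 * (F / s0).
  move=> hP hQ hc hs; apply: (le_trans (ler_normD _ _)); rewrite !normrM.
  have t1 : `|P| * `|c| <= 5 * (F / s0) * 1 by apply: ler_pM.
  have t2 : `|Q| * `|s| <= 5 * (F / s0) * 1 by apply: ler_pM.
  by lra.
split.
- have -> : D (a + 1) - (D a * cos (2 * s0) + Ee a * sin (2 * s0)) =
     (p (a + 1) - D a) * cos (2 * s0) + (r (a + 1) - Ee a) * sin (2 * s0).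
    apply/eqP; rewrite -subr_eq0 /p /r ta1; apply/eqP.
    transitivity (D (a + 1) * (1 - (cos (2 * s0) ^+ 2 + sin (2 * s0) ^+ 2))); first by ring.
    by rewrite cs subrr mulr0.
  exact: comb.
- have -> : Ee (a + 1) - (Ee a * cos (2 * s0) - D a * sin (2 * s0)) =
     (r (a + 1) - Ee a) * cos (2 * s0) + (p (a + 1) - D a) * - sin (2 * s0).
    apply/eqP; rewrite -subr_eq0 /p /r ta1; apply/eqP.
    transitivity (Ee (a + 1) * (1 - (cos (2 * s0) ^+ 2 + sin (2 * s0) ^+ 2))); first by ring.
    by rewrite cs subrr mulr0.
  by apply: comb => //; rewrite normrN.
Qed.

(** The squared frequencies are variables so that the truncated [bq] can be substituted at the sites
    where it equals the potential. *)
Lemma free_rotation (r0 r1 : R) : r0 = F * a + En -> r1 = r0 + F ->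
  `|osc_cos r1 (u (a + 1)) (v (a + 1)) -
    (osc_cos r0 (u a) (v a) * cos (2 * Num.sqrt r0) +
     osc_sin r0 (u a) (v a) * sin (2 * Num.sqrt r0))| <= 10 * (F / Num.sqrt r0) /\
  `|osc_sin r1 (u (a + 1)) (v (a + 1)) -
    (osc_sin r0 (u a) (v a) * cos (2 * Num.sqrt r0) -
     osc_cos r0 (u a) (v a) * sin (2 * Num.sqrt r0))| <= 10 * (F / Num.sqrt r0).
Proof.
move=> -> ->; have -> : F * a + En + F = F * (a + 1) + En by ring.
exact: free_rotation_.
Qed.

Hypothesis qF : F <= F * a + En.

(** The energy [m] has derivative [F u^2], which is the wanted [F m / (2 q)] plus the oscillating
    [F (q u^2 - v^2) / (2 q)]. As [(u v)' = v^2 - q u^2], adding [N] cancels the oscillation and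
    leaves only the derivative of the coefficient [F / (2 q)]. *)
Let N x := F / (2 * q x) * (u x * v x).
Let M x := m x + N x.

Let uv_le x : a <= x -> `|u x * v x| <= m x / (2 * s0).
Proof.
move=> ax; rewrite ler_pdivlMr ?mulr_gt0//.
have h := s0_le ax; have e1 := sqK ax.
apply: (@le_trans _ _ (`|u x * v x| * (2 * Num.sqrt (q x)))).
  by rewrite ler_wpM2l// ler_wpM2l.
have -> : m x = (Num.sqrt (q x) * `|u x|) ^+ 2 + `|v x| ^+ 2.
  by rewrite exprMn !real_normK ?num_real// e1.
rewrite normrM -subr_ge0.
have -> : (Num.sqrt (q x) * `|u x|) ^+ 2 + `|v x| ^+ 2 - `|u x| * `|v x| * (2 * Num.sqrt (q x))
  = (Num.sqrt (q x) * `|u x| - `|v x|) ^+ 2 by ring.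
exact: sqr_ge0.
Qed.

Let qmono x : a <= x -> q a <= q x.
Proof. by move=> ax; rewrite lerD2r ler_wpM2l ?(ltW F0). Qed.

Let s0E : s0 ^+ 2 = q a.
Proof. by rewrite /s0 sqK. Qed.

Let N_le x : a <= x -> `|N x| <= F / (4 * s0 ^+ 3) * m x.
Proof.
move=> ax; have qx := q0 ax; have qa0 := q0 (lexx a).
rewrite /N normrM ger0_norm ?divr_ge0 ?mulr_ge0 ?(ltW F0) ?(ltW qx)//.
have -> : F / (4 * s0 ^+ 3) * m x = F / (2 * q a) * (m x / (2 * s0)).
  by rewrite -s0E; field; rewrite gt_eqF.
apply: ler_pM => //; first by rewrite divr_ge0 ?mulr_ge0 ?(ltW F0) ?(ltW qx).
  rewrite ler_wpM2l ?(ltW F0)// lef_pV2 ?posrE ?mulr_gt0// ler_wpM2l// qmono//.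
exact: uv_le.
Qed.

Let s0_cube : F / (4 * s0 ^+ 3) <= 4^-1.
Proof.
rewrite ler_pdivrMr ?mulr_gt0 ?exprn_gt0//.
apply: (le_trans qF); rewrite -/(q a) -s0E.
have := s0_ge1; move: s0 => b b1.
have -> : 4^-1 * (4 * b ^+ 3) = b ^+ 2 * b by field.
by rewrite ler_peMr ?sqr_ge0.
Qed.

Let M_ge x : a <= x -> 3 / 4 * m x <= M x.
Proof.
move=> ax; have := N_le ax; rewrite ler_norml => /andP[h _].
have : F / (4 * s0 ^+ 3) * m x <= 4^-1 * m x by rewrite ler_wpM2r ?s0_cube// ltW// m0.
by rewrite /M; lra.
Qed.

Let M0 x : a <= x -> 0 < M x.
Proof. by move=> ax; apply: lt_le_trans (M_ge ax); rewrite mulr_gt0// m0. Qed.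

Let lnM_le x : a <= x -> `|ln (M x) - ln (m x)| <= F / (2 * s0 ^+ 3).
Proof.
move=> ax; have mx := m0 ax; have Mx := M0 ax.
rewrite -ln_div ?posrE//.
have -> : M x / m x = 1 + N x / m x by rewrite /M mulrDl mulfV// gt_eqF.
have t1 : `|N x / m x| <= F / (4 * s0 ^+ 3).
  by rewrite normrM normfV (gtr0_norm mx) ler_pdivrMr// N_le.
apply: le_trans (ln1D_le (le_trans t1 _)) _.
  by apply: le_trans s0_cube _; lra.
have -> : F / (2 * s0 ^+ 3) = 2 * (F / (4 * s0 ^+ 3)) by field; rewrite gt_eqF.
by rewrite ler_wpM2l.
Qed.

Let G x := ln (M x) - 2^-1 * ln (q x).

(** Here [3 / 4 = 1 / 2 + 1 / 4]: the first part is the derivative of the coefficient of [N], the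
    second comes from subtracting [F M / (2 q)] in place of [F m / (2 q)]. *)
Let dG x : a <= x -> is_derive x 1 G (- (3 * F ^+ 2 / (4 * q x ^+ 2)) * (u x * v x) / M x).
Proof.
move=> ax; have qx := q0 ax; have Mx := M0 ax.
have q2 : 2 * q x != 0 by rewrite mulf_neq0// gt_eqF.
have dNx := dmul (dmul (dcst F x) (@dinv _ (fun t => 2 * q t) x _ q2 (dmul (dcst 2 x) (dq x)))) (dmul (du x) (dv x)).
have := dsub (dcomp (is_derive1_ln Mx) (dadd (dm x) dNx))
  (dmul (dcst 2^-1 x) (dcomp (is_derive1_ln qx) (dq x))).
move=> /deq; apply; rewrite -/(q x).
have Mn : M x != 0 by rewrite gt_eqF.
have qn : q x != 0 by rewrite gt_eqF.
apply: (mulIf Mn).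
rewrite [in RHS]divfK// mulrBl [(M x)^-1 * _ * _]mulrAC mulVf// mul1r.
rewrite /M /N /m; field.
by rewrite qn.
Qed.

(** The corrected [G] moves by at most [F^2 / s0^3], and passing between [ln M] and [ln m] costs
    [F / (2 s0^3)] at each end. *)
Let free_energy_ :
  `|(ln (m (a + 1)) - 2^-1 * ln (q (a + 1))) - (ln (m a) - 2^-1 * ln (q a))|
    <= (F + F ^+ 2) / s0 ^+ 3.
Proof.
have a1 : a <= a + 1 by rewrite lerDl.
have hG : `|G (a + 1) - G a| <= F ^+ 2 / s0 ^+ 3 * (a + 1 - a).
  apply: (@mvt_bound _ _ (fun x => - (3 * F ^+ 2 / (4 * q x ^+ 2)) * (u x * v x) / M x)) => //.
    by move=> x /andP[ax _]; exact: dG.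
  move=> x /andP[ax _]; have Mx := M0 ax; have qx := q0 ax; have mx := m0 ax.
  have qa0 := q0 (lexx a).
  have A0 : 0 <= 3 * F ^+ 2 / (4 * q x ^+ 2).
    by rewrite divr_ge0 ?mulr_ge0 ?exprn_ge0 ?(ltW F0) ?(ltW qx).
  rewrite normrM normfV (gtr0_norm Mx) normrM normrN (ger0_norm A0).
  rewrite ler_pdivrMr//.
  apply: (@le_trans _ _ (3 * F ^+ 2 / (4 * q a ^+ 2) * (m x / (2 * s0)))).
    apply: ler_pM => //; last exact: uv_le.
    rewrite ler_wpM2l ?mulr_ge0 ?exprn_ge0 ?(ltW F0)// lef_pV2 ?posrE ?mulr_gt0 ?exprn_gt0//.
    rewrite ler_wpM2l// lerXn2r ?nnegrE ?(ltW qx) ?(ltW qa0)// qmono//.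
  apply: (@le_trans _ _ (F ^+ 2 / s0 ^+ 3 * (3 / 4 * m x))); last first.
    by rewrite ler_wpM2l ?M_ge// divr_ge0 ?exprn_ge0 ?(ltW F0) ?(ltW s0_gt0).
  have -> : 3 * F ^+ 2 / (4 * q a ^+ 2) * (m x / (2 * s0)) =
     F ^+ 2 / s0 ^+ 3 * (3 / 4 * m x) * (2 * s0 ^+ 2)^-1.
    by rewrite -s0E; field; rewrite gt_eqF.
  rewrite ler_piMr//.
    by rewrite !mulr_ge0 ?invr_ge0 ?exprn_ge0 ?mulr_ge0 ?(ltW F0) ?(ltW s0_gt0) ?(ltW mx).
  rewrite invf_le1 ?mulr_gt0 ?exprn_gt0//; have := s0_ge1; move: s0 => b b1; nra.
have h1 := lnM_le (lexx a); have h2 := lnM_le a1.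
have -> : (ln (m (a + 1)) - 2^-1 * ln (q (a + 1))) - (ln (m a) - 2^-1 * ln (q a)) =
   (G (a + 1) - G a) - (ln (M (a + 1)) - ln (m (a + 1))) + (ln (M a) - ln (m a)).
  by rewrite /G; ring.
apply: (le_trans (ler_normD _ _)); apply: (le_trans (lerD (ler_normB _ _) (lexx _))).
have -> : (F + F ^+ 2) / s0 ^+ 3 = F ^+ 2 / s0 ^+ 3 * (a + 1 - a) + F / (2 * s0 ^+ 3) + F / (2 * s0 ^+ 3).
  by field; rewrite gt_eqF.
by apply: lerD => //; apply: lerD.
Qed.

Lemma free_energy (r0 r1 : R) : r0 = F * a + En -> r1 = r0 + F ->
  `|(ln (osc_energy r1 (u (a + 1)) (v (a + 1))) - 2^-1 * ln r1) -
    (ln (osc_energy r0 (u a) (v a)) - 2^-1 * ln r0)| <= (F + F ^+ 2) / Num.sqrt r0 ^+ 3.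
Proof.
move=> -> ->; have -> : F * a + En + F = F * (a + 1) + En by ring.
exact: free_energy_.
Qed.

End Interval.
End FreeEvolution.

(** * Sequences tending to zero *)

Section NullSequences.
Variable R : realType.

Lemma null_le (a c : nat -> R) : c @ \oo --> 0 ->
  (exists K, forall k, (K <= k)%N -> `|a k| <= c k) -> a @ \oo --> 0.
Proof.
move=> /cvgrPdist_le c0 [K HK]; apply/cvgrPdist_le => e e0.
have [K2 _ HK2] := c0 e e0; exists (maxn K K2) => // k /=.
rewrite geq_max => /andP[Kk K2k]; have := HK2 k K2k => /=.
rewrite !sub0r !normrN; apply: le_trans; apply: le_trans (HK k Kk) _.
exact: ler_norm.
Qed.

Lemma null_comb (c1 c2 : R) (a b : nat -> R) : a @ \oo --> 0 -> b @ \oo --> 0 ->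
  c1 * a k + c2 * b k @[k --> \oo] --> 0.
Proof.
move=> a0 b0.
have : c1 * a k + c2 * b k @[k --> \oo] --> c1 * 0 + c2 * 0.
  by apply: cvgD; exact: cvgMl_tmp.
by rewrite !mulr0 addr0.
Qed.

Lemma null_norm (a : nat -> R) : a @ \oo --> 0 -> `|a k| @[k --> \oo] --> 0.
Proof.
move=> a0; have : `|a k| @[k --> \oo] --> `|0 : R| by exact: cvg_norm.
by rewrite normr0.
Qed.

End NullSequences.

(** * Growth of the energy along one realization *)

Section Deterministic.
Variable R : realType.
Variables (F En lam : R) (u v h : nat -> R).
Hypothesis F0 : 0 < F.
Hypothesis uv0 : forall k, 0 < u k ^+ 2 + v k ^+ 2.
(** The data [u k], [v k] are the value and the slope at the site [k + 1] before the kick [h k]; [U]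
    and [V] start from the kicked data and run freely to the site [k + 2]. *)
Hypothesis free : forall k, exists U V : R -> R, [/\
  forall x : R, is_derive x 1 U (V x),
  forall x : R, is_derive x 1 V (- (F * x + En) * U x),
  forall x, 0 < U x ^+ 2 + V x ^+ 2,
  U k.+1%:R = u k /\ V k.+1%:R = v k + h k * u k &
  U k.+2%:R = u k.+1 /\ V k.+2%:R = v k.+1].

Local Notation bq := (bq F En).
Local Notation bw := (bw F En).
Local Notation wt := (wt F En).
Let gam k := h k / bw k.
Let D k := osc_cos (bq k) (u k) (v k).
Let S k := osc_sin (bq k) (u k) (v k).
Let X k := ln (osc_energy (bq k) (u k) (v k)) - 2^-1 * ln (bq k).
Let Vk k := (1 + D k - S k ^+ 2) / 2.

Hypothesis gam0 : gam @ \oo --> 0.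
Hypothesis mart1 : olog (fun n => \sum_(0 <= k < n) S k * gam k).
Hypothesis mart2 : olog (fun n => \sum_(0 <= k < n) Vk k * ((h k ^+ 2 - lam ^+ 2) * wt k)).
Hypothesis mart3 : olog (fun n => \sum_(0 <= k < n) (h k ^+ 2 - lam ^+ 2) * wt k).

Let D1 k : `|D k| <= 1. Proof. by apply: osc_cos_le1; rewrite ?bq_gt0. Qed.
Let S1 k : `|S k| <= 1. Proof. by apply: osc_sin_le1; rewrite ?bq_gt0. Qed.
Let DS1 k : D k ^+ 2 + S k ^+ 2 = 1. Proof. by apply: osc_cos2Dsin2; rewrite ?bq_gt0. Qed.

Let gam_small (e : R) : 0 < e -> exists K, forall k, (K <= k)%N -> `|gam k| <= e.
Proof.
move=> e0; have /cvgrPdist_le/(_ e e0)[K _ HK] := gam0.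
by exists K => k /HK /=; rewrite sub0r normrN.
Qed.

Let bw_null : (bw k)^-1 @[k --> \oo] --> 0.
Proof.
apply/cvgrPdist_le => e e0; have [K HK] := invbw_small En F0 e0.
by exists K => // k /HK /=; rewrite sub0r normrN ger0_norm// invr_ge0 ltW// bw_gt0.
Qed.

Let bound k := 10 * F * (bw k)^-1 + 16 * `|gam k|.

Let bound_null : bound @ \oo --> 0.
Proof. by apply: null_comb => //; exact: null_norm. Qed.

Let cs1 (z : R) : `|cos z| <= 1. Proof. by rewrite ler_norml cos_geN1 cos_le1. Qed.
Let sn1 (z : R) : `|sin z| <= 1. Proof. by rewrite ler_norml sin_geN1 sin_le1. Qed.

(** One kick followed by one free interval. In [bound], [10 F / b] is the error of the free rotation
    and [16 |gam|] that of a kick moving each of [D] and [S] by at most [8 |gam|]. *)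
Let step : exists K, forall k, (K <= k)%N -> [/\
  `|D k.+1 - (D k * cos (2 * bw k) + S k * sin (2 * bw k))| <= bound k,
  `|S k.+1 - (S k * cos (2 * bw k) - D k * sin (2 * bw k))| <= bound k &
  `|X k.+1 - X k - (S k * gam k + Vk k * gam k ^+ 2)|
     <= (F + F ^+ 2) * (bw k)^-1 ^+ 3 + 18 * `|gam k| ^+ 3].
Proof.
have [K1 HK1] := bq_large En F0; have [K2 HK2] := bq_step En F0.
have [K3 HK3] := bq_unbounded En F0 F.
have [K4 HK4] := @gam_small 4^-1 ltac:(by []).
exists (maxn (maxn K1 K2) (maxn K3 K4)) => k.
rewrite !geq_max => /andP[/andP[/HK1 q1 /HK2 q2] /andP[/HK3 q3 /HK4 g4]].
have [U [V [dU dV UV [Uk Vk_] [Uk1 Vk1]]]] := free k.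
have b0 := bw_gt0 F En k; have b1 := bq_ge1 F En k; have b2 := bw_sqr F En k.
have kn : k.+2%:R = k.+1%:R + 1 :> R by rewrite natr1.
rewrite kn in Uk1 Vk1.
have qa : 1 <= F * k.+1%:R + En by rewrite -q1.
have qF : F <= F * k.+1%:R + En by rewrite -q1.
have [f1 f2] := free_rotation F0 dU dV UV qa q1 q2.
have f3 := free_energy F0 dU dV UV qa qF q1 q2.
rewrite Uk Vk_ Uk1 Vk1 -/(bw k) in f1 f2 f3.
have c1 := kick_cos b0 (uv0 k) g4; have c2 := kick_sin b0 (uv0 k) g4.
have c3 := kick_energy b0 (uv0 k) g4.
rewrite b2 -/(D k) -/(S k) -/(gam k) in c1 c2 c3.
set Dp := osc_cos (bq k) (u k) (v k + h k * u k) in f1 f2 c1.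
set Sp := osc_sin (bq k) (u k) (v k + h k * u k) in f1 f2 c2.
rewrite -/(D k.+1) in f1; rewrite -/(S k.+1) in f2.
have comb (A P Q C s B c : R) : `|A - B| <= 10 * (F / bw k) -> `|P| <= 8 * `|gam k| ->
    `|Q| <= 8 * `|gam k| -> `|c| <= 1 -> `|s| <= 1 ->
    B = C + (P * c + Q * s) -> `|A - C| <= bound k.
  move=> hA hP hQ hc hs eB.
  have -> : A - C = (A - B) + (P * c + Q * s) by rewrite eB; ring.
  apply: (le_trans (ler_normD _ _)); rewrite /bound -mulrA; apply: lerD => //.
  apply: (le_trans (ler_normD _ _)); rewrite (normrM P) (normrM Q).
  have t1 : `|P| * `|c| <= 8 * `|gam k| * 1 by apply: ler_pM.
  have t2 : `|Q| * `|s| <= 8 * `|gam k| * 1 by apply: ler_pM.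
  by apply: (le_trans (lerD t1 t2)); rewrite le_eqVlt; apply/orP; left; apply/eqP; ring.
split.
- apply: (comb _ _ _ _ _ _ _ f1 c1 c2 (cs1 (2 * bw k)) (sn1 (2 * bw k))); ring.
- have c1' : `|- (Dp - D k)| <= 8 * `|gam k| by rewrite normrN.
  apply: (comb _ _ _ _ _ _ _ f2 c2 c1' (cs1 (2 * bw k)) (sn1 (2 * bw k))); ring.
- set e1 := ln (osc_energy (bq k.+1) _ _) - _ in f3.
  have -> : X k.+1 - X k - (S k * gam k + Vk k * gam k ^+ 2) =
    (e1 - (ln (osc_energy (bq k) (u k) (v k + h k * u k)) - 2^-1 * ln (bq k))) +
    (ln (osc_energy (bq k) (u k) (v k + h k * u k)) - ln (osc_energy (bq k) (u k) (v k)) -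
     (gam k * S k + gam k ^+ 2 * ((1 + D k - S k ^+ 2) / 2))).
    by rewrite /X -/e1 /Vk; ring.
  apply: (le_trans (ler_normD _ _)); apply: lerD => //.
  by rewrite exprVn.
Qed.

Let D_null : lognull wt D.
Proof.
have [K HK] := step.
apply: (@rot_lognull _ wt (wt_ge0 F En) (wt_le1 F En) (wt_dec En F0) _ (wt_sum En F0)
  D S (fun k => 2 * bw k)).
- by move=> k; rewrite DS1.
- by apply: bw_step_null.
- by apply: (null_le bound_null); exists K => k /HK[].
- by apply: (null_le bound_null); exists K => k /HK[].
- move=> m m0; have := @lognull_cos_bw _ F En F0 (m%:R * 2) _.
  under eq_fun do rewrite -mulrA.
  by apply; rewrite mulr_gt0// ltr0n.
Qed.

(** The pair [D^2 - S^2], [2 D S] is [(D, S)] with its angle doubled, so it rotates by [4 b] and the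
    same averaging applies. *)
Let DS_null : lognull wt (fun k => D k ^+ 2 - S k ^+ 2).
Proof.
have [K HK] := step.
(* For the cosine, [6 = 3 + 3]: each one-step error is multiplied by a sum of size at most [1 + 2].
   For the sine, [6 = 2 + 4]. *)
have b6 : (fun k => 6 * bound k + 0 * bound k) @ \oo --> 0 by apply: null_comb.
have ab k (x := 2 * bw k) : `|D k * cos x + S k * sin x| <= 2 /\ `|S k * cos x - D k * sin x| <= 2.
  split; first exact: norm_dot_le2.
  by rewrite -mulrN; apply: norm_dot_le2; rewrite ?normrN.
have e4 (x : R) : 4 * x = 2 * (2 * x) by ring.
have dbl (x : R) : cos (2 * x) = cos x ^+ 2 - sin x ^+ 2 /\ sin (2 * x) = 2 * (sin x * cos x).
  by rewrite mulrDl mul1r cosD sinD; split; ring.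
apply: (@rot_lognull _ wt (wt_ge0 F En) (wt_le1 F En) (wt_dec En F0) _ (wt_sum En F0)
  (fun k => D k ^+ 2 - S k ^+ 2) (fun k => 2 * (D k * S k)) (fun k => 2 * (2 * bw k))).
- move=> k; have e := DS1 k.
  have -> : (D k ^+ 2 - S k ^+ 2) ^+ 2 + (2 * (D k * S k)) ^+ 2 = (D k ^+ 2 + S k ^+ 2) ^+ 2 by ring.
  by rewrite e expr1n.
- have := @bw_step_null _ F En F0 4 _.
  by under eq_fun do rewrite !e4; apply.
- apply: (null_le b6); exists K => k /HK[s1 s2 _].
  have [a1 a2] := ab k; have [-> ->] := dbl (2 * bw k).
  set c := cos _ in s1 s2 a1 a2 *; set s := sin _ in s1 s2 a1 a2 *.
  set e1 := D k.+1 - _ in s1; set e2 := S k.+1 - _ in s2.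
  have -> : D k.+1 ^+ 2 - S k.+1 ^+ 2 - ((D k ^+ 2 - S k ^+ 2) * (c ^+ 2 - s ^+ 2) +
      2 * (D k * S k) * (2 * (s * c))) =
      e1 * (D k.+1 + (D k * c + S k * s)) - e2 * (S k.+1 + (S k * c - D k * s)).
    by rewrite /e1 /e2; ring.
  rewrite mul0r addr0; apply: (le_trans (ler_normB _ _)); rewrite !normrM.
  have t1 : `|e1| * `|D k.+1 + (D k * c + S k * s)| <= bound k * 3.
    apply: ler_pM => //; apply: (le_trans (ler_normD _ _)).
    by apply: le_trans (lerD (D1 _) a1) _; lra.
  have t2 : `|e2| * `|S k.+1 + (S k * c - D k * s)| <= bound k * 3.
    apply: ler_pM => //; apply: (le_trans (ler_normD _ _)).
    by apply: le_trans (lerD (S1 _) a2) _; lra.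
  by apply: (le_trans (lerD t1 t2)); rewrite le_eqVlt; apply/orP; left; apply/eqP; ring.
- apply: (null_le b6); exists K => k /HK[s1 s2 _].
  have [a1 a2] := ab k; have [-> ->] := dbl (2 * bw k).
  set c := cos _ in s1 s2 a1 a2 *; set s := sin _ in s1 s2 a1 a2 *.
  set e1 := D k.+1 - _ in s1; set e2 := S k.+1 - _ in s2.
  have -> : 2 * (D k.+1 * S k.+1) - (2 * (D k * S k) * (c ^+ 2 - s ^+ 2) -
      (D k ^+ 2 - S k ^+ 2) * (2 * (s * c))) =
      e1 * (2 * S k.+1) + e2 * (2 * (D k * c + S k * s)).
    by rewrite /e1 /e2; ring.
  rewrite mul0r addr0; apply: (le_trans (ler_normD _ _)).
  rewrite (normrM e1) (normrM e2) !(normrM 2) (@ger0_norm _ 2)//.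
  have t1 : `|e1| * (2 * `|S k.+1|) <= bound k * (2 * 1).
    by apply: ler_pM => //; rewrite ?mulr_ge0// ler_wpM2l.
  have t2 : `|e2| * (2 * `|D k * c + S k * s|) <= bound k * (2 * 2).
    by apply: ler_pM => //; rewrite ?mulr_ge0// ler_wpM2l.
  by apply: (le_trans (lerD t1 t2)); rewrite le_eqVlt; apply/orP; left; apply/eqP; ring.
- move=> m m0; have := @lognull_cos_bw _ F En F0 (m%:R * 4) _.
  under eq_fun do rewrite -mulrA e4.
  by apply; rewrite mulr_gt0// ltr0n.
Qed.

Let gam2 k : gam k ^+ 2 = (h k ^+ 2 - lam ^+ 2) * wt k + lam ^+ 2 * wt k.
Proof. by rewrite /gam wt_bw exprMn; ring. Qed.

(** The one-step remainders are [o(b^-2)] and [o(gam^2)]. This weight dominates both, and its sums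
    are logarithmic because [mart3] trades [h^2] for [lam^2]. *)
Let w k := wt k + gam k ^+ 2.

Let w_ge0 k : 0 <= w k. Proof. by rewrite addr_ge0 ?wt_ge0 ?sqr_ge0. Qed.

Let w_sum : \forall n \near \oo,
  \sum_(0 <= k < n) w k <= ((1 + lam ^+ 2) * ((1 + `|En|) / F) + 1) * (1 + ln n%:R).
Proof.
have /ologP/(_ 1 ltr01) m3 := mart3.
near=> n; have l0 : 0 <= ln n%:R :> R by near: n; exact: near_le_ln.
have hw : \sum_(0 <= k < n) wt k <= (1 + `|En|) / F * (1 + ln n%:R) by near: n; exact: wt_sum.
have h3 : `|\sum_(0 <= k < n) (h k ^+ 2 - lam ^+ 2) * wt k| <= 1 * ln n%:R by near: n.
have -> : \sum_(0 <= k < n) w k = (1 + lam ^+ 2) * \sum_(0 <= k < n) wt k +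
    \sum_(0 <= k < n) (h k ^+ 2 - lam ^+ 2) * wt k.
  by rewrite mulr_sumr -big_split; apply: eq_bigr => k _; rewrite /w gam2 /=; ring.
rewrite [leRHS]mulrDl -[(1 + lam ^+ 2) * _ * _]mulrA; apply: lerD.
  by rewrite ler_wpM2l// addr_ge0 ?sqr_ge0.
apply: (le_trans (ler_norm _)); apply: (le_trans h3); rewrite !mul1r; lra.
Unshelve. all: by end_near. Qed.

Lemma log_energy_growth : olog (fun n => X n - lam ^+ 2 / (4 * F) * ln n%:R).
Proof.
pose r k := X k.+1 - X k - (S k * gam k + Vk k * gam k ^+ 2).
have o1 : olog (fun n => \sum_(0 <= k < n) r k).
  apply: (olog_sum_small w_ge0 w_sum) => e e0.
  have [K HK] := step.
  have FF : 0 < F + F ^+ 2 by rewrite addr_gt0 ?exprn_gt0.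
  have [K1 HK1] := invbw_small En F0 (divr_gt0 e0 FF).
  have [K2 HK2] := gam_small (divr_gt0 e0 (ltr0Sn R 17)).
  exists (maxn K (maxn K1 K2)) => k; rewrite !geq_max => /and3P[/HK[_ _ hr] /HK1 b1 /HK2 g1].
  apply: (le_trans hr); rewrite /w mulrDr; apply: lerD.
    rewrite wt_bw exprS mulrA ler_wpM2r ?sqr_ge0// mulrC -ler_pdivlMr//.
  rewrite exprS mulrA real_normK ?num_real// ler_wpM2r ?sqr_ge0//.
  by rewrite mulrC -ler_pdivlMr.
(* As [D^2 + S^2 = 1], [(1 + D - S^2) / 2 = 1 / 4 + D / 2 + (D^2 - S^2) / 4], and the last two terms
   have zero logarithmic mean. *)
have o4 : olog (fun n => \sum_(0 <= k < n) Vk k * wt k - (4 * F)^-1 * ln n%:R).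
  have := ologD (ologM 4^-1 (wt_log_mean En F0)) (ologD (ologM 2^-1 D_null) (ologM 4^-1 DS_null)).
  congr olog; apply/funext => n; rewrite /wsum.
  rewrite mulrBr -addrA [- _ + _]addrC addrA; congr (_ - _); last first.
    by rewrite mulrA -invfM.
  rewrite !mulr_sumr -!big_split /=; apply: eq_bigr => k _.
  rewrite /Vk; have e : S k ^+ 2 = 1 - D k ^+ 2 by rewrite -(DS1 k); ring.
  by rewrite e; field.
have o5 := ologD o1 (ologD mart1 (ologD mart2 (ologM (lam ^+ 2) o4))).
have o6 : olog (fun=> X 0) by apply: (@olog_bounded _ _ `|X 0|); near=> n.
have := ologD o5 o6; congr olog; apply/funext => n.
rewrite mulrBr mulr_sumr.
have -> : \sum_(0 <= k < n) r k = (X n - X 0) - (\sum_(0 <= k < n) S k * gam k +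
   (\sum_(0 <= k < n) Vk k * ((h k ^+ 2 - lam ^+ 2) * wt k) +
    \sum_(0 <= k < n) lam ^+ 2 * (Vk k * wt k))).
  rewrite -!big_split /= -(telescope_sumr X (leq0n n)) -sumrB; apply: eq_bigr => k _.
  by rewrite /r gam2; ring.
by rewrite invfM; ring.
Unshelve. all: by end_near. Qed.

End Deterministic.

(** * Entire power series *)

Section EntireSeries.
Variable R : realType.
Implicit Types c : nat -> R.

Definition entire c := forall r : R, 1 <= r -> exists M : R, forall n, `|c n| * r ^+ n <= M.

(** The factor [n + 1] is at most [2^(n+1)], so the bound at radius [2 r] controls the
    differentiated series at radius [r]. *)
Lemma entire_diffs c : entire c -> entire (pseries_diffs c).
Proof.
move=> ec r r1; have r0 : 0 <= r by lra.
have [M HM] := ec (2 * r) ltac:(lra); exists M => n.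
apply: le_trans (HM n.+1); rewrite /pseries_diffs normrM ger0_norm//.
rewrite [n.+1%:R * _]mulrC -mulrA ler_wpM2l//.
rewrite exprMn [r ^+ n.+1]exprS; apply: ler_pM => //; first exact: exprn_ge0.
  by rewrite -natrX ler_nat; apply: ltnW; exact: ltn_expl.
by rewrite ler_peMl// exprn_ge0.
Qed.

Lemma entire_cvg c x : entire c -> cvgn (pseries c x).
Proof.
move=> ec; apply: normed_cvg; rewrite /normed_series_of /=.
have [M HM] := ec (2 * (1 + `|x|)) ltac:(by have := normr_ge0 x; lra).
have x0 : 0 <= `|x| by [].
have x1 : 0 <= 2 * (1 + `|x|) by lra.
have M0 : 0 <= M by apply: le_trans (HM 0%N); rewrite mulr_ge0// exprn_ge0.
apply: (@series_le_cvg _ _ (geometric M 2^-1)) => //.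
- by move=> n /=; rewrite mulr_ge0// exprn_ge0.
- move=> n /=; rewrite -ler_pdivrMr ?exprn_gt0// exprVn invrK.
  apply: le_trans (HM n); rewrite normrM normrX -mulrA ler_wpM2l//.
  rewrite exprMn mulrC ler_wpM2l ?exprn_ge0// lerXn2r ?nnegrE//; lra.
- by apply: is_cvg_geometric_series; rewrite ger0_norm//; lra.
Qed.

Lemma entire_derive c (x : R) : entire c ->
  is_derive x 1 (fun z => limn (pseries c z)) (limn (pseries (pseries_diffs c) x)).
Proof.
move=> ec; apply: (@pseries_snd_diffs _ c (`|x| + 1)).
- exact: entire_cvg.
- by apply: entire_cvg; exact: entire_diffs.
- by apply: entire_cvg; do 2 apply: entire_diffs.
- by rewrite (@ger0_norm _ (`|x| + 1)) ?addr_ge0// ltrDl.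
Qed.

Lemma pseries_at0 c : limn (pseries c 0) = c 0%N.
Proof.
apply/cvg_lim => //; rewrite -cvg_shiftS /=.
rewrite (_ : (fun n => _) = fun=> c 0%N); first exact: cvg_cst.
apply/funext => n; rewrite /pseries /series /= big_nat_recl// expr0 mulr1.
by rewrite big1 ?addr0// => i _; rewrite exprS mul0r mulr0.
Qed.

End EntireSeries.

(** * The Airy series and their differential equation *)

Section AiryCoefficients.
Variable R : realType.

Section Recurrence.
Variable c : nat -> R.
Hypothesis c2 : c 2 = 0.
Hypothesis cS : forall n, c n.+3 = c n / (n.+2%:R * n.+3%:R).

(** Once [n >= r^3], passing from [n] to [n + 3] does not increase [|c n| r^n]; all terms are thus
    bounded by the sum of the first [N + 3]. *)
Lemma airy_rec_entire : entire c.
Proof.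
move=> r r1; have r0 : 0 < r by lra.
pose b n := `|c n| * r ^+ n.
have b0 n : 0 <= b n by rewrite mulr_ge0// exprn_ge0// ltW.
have [N _ HN] := nbhs_infty_ger (r ^+ 3).
have bS n : (N <= n)%N -> b n.+3 <= b n.
  move=> Nn; rewrite /b cS normrM normfV.
  have p0 : 0 < n.+2%:R * n.+3%:R :> R by rewrite mulr_gt0 ?ltr0n.
  rewrite (gtr0_norm p0) mulrAC ler_pdivrMr// -addn3 exprD mulrA ler_wpM2l ?b0//.
  apply: le_trans (HN n Nn) _.
  by rewrite -natrM ler_nat; lia.
exists (\sum_(0 <= i < N.+3) b i) => n; rewrite -/(b n).
elim/ltn_ind: n => n IH; have [nN|Nn] := ltnP n N.+3.
  rewrite (bigD1_seq n) ?mem_index_iota ?iota_uniq//= lerDl sumr_ge0//.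
have -> : n = (n - 3).+3 by lia.
by apply: (le_trans (bS _ _)); [lia|apply: IH; lia].
Qed.

(** The twice differentiated series starts with [2 c_2 = 0], and its later partial sums are those of
    [x] times the series, one index behind. *)
Lemma airy_rec_ode x :
  limn (pseries (pseries_diffs (pseries_diffs c)) x) = x * limn (pseries c x).
Proof.
apply/cvg_lim => //; rewrite -cvg_shiftS /=.
rewrite (_ : (fun n => _) = (fun n => x * pseries c x n)).
  by apply: cvgMl_tmp; apply: entire_cvg; exact: airy_rec_entire.
apply/funext => n; rewrite /pseries /series /= big_nat_recl// /pseries_diffs c2.
rewrite !(mulr0, mul0r, add0r) mulr_sumr; apply: eq_bigr => i _.
have h2 : i.+2%:R != 0 :> R by rewrite pnatr_eq0.
have h3 : i.+3%:R != 0 :> R by rewrite pnatr_eq0.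
rewrite cS exprS; move: (i.+2%:R : R) (i.+3%:R : R) h2 h3 => a b a0 b0.
by field; rewrite a0 b0.
Qed.

End Recurrence.

Lemma limn_triple (S T : nat -> R) : cvgn S -> (forall n, T n = S (3 * n)%N) ->
  limn T = limn S.
Proof.
move=> /cvgrPdist_le cS TS; apply/cvg_lim => //; apply/cvgrPdist_le => e e0.
have [K _ HK] := cS e e0; exists K => // n /= Kn; rewrite TS; apply: HK => /=.
by apply: leq_trans Kn _; lia.
Qed.

(** The series of [airy_f] with zeros at the missing exponents: its partial sums of length [3 n] are
    those defining [airy_f], and it can be differentiated termwise as an ordinary power series. *)
Definition airy_fcoef n : R := if (n %% 3 == 0)%N then airy_af R (n %/ 3) else 0.
Definition airy_gcoef n : R := if (n %% 3 == 1)%N then airy_bg R (n %/ 3) else 0.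

Lemma modn3S n : (n.+3 %% 3 = n %% 3)%N.
Proof. lia. Qed.

Lemma divn3S n : (n.+3 %/ 3 = (n %/ 3).+1)%N.
Proof. lia. Qed.

Lemma airy_fcoefS n : airy_fcoef n.+3 = airy_fcoef n / (n.+2%:R * n.+3%:R).
Proof.
rewrite /airy_fcoef modn3S divn3S; case: eqP => [n3|_]; last by rewrite mul0r.
rewrite /= (_ : (3 * (n %/ 3) + 2)%N = n.+2); last by lia.
by rewrite (_ : (3 * (n %/ 3) + 3)%N = n.+3)//; lia.
Qed.

Lemma airy_gcoefS n : airy_gcoef n.+3 = airy_gcoef n / (n.+2%:R * n.+3%:R).
Proof.
rewrite /airy_gcoef modn3S divn3S; case: eqP => [n3|_]; last by rewrite mul0r.
rewrite /= (_ : (3 * (n %/ 3) + 3)%N = n.+2); last by lia.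
by rewrite (_ : (3 * (n %/ 3) + 4)%N = n.+3)//; lia.
Qed.

Lemma airy_fE : @airy_f R = fun x => limn (pseries airy_fcoef x).
Proof.
apply/funext => x; apply: limn_triple.
  by apply: entire_cvg; apply: airy_rec_entire; exact: airy_fcoefS.
elim=> [|n IH]; first by rewrite muln0 /pseries /series /= !big_geq.
have e : (3 * n.+1 = (3 * n).+3)%N by lia.
rewrite e /pseries /series /= !big_nat_recr//= IH /pseries /series /=.
rewrite /airy_fcoef.
rewrite (_ : (3 * n %% 3 == 0)%N = true); last by lia.
rewrite (_ : ((3 * n).+1 %% 3 == 0)%N = false); last by lia.
rewrite (_ : ((3 * n).+2 %% 3 == 0)%N = false); last by lia.
by rewrite (_ : (3 * n %/ 3)%N = n) ?mul0r ?addr0//; lia.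
Qed.

Lemma airy_gE : @airy_g R = fun x => limn (pseries airy_gcoef x).
Proof.
apply/funext => x; apply: limn_triple.
  by apply: entire_cvg; apply: airy_rec_entire; exact: airy_gcoefS.
elim=> [|n IH]; first by rewrite muln0 /pseries /series /= !big_geq.
have e : (3 * n.+1 = (3 * n).+3)%N by lia.
rewrite e /pseries /series /= !big_nat_recr//= IH /pseries /series /=.
rewrite /airy_gcoef.
rewrite (_ : (3 * n %% 3 == 1)%N = false); last by lia.
rewrite (_ : ((3 * n).+1 %% 3 == 1)%N = true); last by lia.
rewrite (_ : ((3 * n).+2 %% 3 == 1)%N = false); last by lia.
by rewrite (_ : ((3 * n).+1 %/ 3)%N = n) ?mul0r ?addr0 ?addn1//; lia.
Qed.

Definition airy_f' (x : R) := limn (pseries (pseries_diffs airy_fcoef) x).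
Definition airy_g' (x : R) := limn (pseries (pseries_diffs airy_gcoef) x).

Lemma is_derive_airy_f (x : R) : is_derive x 1 (@airy_f R) (airy_f' x).
Proof.
by rewrite airy_fE; apply: entire_derive; apply: airy_rec_entire; exact: airy_fcoefS.
Qed.

Lemma is_derive_airy_g (x : R) : is_derive x 1 (@airy_g R) (airy_g' x).
Proof.
by rewrite airy_gE; apply: entire_derive; apply: airy_rec_entire; exact: airy_gcoefS.
Qed.

Lemma is_derive_airy_f' (x : R) : is_derive x 1 airy_f' (x * airy_f x).
Proof.
rewrite airy_fE -airy_rec_ode//; last exact: airy_fcoefS.
by apply: entire_derive; apply: entire_diffs; apply: airy_rec_entire; exact: airy_fcoefS.
Qed.

Lemma is_derive_airy_g' (x : R) : is_derive x 1 airy_g' (x * airy_g x).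
Proof.
rewrite airy_gE -airy_rec_ode//; last exact: airy_gcoefS.
by apply: entire_derive; apply: entire_diffs; apply: airy_rec_entire; exact: airy_gcoefS.
Qed.

Lemma airy_wronskian (x : R) : airy_f x * airy_g' x - airy_f' x * airy_g x = 1.
Proof.
have f0 : airy_f (0 : R) = 1.
  by rewrite airy_fE pseries_at0 /airy_fcoef.
have f'0 : airy_f' 0 = 0.
  by rewrite /airy_f' pseries_at0 /pseries_diffs /airy_fcoef mulr0.
have g0 : airy_g (0 : R) = 0.
  by rewrite airy_gE pseries_at0 /airy_gcoef.
have g'0 : airy_g' 0 = 1.
  by rewrite /airy_g' pseries_at0 /pseries_diffs /airy_gcoef mulr1.
transitivity (airy_f 0 * airy_g' 0 - airy_f' 0 * airy_g 0); last first.
  by rewrite f0 f'0 g'0; ring.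
apply: (derive0_const (f := fun x => airy_f x * airy_g' x - airy_f' x * airy_g x)) => z.
apply: deq (dsub (dmul (is_derive_airy_f z) (is_derive_airy_g' z))
  (dmul (is_derive_airy_f' z) (is_derive_airy_g z))) _.
by ring.
Qed.

End AiryCoefficients.

(** * Finiteness and positivity of Gamma on the interval from 0 to 1 *)

Section GammaPositive.
Variable R : realType.
Variable s : R.
Hypothesis s0 : 0 < s.
Hypothesis s1 : s <= 1.
Local Notation mu := (@lebesgue_measure R).

Let f (t : R) : R := powR t (s - 1) * expR (- t).

Let f_ge0 t : 0 <= f t.
Proof. by rewrite mulr_ge0 ?powR_ge0 ?expR_ge0. Qed.

Let mexp (D : set R) : measurable_fun D (fun t : R => expR (- t)).
Proof.
apply: measurable_funTS; exact: measurableT_comp.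
Qed.

Let mf (D : set R) : measurable_fun D (EFin \o f).
Proof.
apply/measurable_EFinP; apply: measurable_funM; last exact: mexp.
by apply: measurable_funTS; exact: measurable_powR.
Qed.

Let mp (D : set R) : measurable_fun D (fun t : R => (powR t (s - 1))%:E).
Proof. by apply/measurable_EFinP; apply: measurable_funTS; exact: measurable_powR. Qed.

Lemma integral_powR_itvcc (e : R) : 0 < e -> e < 1 ->
  (\int[mu]_(t in `[e, 1%R]) (powR t (s - 1))%:E <= (s^-1)%:E)%E.
Proof.
move=> e0 e1.
have dF (t : R) : e <= t -> is_derive t 1 (fun z : R => s^-1 * powR z s) (powR t (s - 1)).
  move=> et; have t0 : 0 < t by exact: lt_le_trans et.
  apply: deq (dmul (dcst s^-1 t) (is_derive1_powR s t0)) _.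
  by rewrite mulr0 addr0 mulKf// gt_eqF.
have cF (t : R) : e <= t -> {for t, continuous (fun z : R => s^-1 * powR z s)}.
  move=> et; apply: differentiable_continuous; apply/derivable1_diffP.
  by have [] := dF t et.
rewrite (@continuous_FTC2 _ _ (fun t => s^-1 * powR t s))//.
- rewrite powR1 mulr1 -EFinB lee_fin lerBlDr lerDl.
  by rewrite mulr_ge0 ?powR_ge0// invr_ge0 ltW.
- apply: derivable_within_continuous => t; rewrite in_itv /= => /andP[et _].
  have t0 : 0 < t by exact: lt_le_trans et.
  by have [] := is_derive1_powR (s - 1) t0.
- split.
  + by move=> t; rewrite in_itv /= => /andP[et _]; have [] := dF t (ltW et).
  + by apply: cvg_at_right_filter; exact: cF.
  + by apply: cvg_at_left_filter; apply: cF; exact: ltW.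
- move=> t; rewrite in_itv /= => /andP[et _]; rewrite derive1E.
  by have h := dF t (ltW et); rewrite derive_val.
Qed.

Lemma integral_powR_itvoc :
  (\int[mu]_(t in `]0%R, 1%R]) (powR t (s - 1))%:E <= (s^-1)%:E)%E.
Proof.
(* The left endpoints [1 / (n + 2)] stay below 1, where the bound [1 / s] is uniform; monotone
   convergence carries it to the singular endpoint 0. *)
pose I (n : nat) := `[(n.+2%:R)^-1, 1%R]%classic : set R.
have UI : \bigcup_n I n = `]0%R, 1%R]%classic.
  apply/seteqP; split => t /=.
    move=> [n _]; rewrite /I /= !in_itv /= => /andP[nt ->]; rewrite andbT.
    by apply: lt_le_trans nt; rewrite invr_gt0.
  rewrite in_itv /= => /andP[t0 t1].
  have [k] := ltr_add_invr t0; rewrite add0r => kt.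
  exists k => //; rewrite /I /= in_itv /= t1 andbT; apply: le_trans (ltW kt).
  by rewrite lef_pV2 ?posrE// ler_nat.
have cv : (\int[mu]_(t in I n) (powR t (s - 1))%:E)%E @[n --> \oo] -->
    (\int[mu]_(t in \bigcup_n I n) (powR t (s - 1))%:E)%E.
  apply: ge0_nondecreasing_set_cvg_integral.
  - move=> n m nm; apply/subsetPset => t; rewrite /I /= !in_itv /= => /andP[nt ->].
    by rewrite andbT; apply: le_trans nt; rewrite lef_pV2 ?posrE// ler_nat.
  - by move=> n; exact: measurable_itv.
  - by move=> n; exact: mp.
  - by move=> n t _; rewrite lee_fin powR_ge0.
rewrite -UI -(cvg_lim _ cv)//.
apply: lime_le; first by apply/cvg_ex; eexists; exact: cv.
apply: nearW => n; apply: integral_powR_itvcc; first by rewrite invr_gt0.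
by rewrite invf_lt1// ltr1n.
Qed.

(** Finiteness matters because [fine] sends an infinite integral to 0. The integrand is below
    [t^(s-1)] up to 1 and below the exponential density beyond. *)
Lemma Gamma_integral_fin :
  (\int[mu]_(t in `]0%R, +oo[) (f t)%:E < +oo)%E.
Proof.
have -> : `]0%R, +oo[%classic = `]0%R, 1%R] `|` `]1%R, +oo[ :> set R.
  by rewrite -itv_bndbnd_setU ?bnd_simp ?ler01.
rewrite ge0_integral_setU//=; first last.
- apply/disj_setPRL => t /=; rewrite !in_itv /= andbT => t1; apply/negP.
  by rewrite negb_and -ltNge t1 orbT.
- by move=> t _; rewrite lee_fin.
- exact: mf.
apply: lte_add_pinfty.
- apply: (@le_lt_trans _ _ (s^-1)%:E); last exact: ltry.
  apply: le_trans integral_powR_itvoc; apply: ge0_le_integral => //.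
  + by move=> t _; rewrite lee_fin.
  + exact: mf.
  + exact: mp.
  + move=> t /=; rewrite in_itv /= => /andP[t0 _]; rewrite lee_fin ler_piMr ?powR_ge0//.
    by rewrite -expR0 ler_expR lerNl oppr0 ltW.
- apply: (@le_lt_trans _ _ 1%E); last exact: ltry.
  rewrite -(@integral_exponential_pdf R 1 ltr01).
  apply: (@le_trans _ _ (\int[mu]_(t in `]1%R, +oo[) (exponential_pdf 1 t)%:E)%E).
    apply: ge0_le_integral => //.
    + by move=> t _; rewrite lee_fin.
    + exact: mf.
    + by apply/measurable_EFinP; apply: measurable_funTS; exact: measurable_exponential_pdf.
    + move=> t /=; rewrite in_itv /= andbT => t1; rewrite lee_fin.
      have t0 : 0 <= t by lra.
      rewrite /exponential_pdf patchE ifT; last by rewrite inE /= in_itv /= t0.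
      rewrite mulN1r mul1r ler_piMl ?expR_ge0//.
      rewrite -[leRHS](powRr0 t); apply: ler_powR; first exact: ltW.
      by rewrite subr_le0.
  apply: ge0_subset_integral => //.
  + by apply/measurable_EFinP; exact: measurable_exponential_pdf.
  + by move=> t _; rewrite lee_fin exponential_pdf_ge0.
Qed.

Lemma Gamma_gt0 : 0 < Gamma s.
Proof.
rewrite /Gamma; apply: fine_gt0; apply/andP; split; last exact: Gamma_integral_fin.
apply: (@lt_le_trans _ _ (\int[mu]_(t in `[1%R, 2%R]) (powR 2 (s - 1) * expR (- 2))%:E)%E).
  rewrite integral_cst//= lebesgue_measure_itv /= lte_fin ltr1n /= -EFinD -EFinM lte_fin.
  rewrite mulr_gt0// ?mulr_gt0 ?powR_gt0 ?expR_gt0//; lra.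
apply: (@le_trans _ _ (\int[mu]_(t in `[1%R, 2%R]) (f t)%:E)%E).
  apply: ge0_le_integral => //.
  - exact: mf.
  - move=> t /=; rewrite in_itv /= => /andP[t1 t2]; rewrite lee_fin.
    apply: ler_pM; rewrite ?powR_ge0 ?expR_ge0 ?ler_expR ?lerN2//.
    have t0 : 0 < t by lra.
    have -> : s - 1 = - (1 - s) by ring.
    rewrite !powRN lef_pV2 ?posrE ?powR_gt0//.
    by apply: ge0_ler_powR; rewrite ?nnegrE ?subr_ge0// ltW.
apply: ge0_subset_integral => //.
- exact: mf.
- by move=> t _; rewrite lee_fin.
- move=> t /=; rewrite !in_itv /= andbT => /andP[t1 _]; lra.
Qed.

End GammaPositive.

(** * Airy solutions of the free equation *)

Section AirySolutions.
Variable R : realType.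
Variables (F E : R).
Hypothesis F0 : 0 < F.

Definition stark_scale : R := powR F (1 / 3).
Local Notation kk := stark_scale.

Lemma stark_scale_gt0 : 0 < kk.
Proof. exact: powR_gt0. Qed.

Lemma stark_scale_cube : kk ^+ 3 = F.
Proof.
rewrite -powR_mulrn ?powR_ge0// -powRrM (_ : 1 / 3 * 3%:R = 1) ?powRr1 ?ltW//.
by field.
Qed.

Definition stark_arg (x : R) := - kk * (x + E / F).
Definition stark_f x := airy_f (stark_arg x).
Definition stark_g x := airy_g (stark_arg x).
Definition stark_f' x := - kk * airy_f' (stark_arg x).
Definition stark_g' x := - kk * airy_g' (stark_arg x).

Lemma is_derive_stark_arg (x : R) : is_derive x 1 stark_arg (- kk).
Proof.
by apply: deq (dmul (dcst (- kk) x) (dadd (did x) (dcst (E / F) x))) _; ring.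
Qed.

Lemma is_derive_stark_f (x : R) : is_derive x 1 stark_f (stark_f' x).
Proof.
apply: deq (dcomp (is_derive_airy_f (stark_arg x)) (is_derive_stark_arg x)) _.
by rewrite mulrC.
Qed.

Lemma is_derive_stark_g (x : R) : is_derive x 1 stark_g (stark_g' x).
Proof.
apply: deq (dcomp (is_derive_airy_g (stark_arg x)) (is_derive_stark_arg x)) _.
by rewrite mulrC.
Qed.

Let arg_sqr x : - kk * (stark_arg x * - kk) = - (F * x + E).
Proof.
rewrite /stark_arg; transitivity (- (kk ^+ 3 * (x + E / F))); first by ring.
by rewrite stark_scale_cube; field; rewrite gt_eqF.
Qed.

Lemma is_derive_stark_f' (x : R) : is_derive x 1 stark_f' (- (F * x + E) * stark_f x).
Proof.
apply: deq (dmul (dcst (- kk) x)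
  (dcomp (is_derive_airy_f' (stark_arg x)) (is_derive_stark_arg x))) _.
by rewrite mulr0 addr0 -arg_sqr /stark_f; ring.
Qed.

Lemma is_derive_stark_g' (x : R) : is_derive x 1 stark_g' (- (F * x + E) * stark_g x).
Proof.
apply: deq (dmul (dcst (- kk) x)
  (dcomp (is_derive_airy_g' (stark_arg x)) (is_derive_stark_arg x))) _.
by rewrite mulr0 addr0 -arg_sqr /stark_g; ring.
Qed.

Lemma stark_wronskian x : stark_f x * stark_g' x - stark_f' x * stark_g x = - kk.
Proof.
transitivity (- kk * (airy_f (stark_arg x) * airy_g' (stark_arg x) -
  airy_f' (stark_arg x) * airy_g (stark_arg x))); first by rewrite /stark_f /stark_f' /stark_g /stark_g'; ring.
by rewrite airy_wronskian mulr1.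
Qed.

Definition stark_sol (c : R * R) x := c.1 * stark_f x + c.2 * stark_g x.
Definition stark_sol' (c : R * R) x := c.1 * stark_f' x + c.2 * stark_g' x.

Lemma is_derive_stark_sol c (x : R) : is_derive x 1 (stark_sol c) (stark_sol' c x).
Proof.
apply: deq (dadd (dmul (dcst c.1 x) (is_derive_stark_f x))
  (dmul (dcst c.2 x) (is_derive_stark_g x))) _.
by rewrite /stark_sol'; ring.
Qed.

Lemma is_derive_stark_sol' c (x : R) :
  is_derive x 1 (stark_sol' c) (- (F * x + E) * stark_sol c x).
Proof.
apply: deq (dadd (dmul (dcst c.1 x) (is_derive_stark_f' x))
  (dmul (dcst c.2 x) (is_derive_stark_g' x))) _.
by rewrite /stark_sol; ring.
Qed.

(** Cramer's rule, the determinant being the constant Wronskian [- kk]. *)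
Lemma stark_sol_inv (c : R * R) x :
  c.1 = - (stark_sol c x * stark_g' x - stark_sol' c x * stark_g x) / kk /\
  c.2 = - (stark_f x * stark_sol' c x - stark_f' x * stark_sol c x) / kk.
Proof.
have W := stark_wronskian x; have k0 := stark_scale_gt0.
have kn : kk != 0 by rewrite gt_eqF.
split; apply: (mulIf kn); rewrite divfK// -[kk in LHS]opprK -W /stark_sol /stark_sol'; ring.
Qed.

Lemma stark_sol_gt0 (c : R * R) x : 0 < c.1 ^+ 2 + c.2 ^+ 2 ->
  0 < stark_sol c x ^+ 2 + stark_sol' c x ^+ 2.
Proof.
move=> c0; rewrite lt_neqAle addr_ge0 ?sqr_ge0// andbT eq_sym.
rewrite paddr_eq0 ?sqr_ge0// !sqrf_eq0; apply/negP => /andP[/eqP u0 /eqP v0].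
have [c1 c2] := stark_sol_inv c x.
by move: c0; rewrite c1 c2 u0 v0 !(mul0r, mulr0, subrr, oppr0) expr0n /= addr0 ltxx.
Qed.

Lemma stark_sol_eq (c c' : R * R) x : stark_sol c x = stark_sol c' x ->
  stark_sol' c x = stark_sol' c' x -> c = c'.
Proof.
move=> e e'; have [c1 c2] := stark_sol_inv c x; have [c1' c2'] := stark_sol_inv c' x.
rewrite e e' in c1 c2.
by rewrite [LHS]surjective_pairing [RHS]surjective_pairing c1 c1' c2 c2'.
Qed.

(* The Wronskians with the two Airy solutions are constant. *)
Lemma ode_stark_sol (psi : R -> R) (a b : R) : a < b ->
  (forall x : R, a < x < b -> [/\ derivable psi x 1, derivable (derive1 psi) x 1 &
     - derive1n 2 psi x - F * x * psi x = E * psi x]) ->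
  exists c, forall x, a < x < b ->
    psi x = stark_sol c x /\ derive1 psi x = stark_sol' c x.
Proof.
move=> ab ode.
have d1 (x : R) : a < x < b -> is_derive x 1 psi (derive1 psi x).
  by move=> /ode[h _ _]; apply: DeriveDef => //; rewrite derive1E.
have d2 (x : R) : a < x < b -> is_derive x 1 (derive1 psi) (- (F * x + E) * psi x).
  move=> /ode[_ h e]; apply: DeriveDef => //; rewrite -derive1E.
  have -> : derive1 (derive1 psi) x = derive1n 2 psi x by [].
  by rewrite mulNr mulrDl -e; ring.
pose w1 x := psi x * stark_g' x - derive1 psi x * stark_g x.
pose w2 x := stark_f x * derive1 psi x - stark_f' x * psi x.
pose z := (a + b) / 2.
have zab : a < z < b by rewrite /z; apply/andP; split; lra.
have w1c x : a < x < b -> w1 x = w1 z.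
  move=> xab; apply: (@derive0_const_oo _ w1 a b) => // t tab.
  apply: deq (dsub (dmul (d1 t tab) (is_derive_stark_g' t)) (dmul (d2 t tab) (is_derive_stark_g t))) _.
  by ring.
have w2c x : a < x < b -> w2 x = w2 z.
  move=> xab; apply: (@derive0_const_oo _ w2 a b) => // t tab.
  apply: deq (dsub (dmul (is_derive_stark_f t) (d2 t tab)) (dmul (is_derive_stark_f' t) (d1 t tab))) _.
  by ring.
exists (- w1 z / kk, - w2 z / kk) => x xab.
have kn : kk != 0 by rewrite gt_eqF// stark_scale_gt0.
have W := stark_wronskian x.
rewrite -(w1c x xab) -(w2c x xab) /stark_sol /stark_sol' /=.
split; apply: (mulIf kn); rewrite mulrDl ![_ / kk * _ * kk]mulrAC !divfK// -[kk]opprK -W /w1 /w2; ring.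
Qed.

End AirySolutions.

(** * One-sided limits *)

Section OneSidedLimits.
Variable R : realType.

Lemma is_derive_continuous (f : R -> R) (x d : R) : is_derive x 1 f d -> {for x, continuous f}.
Proof.
by move=> [h _]; apply: differentiable_continuous; apply/derivable1_diffP.
Qed.

Lemma is_derive_cvg_right (f : R -> R) (x d : R) : is_derive x 1 f d -> f @ x^'+ --> f x.
Proof. by move=> /is_derive_continuous h; exact: cvg_at_right_filter. Qed.

Lemma is_derive_cvg_left (f : R -> R) (x d : R) : is_derive x 1 f d -> f @ x^'- --> f x.
Proof. by move=> /is_derive_continuous h; exact: cvg_at_left_filter. Qed.

Lemma lim_right_eq (f g : R -> R) (p b l l' : R) : p < b ->
  (forall x, p < x < b -> f x = g x) -> f @ p^'+ --> l -> g @ p^'+ --> l' -> l = l'.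
Proof.
move=> pb fg fl gl; apply: (@cvg_unique _ _ (f @ p^'+)) => //.
apply: cvg_trans gl; apply: near_eq_cvg; near=> x; apply/esym; apply: fg.
by apply/andP; split; near: x; [exact: nbhs_right_gt|exact: nbhs_right_lt].
Unshelve. all: by end_near. Qed.

Lemma lim_left_eq (f g : R -> R) (a p l l' : R) : a < p ->
  (forall x, a < x < p -> f x = g x) -> f @ p^'- --> l -> g @ p^'- --> l' -> l = l'.
Proof.
move=> ap fg fl gl; apply: (@cvg_unique _ _ (f @ p^'-)) => //.
apply: cvg_trans gl; apply: near_eq_cvg; near=> x; apply/esym; apply: fg.
by apply/andP; split; near: x; [exact: nbhs_left_gt|exact: nbhs_left_lt].
Unshelve. all: by end_near. Qed.

End OneSidedLimits.

(** * Recursion for the Airy coordinates of a solution *)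

Section TransferRecursion.
Variable R : realType.
Variables (F E th0 : R).
Hypothesis F0 : 0 < F.
Local Notation kk := (stark_scale F).
Local Notation sol := (stark_sol F E).
Local Notation sol' := (stark_sol' F E).

Definition stark_data (u v x : R) : R * R :=
  (- (u * stark_g' F E x - v * stark_g F E x) / kk,
   - (stark_f F E x * v - stark_f' F E x * u) / kk).

Lemma stark_dataE u v x : sol (stark_data u v x) x = u /\ sol' (stark_data u v x) x = v.
Proof.
have kn : kk != 0 by rewrite gt_eqF// stark_scale_gt0.
have W := stark_wronskian F E x.
rewrite /stark_sol /stark_sol' /stark_data /=.
by split; apply: (mulIf kn); rewrite mulrDl ![_ / kk * _ * kk]mulrAC !divfK// -[kk]opprK -W; ring.
Qed.

(* [stark_coef h k] gives the Airy coordinates of the solution on ]k, k + 1[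
   when the coupling at the site k + 1 is [h k]. *)
Fixpoint stark_coef (h : nat -> R) (k : nat) : R * R :=
  match k with
  | 0%N => stark_data (sin th0) (cos th0) 0
  | k'.+1 => let c := stark_coef h k' in
     stark_data (sol c k'.+1%:R) (sol' c k'.+1%:R + h k' * sol c k'.+1%:R) k'.+1%:R
  end.

Lemma stark_data_gt0 u v x : 0 < u ^+ 2 + v ^+ 2 ->
  0 < (stark_data u v x).1 ^+ 2 + (stark_data u v x).2 ^+ 2.
Proof.
move=> uv; rewrite lt_neqAle addr_ge0 ?sqr_ge0// andbT eq_sym.
rewrite paddr_eq0 ?sqr_ge0// !sqrf_eq0; apply/negP => /andP[/eqP c1 /eqP c2].
have [e1 e2] := stark_dataE u v x.
have u0 : u = 0 by rewrite -e1 /stark_sol c1 c2 !mul0r addr0.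
have v0 : v = 0 by rewrite -e2 /stark_sol' c1 c2 !mul0r addr0.
by move: uv; rewrite u0 v0 expr0n /= addr0 ltxx.
Qed.

Lemma stark_coef_gt0 h k : 0 < (stark_coef h k).1 ^+ 2 + (stark_coef h k).2 ^+ 2.
Proof.
elim: k => [|k IH] /=; apply: stark_data_gt0.
  by rewrite addrC cos2Dsin2.
have := stark_sol_gt0 E F0 k.+1%:R IH; set u := sol _ _; set v := sol' _ _ => uv.
rewrite lt_neqAle addr_ge0 ?sqr_ge0// andbT eq_sym.
rewrite paddr_eq0 ?sqr_ge0// !sqrf_eq0; apply/negP => /andP[/eqP u0 /eqP v0].
rewrite u0 mulr0 addr0 in v0.
by move: uv; rewrite u0 v0 expr0n /= addr0 ltxx.
Qed.

(** Continuity and the jump condition fix the value and the slope to the right of each site from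
    those to its left, so the couplings and initial data determine the solution. This replaces [psi]
    by an explicit function of finitely many couplings. *)
Lemma gen_eigen_solution_stark (g : nat -> R) (psi : R -> R) :
  is_gen_eigen_solution F E th0 g psi -> forall (k : nat) (x : R), k%:R < x < k.+1%:R ->
    psi x = sol (stark_coef (fun j => g j.+1) k) x.
Proof.
move=> [psic psi0 dpsi0 ode jump].
have kS (k : nat) : k%:R < k.+1%:R :> R by rewrite ltr_nat.
have piece k : exists c, forall x, k%:R < x < k.+1%:R ->
    psi x = sol c x /\ derive1 psi x = sol' c x.
  apply: ode_stark_sol => // x /andP[kx xk]; apply: ode.
    by apply: le_lt_trans kx; rewrite ler0n.
  move=> n; apply/negP => /eqP xn; rewrite xn !ltr_nat in kx xk.
  by move: xk; rewrite ltnS leqNgt kx.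
have /continuous_within_itvcyP[cpsi cpsi0] := psic.
(* Stated for arbitrary coordinates representing [psi] on the interval, so that the induction
   hypothesis applies to those supplied by [piece]. *)
suff H k c : (forall x, k%:R < x < k.+1%:R -> psi x = sol c x /\ derive1 psi x = sol' c x) ->
    c = stark_coef (fun j => g j.+1) k.
  move=> k x kx; have [c Hc] := piece k; have [-> _] := Hc x kx.
  by rewrite -(H k c Hc).
elim: k c => [|k IH] c Hc.
  have [d1 d2] := stark_dataE (sin th0) (cos th0) 0.
  apply: (@stark_sol_eq _ F E F0 _ _ 0); rewrite [RHS]/= ?d1 ?d2 -?psi0.
    apply/esym; apply: (@lim_right_eq _ psi (sol c) 0 1) => //.
      by move=> x xc; have [] := Hc x xc.
    exact: is_derive_cvg_right (is_derive_stark_sol F E c 0).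
  apply/esym; apply: (@lim_right_eq _ (derive1 psi) (sol' c) 0 1) => //.
    by move=> x xc; have [] := Hc x xc.
  exact: is_derive_cvg_right (is_derive_stark_sol' E F0 c 0).
have [c0 Hc0] := piece k; rewrite /= -(IH c0 Hc0).
set p := k.+1%:R in Hc *.
have p0 : 0 < p by rewrite ltr0n.
have kp : k%:R < p := kS k.
have pk : p < k.+2%:R := kS k.+1.
have cp : {for p, continuous psi} by apply: cpsi; rewrite in_itv /= p0.
have pl : psi p = sol c0 p.
  apply: (@lim_left_eq _ psi (sol c0) k%:R p) => //.
  - by move=> x xc; have [] := Hc0 x xc.
  - exact: cvg_at_left_filter.
  - exact: is_derive_cvg_left (is_derive_stark_sol F E c0 p).
have pr : psi p = sol c p.
  apply: (@lim_right_eq _ psi (sol c) p k.+2%:R) => //.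
  - by move=> x xc; have [] := Hc x xc.
  - exact: cvg_at_right_filter.
  - exact: is_derive_cvg_right (is_derive_stark_sol F E c p).
(* On either side [psi'] agrees with the slope of a smooth free solution, so the limit of the jump
   is the value of the continuous function [j] at 0. *)
have J : g k.+1 * psi p = sol' c p - sol' c0 p.
  pose j (e : R) := sol' c (p + e) - sol' c0 (p - e).
  have -> : sol' c p - sol' c0 p = j 0 by rewrite /j addr0 subr0.
  apply: (@lim_right_eq _ (fun e => derive1 psi (p + e) - derive1 psi (p - e)) j 0 1) => //.
  - move=> e /andP[e0 e1]; rewrite /j.
    have [_ ->] : psi (p + e) = sol c (p + e) /\ derive1 psi (p + e) = sol' c (p + e).
      by apply: Hc; rewrite ltrDl e0 /= -[k.+2%:R]natr1 ltrD2l.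
    have [_ -> //] : psi (p - e) = sol c0 (p - e) /\ derive1 psi (p - e) = sol' c0 (p - e).
    apply: Hc0; rewrite gtrBl e0 andbT /p -natr1; lra.
  - exact: jump.
  - have dj := dsub
      (@dcomp _ (sol' c) (fun e => p + e) 0 _ _
        (is_derive_stark_sol' E F0 c (p + 0)) (dadd (dcst p 0) (did 0)))
      (@dcomp _ (sol' c0) (fun e => p - e) 0 _ _
        (is_derive_stark_sol' E F0 c0 (p - 0)) (dsub (dcst p 0) (did 0))).
    exact: (@is_derive_cvg_right _ j 0 _ dj).
have [d1 d2] := stark_dataE (sol c0 p) (sol' c0 p + g k.+1 * sol c0 p) p.
apply: (@stark_sol_eq _ F E F0 _ _ p); rewrite ?d1 ?d2.
  by rewrite -pr pl.
by rewrite -pl J; ring.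
Qed.

End TransferRecursion.

(** * Comparison of the site energy with the norm of the coordinates *)

Section LogComparison.
Variable R : realType.

Lemma ln_comparable (l u x y : R) : 0 < l -> 0 < u -> 0 < x -> 0 < y ->
  l * x <= y -> y <= u * x -> `|ln y - ln x| <= `|ln l| + `|ln u|.
Proof.
move=> l0 u0 x0 y0 ly yu.
have h1 : ln l + ln x <= ln y by rewrite -lnM ?posrE// ler_ln ?posrE ?mulr_gt0.
have h2 : ln y <= ln u + ln x by rewrite -lnM ?posrE// ler_ln ?posrE ?mulr_gt0.
have := ler_norm (- ln l); have := ler_norm (ln u); rewrite normrN.
have := normr_ge0 (ln l); have := normr_ge0 (ln u).
by move=> a1 a2 a3 a4; rewrite ler_norml; apply/andP; split; lra.
Qed.

End LogComparison.

Section EnergyOfCoordinates.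
Variable R : realType.
Variables (F E : R).
Hypothesis F0 : 0 < F.
Local Notation kk := (stark_scale F).
Local Notation sol := (stark_sol F E).
Local Notation sol' := (stark_sol' F E).
Local Notation bq := (bq F E).
Local Notation bw := (bw F E).

Definition site_energy (c : R * R) k :=
  ln (osc_energy (bq k) (sol c k.+1%:R) (sol' c k.+1%:R)) - 2^-1 * ln (bq k).

Let csqr (c : R * R) := c.1 ^+ 2 + c.2 ^+ 2.

Lemma site_energy_step : exists K, forall k c, (K <= k)%N -> 0 < csqr c ->
  `|site_energy c k.+1 - site_energy c k| <= (F + F ^+ 2) / bw k ^+ 3.
Proof.
have [K1 HK1] := bq_large E F0; have [K2 HK2] := bq_step E F0.
have [K3 HK3] := bq_unbounded E F0 F.
exists (maxn K1 (maxn K2 K3)) => k c; rewrite !geq_max => /and3P[/HK1 q1 /HK2 q2 /HK3 q3] c0.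
have b1 := bq_ge1 F E k.
have qa : 1 <= F * k.+1%:R + E by rewrite -q1.
have qF : F <= F * k.+1%:R + E by rewrite -q1.
have := free_energy F0 (is_derive_stark_sol F E c) (is_derive_stark_sol' E F0 c)
  (fun x => stark_sol_gt0 E F0 x c0) qa qF q1 q2.
by rewrite natr1.
Qed.

(** At one fixed site the map from coordinates to value and slope is linear and invertible: [A]
    bounds its squared norm and [A / kk^2] that of its inverse, both by Cauchy-Schwarz. *)
Lemma site_energy_csqr K : exists B, forall c, 0 < csqr c ->
  `|site_energy c K - ln (csqr c)| <= B.
Proof.
set f := stark_f F E K.+1%:R; set g := stark_g F E K.+1%:R.
set f' := stark_f' F E K.+1%:R; set g' := stark_g' F E K.+1%:R.
pose A := f ^+ 2 + g ^+ 2 + f' ^+ 2 + g' ^+ 2.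
have k0 := stark_scale_gt0 F0.
have A0 : 0 < A.
  rewrite lt_neqAle !addr_ge0 ?sqr_ge0// andbT eq_sym; apply/negP => /eqP A0.
  have f0 : f ^+ 2 = 0.
    by have := sqr_ge0 f; have := sqr_ge0 g; have := sqr_ge0 f'; have := sqr_ge0 g'; rewrite /A in A0; lra.
  have g0 : g ^+ 2 = 0.
    by have := sqr_ge0 f; have := sqr_ge0 g; have := sqr_ge0 f'; have := sqr_ge0 g'; rewrite /A in A0; lra.
  have W := stark_wronskian F E K.+1%:R; rewrite -/f -/g -/f' -/g' in W.
  move/eqP: f0; rewrite sqrf_eq0 => /eqP f0; move/eqP: g0; rewrite sqrf_eq0 => /eqP g0.
  by move: W; rewrite f0 g0 mul0r mulr0 subrr => /esym/eqP; rewrite oppr_eq0 gt_eqF.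
have b0 := bq_gt0 F E K; have b1 := bq_ge1 F E K.
exists (`|ln (kk ^+ 2 / A)| + `|ln (bq K * A)| + `|2^-1 * ln (bq K)|) => c c0.
have uv := stark_sol_gt0 E F0 K.+1%:R c0.
have [i1 i2] := stark_sol_inv E F0 c K.+1%:R.
have uE : sol c K.+1%:R = c.1 * f + c.2 * g by [].
have vE : sol' c K.+1%:R = c.1 * f' + c.2 * g' by [].
rewrite /site_energy -/f -/g -/f' -/g' in i1 i2 *.
move: (sol c K.+1%:R) (sol' c K.+1%:R) uv i1 i2 uE vE => u v uv i1 i2 uE vE.
have m0 := osc_energy_gt0 b0 uv.
have cs (a1 a2 z1 z2 : R) : (a1 * z1 + a2 * z2) ^+ 2 <= (a1 ^+ 2 + a2 ^+ 2) * (z1 ^+ 2 + z2 ^+ 2).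
  rewrite -subr_ge0 (_ : _ - _ = (a1 * z2 - a2 * z1) ^+ 2) ?sqr_ge0//; ring.
have up : u ^+ 2 + v ^+ 2 <= A * csqr c.
  rewrite uE vE; apply: (le_trans (lerD (cs _ _ _ _) (cs _ _ _ _))).
  by rewrite le_eqVlt; apply/orP; left; apply/eqP; rewrite /A /csqr; ring.
have lo : kk ^+ 2 / A * csqr c <= u ^+ 2 + v ^+ 2.
  rewrite mulrAC ler_pdivrMr//.
  have e1 : kk * c.1 = u * - g' + v * g by rewrite i1 mulrCA mulfV ?gt_eqF//; ring.
  have e2 : kk * c.2 = u * f' + v * - f by rewrite i2 mulrCA mulfV ?gt_eqF//; ring.
  have -> : kk ^+ 2 * csqr c = (kk * c.1) ^+ 2 + (kk * c.2) ^+ 2 by rewrite /csqr; ring.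
  rewrite e1 e2; apply: (le_trans (lerD (cs _ _ _ _) (cs _ _ _ _))).
  by rewrite le_eqVlt; apply/orP; left; apply/eqP; rewrite /A; ring.
have mlo : u ^+ 2 + v ^+ 2 <= osc_energy (bq K) u v.
  by rewrite /osc_energy lerD2r ler_peMl ?sqr_ge0.
have mup : osc_energy (bq K) u v <= bq K * (u ^+ 2 + v ^+ 2).
  by rewrite /osc_energy mulrDr lerD2l ler_peMl ?sqr_ge0.
have h : `|ln (osc_energy (bq K) u v) - ln (csqr c)| <= `|ln (kk ^+ 2 / A)| + `|ln (bq K * A)|.
  apply: ln_comparable => //; rewrite ?divr_gt0 ?mulr_gt0 ?exprn_gt0//.
    exact: le_trans mlo.
  by apply: (le_trans mup); rewrite -mulrA ler_wpM2l// ltW.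
rewrite addrAC; apply: (le_trans (ler_normB _ _)); exact: lerD.
Qed.

(** For each [n] the coordinates [c n] are frozen and transported freely from the site of index [n]
    back to that of a fixed index [K], where the norms are equivalent. Both bounds are uniform in
    the coordinates, so [c n] may change with [n]. *)
Lemma site_energy_olog (c : nat -> R * R) : (forall k, 0 < csqr (c k)) ->
  olog (fun n => site_energy (c n) n - ln (csqr (c n))).
Proof.
move=> c0; have [K HK] := site_energy_step; have [B HB] := site_energy_csqr K.
have FF : 0 < F + F ^+ 2 by rewrite addr_gt0 ?exprn_gt0.
have o1 : olog (fun n => \sum_(0 <= k < n) (F + F ^+ 2) / bw k ^+ 3).
  apply: (olog_sum_small (wt_ge0 F E) (wt_sum E F0)) => e e0.
  have [K1 HK1] := invbw_small E F0 (divr_gt0 e0 FF).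
  exists K1 => k /HK1 b1; have b0 := bw_gt0 F E k.
  rewrite ger0_norm; last by rewrite divr_ge0 ?exprn_ge0 ?(ltW FF) ?(ltW b0).
  rewrite wt_bw -exprVn exprS mulrA ler_wpM2r ?sqr_ge0//.
  by rewrite mulrC -ler_pdivlMr.
have o2 : olog (fun=> `|B|) by apply: (@olog_bounded _ _ `|B|); near=> n; rewrite normr_id.
apply: (olog_le (ologD o1 o2)); near=> n.
have Kn : (K <= n)%N by near: n; exact: nbhs_infty_ge.
have Z0 (m : nat) : 0 <= \sum_(0 <= k < m) (F + F ^+ 2) / bw k ^+ 3.
  by rewrite sumr_ge0// => k _; rewrite divr_ge0 ?exprn_ge0 ?(ltW FF) ?(ltW (bw_gt0 F E k)).
have tel (x : R * R) (m : nat) : 0 < csqr x -> (K <= m)%N ->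
    `|site_energy x m - site_energy x K| <= \sum_(0 <= k < m) (F + F ^+ 2) / bw k ^+ 3.
  move=> x0 Km; rewrite -(telescope_sumr (site_energy x) Km).
  apply: (le_trans (ler_norm_sum _ _ _)).
  apply: (@le_trans _ _ (\sum_(K <= k < m) (F + F ^+ 2) / bw k ^+ 3)).
    by apply: ler_sum_nat => k /andP[Kk _]; exact: HK.
  by rewrite [leRHS](big_cat_nat (leq0n K) Km)//= lerDr Z0.
rewrite [leRHS]ger0_norm ?addr_ge0//.
have -> : site_energy (c n) n - ln (csqr (c n)) =
  (site_energy (c n) n - site_energy (c n) K) + (site_energy (c n) K - ln (csqr (c n))) by ring.
apply: (le_trans (ler_normD _ _)); apply: lerD; first exact: tel.
by apply: (le_trans (HB _ (c0 n))); exact: ler_norm.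
Unshelve. all: by end_near. Qed.

End EnergyOfCoordinates.

(** * The Prüfer radius and the Airy coordinates *)

Section PruferRadius.
Variable R : realType.
Variables (F E : R).
Hypothesis F0 : 0 < F.
Local Notation sol := (stark_sol F E).
Local Notation sol' := (stark_sol' F E).

(** The difference vanishes on the interval, so the mean value theorem gives a point where the
    slopes agree as well as the values. *)
Lemma stark_sol_unique (c c' : R * R) (a b : R) : a < b ->
  (forall x, a < x < b -> sol c x = sol c' x) -> c = c'.
Proof.
move=> ab e; pose x := (2 * a + b) / 3; pose y := (a + 2 * b) / 3.
have xy : x < y by rewrite /x /y; lra.
pose d z := sol c z - sol c' z.
have dd (z : R) : is_derive z 1 d (sol' c z - sol' c' z).
  exact: dsub (is_derive_stark_sol F E c z) (is_derive_stark_sol F E c' z).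
have d0 z : a < z < b -> d z = 0 by move=> /e ze; rewrite /d ze subrr.
have cd : {within `[x, y], continuous d}.
  by apply: derivable_within_continuous => z _; have [] := dd z.
have [z] := MVT xy (fun z _ => dd z) cd.
rewrite in_itv /= => /andP[xz zy].
have axb : a < x < b by rewrite /x; apply/andP; split; lra.
have ayb : a < y < b by rewrite /y; apply/andP; split; lra.
have azb : a < z < b.
  by case/andP: axb => ax _; case/andP: ayb => _ yb; rewrite (lt_trans ax xz) (lt_trans zy yb).
rewrite (d0 y ayb) (d0 x axb) subrr => /esym/eqP.
rewrite mulf_eq0 [y - x == 0]gt_eqF ?subr_gt0// orbF subr_eq0 => /eqP e'.
exact: (stark_sol_eq F0 (e z azb) e').
Qed.

Let kap : R := Num.sqrt (pi / powR F (1 / 3)).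
Let C1 : R := airy_c1 R.
Let C2 : R := airy_c2 R.
Let s3 : R := Num.sqrt 3.

Let kap_gt0 : 0 < kap.
Proof. by rewrite sqrtr_gt0 divr_gt0 ?pi_gt0// powR_gt0. Qed.

Let C1_gt0 : 0 < C1.
Proof. by rewrite divr_gt0// mulr_gt0 ?powR_gt0// Gamma_gt0//; lra. Qed.

Let C2_gt0 : 0 < C2.
Proof. by rewrite divr_gt0// mulr_gt0 ?powR_gt0// Gamma_gt0//; lra. Qed.

Let s3_gt0 : 0 < s3. Proof. by rewrite sqrtr_gt0. Qed.
Let s3_sqr : s3 ^+ 2 = 3. Proof. by rewrite sqr_sqrtr. Qed.

(** The coordinates of [2 Re ((a + i b) zeta) = 2 kap (a Bi - b Ai)] in the two power-series
    solutions. *)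
Let coords (a b : R) : R * R :=
  (2 * kap * C1 * (s3 * a - b), 2 * kap * C2 * (s3 * a + b)).

Lemma zeta_combination (a b x : R) :
  (((a +i* b) * zeta F E x + (a +i* b)^* * (zeta F E x)^*) = (sol (coords a b) x)%:C)%C.
Proof.
rewrite /zeta -/kap; simpc; rewrite /Ai /Bi -/C1 -/C2 -/s3.
apply/eqP; rewrite eq_complex /=; apply/andP; split; apply/eqP.
  by rewrite /stark_sol /coords /= /stark_f /stark_g /stark_arg /stark_scale div1r mulNr; ring.
ring.
Qed.

Let norm_coords a b :
  (coords a b).1 ^+ 2 + (coords a b).2 ^+ 2 =
  4 * kap ^+ 2 * (C1 ^+ 2 * (s3 * a - b) ^+ 2 + C2 ^+ 2 * (s3 * a + b) ^+ 2).
Proof. by rewrite /coords /=; ring. Qed.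

Let pq a b : (s3 * a - b) ^+ 2 + (s3 * a + b) ^+ 2 = 6 * a ^+ 2 + 2 * b ^+ 2.
Proof. by transitivity (2 * s3 ^+ 2 * a ^+ 2 + 2 * b ^+ 2); [ring|rewrite s3_sqr; ring]. Qed.

(** The map from [alpha] to the coordinates is a fixed invertible linear map, since both Airy
    constants are positive; hence [B] serves all solutions and all intervals. The radius of index
    [n + 1] belongs to the interval from [n] to [n + 1]. *)
Lemma prufer_radius_log : exists B, forall psi c (n : nat), 0 < c.1 ^+ 2 + c.2 ^+ 2 ->
  (forall x, n%:R < x < n.+1%:R -> psi x = sol c x) ->
  `|ln (prufer_radius F E psi n.+1) - 2^-1 * ln (c.1 ^+ 2 + c.2 ^+ 2)| <= B.
Proof.
(* Here [8 = 4 * 2] and [24 = 4 * 6], as [6 a^2 + 2 b^2] lies between 2 and 6 times [a^2 + b^2]. *)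
pose lo := 8 * kap ^+ 2 * Num.min (C1 ^+ 2) (C2 ^+ 2).
pose up := 24 * kap ^+ 2 * Num.max (C1 ^+ 2) (C2 ^+ 2).
have m0 : 0 < Num.min (C1 ^+ 2) (C2 ^+ 2) by rewrite lt_min !exprn_gt0.
have M0 : 0 < Num.max (C1 ^+ 2) (C2 ^+ 2) by rewrite lt_max !exprn_gt0.
exists (ln 2 + 2^-1 * (`|ln lo| + `|ln up|)) => psi c n c0 psiE.
have [al alE Pal] : exists2 al, al = prufer_alpha F E psi n.+1 & forall x, n%:R < x < n.+1%:R ->
    ((psi x)%:C = al * zeta F E x + al^* * (zeta F E x)^*)%C.
  exists (prufer_alpha F E psi n.+1) => //.
  (* The choice behind [prufer_alpha] defaults to 0 on an empty set; inverting [coords] explicitly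
     shows that the set is inhabited. *)
  have ne : exists al : R[i], forall x, n.+1%:R - 1 < x < n.+1%:R ->
      ((psi x)%:C = al * zeta F E x + al^* * (zeta F E x)^*)%C.
    pose p := c.1 / (2 * kap * C1); pose q := c.2 / (2 * kap * C2).
    exists ((p + q) / (2 * s3) +i* ((q - p) / 2))%C => x.
    rewrite -[n.+1%:R]natr1 addrK natr1 => /psiE ->.
    rewrite zeta_combination; congr (_%:C)%C; congr (stark_sol F E _ x).
    rewrite [c]surjective_pairing /coords /p /q /=.
    by congr pair; field; rewrite !gt_eqF.
  move: (xgetPex 0 ne); rewrite -/(prufer_alpha F E psi n.+1) => h x.
  by have := h x; rewrite -[n.+1%:R]natr1 addrK natr1.
rewrite /prufer_radius -alE; case: al alE Pal => a b alE Pal /=.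
have cE : c = coords a b.
  apply: (@stark_sol_unique _ _ n%:R n.+1%:R); first by rewrite ltr_nat.
  move=> x xn; rewrite -psiE//; have := Pal x xn; rewrite zeta_combination.
  by move=> [].
pose N := a ^+ 2 + b ^+ 2.
have k4 : 0 <= 4 * kap ^+ 2 by apply: mulr_ge0 => //; exact: sqr_ge0.
have cl : lo * N <= c.1 ^+ 2 + c.2 ^+ 2.
  rewrite cE norm_coords /lo.
  have -> : 8 * kap ^+ 2 * Num.min (C1 ^+ 2) (C2 ^+ 2) * N =
     4 * kap ^+ 2 * (Num.min (C1 ^+ 2) (C2 ^+ 2) * (2 * N)) by ring.
  apply: (ler_wpM2l k4).
  have h1 : Num.min (C1 ^+ 2) (C2 ^+ 2) <= C1 ^+ 2 by rewrite ge_min lexx.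
  have h2 : Num.min (C1 ^+ 2) (C2 ^+ 2) <= C2 ^+ 2 by rewrite ge_min lexx orbT.
  apply: (@le_trans _ _ (Num.min (C1 ^+ 2) (C2 ^+ 2) * ((s3 * a - b) ^+ 2 + (s3 * a + b) ^+ 2))).
    rewrite ler_wpM2l ?(ltW m0)// pq /N; have := sqr_ge0 a; lra.
  by rewrite mulrDr lerD// ler_wpM2r// sqr_ge0.
have cu : c.1 ^+ 2 + c.2 ^+ 2 <= up * N.
  rewrite cE norm_coords /up.
  have -> : 24 * kap ^+ 2 * Num.max (C1 ^+ 2) (C2 ^+ 2) * N =
     4 * kap ^+ 2 * (Num.max (C1 ^+ 2) (C2 ^+ 2) * (6 * N)) by ring.
  apply: (ler_wpM2l k4).
  have h1 : C1 ^+ 2 <= Num.max (C1 ^+ 2) (C2 ^+ 2) by rewrite le_max lexx.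
  have h2 : C2 ^+ 2 <= Num.max (C1 ^+ 2) (C2 ^+ 2) by rewrite le_max lexx orbT.
  apply: (@le_trans _ _ (Num.max (C1 ^+ 2) (C2 ^+ 2) * ((s3 * a - b) ^+ 2 + (s3 * a + b) ^+ 2))).
    by rewrite mulrDr lerD// ler_wpM2r// sqr_ge0.
  rewrite ler_wpM2l ?(ltW M0)// pq /N; have := sqr_ge0 b; lra.
have up0 : 0 < up by rewrite !mulr_gt0// exprn_gt0.
have lo0 : 0 < lo by rewrite !mulr_gt0// exprn_gt0.
have N0 : 0 < N by have := lt_le_trans c0 cu; rewrite pmulr_rgt0.
have h := ln_comparable lo0 up0 N0 c0 cl cu.
have sN : 0 < Num.sqrt N by rewrite sqrtr_gt0.
have lnN : ln N = 2 * ln (Num.sqrt N).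
  by rewrite -{1}(sqr_sqrtr (ltW N0)) lnXn// mulr_natl.
rewrite -/N lnM ?posrE//.
have -> : ln 2 + ln (Num.sqrt N) - 2^-1 * ln (c.1 ^+ 2 + c.2 ^+ 2) =
   ln 2 - 2^-1 * (ln (c.1 ^+ 2 + c.2 ^+ 2) - ln N) by rewrite lnN; field.
have l2 : 0 <= ln 2 :> R by apply: ln_ge0; rewrite ler1n.
apply: (le_trans (ler_normB _ _)); rewrite (ger0_norm l2) (normrM 2^-1).
by rewrite (@ger0_norm _ 2^-1)// lerD2l ler_wpM2l.
Qed.

End PruferRadius.

(** * The limit along one realization *)

Section DeterministicLimit.
Variable R : realType.
Variables (F E lam th0 : R).
Hypothesis F0 : 0 < F.
Local Notation bq := (bq F E).
Local Notation bw := (bw F E).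
Local Notation wt := (wt F E).

Definition site_value (h : nat -> R) k := stark_sol F E (stark_coef F E th0 h k) k.+1%:R.
Definition site_slope (h : nat -> R) k := stark_sol' F E (stark_coef F E th0 h k) k.+1%:R.
Definition site_cos (h : nat -> R) k := osc_cos (bq k) (site_value h k) (site_slope h k).
Definition site_sin (h : nat -> R) k := osc_sin (bq k) (site_value h k) (site_slope h k).
Definition site_drift (h : nat -> R) k := (1 + site_cos h k - site_sin h k ^+ 2) / 2.

Lemma site_gt0 h k : 0 < site_value h k ^+ 2 + site_slope h k ^+ 2.
Proof. by apply: stark_sol_gt0 => //; exact: stark_coef_gt0. Qed.

(** A chain of comparisons with errors [o(ln n)]: from the radius of index [n + 1] to the squared
    norm of the coordinates, to the site energy, to its growth. Randomness can enter only through
    the asymptotic hypotheses. *)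
Lemma prufer_radius_limit (g : nat -> R) (psi : R -> R) (h := fun k => g k.+1) :
  is_gen_eigen_solution F E th0 g psi ->
  (fun k => h k / bw k) @ \oo --> 0 ->
  olog (fun n => \sum_(0 <= k < n) site_sin h k * (h k / bw k)) ->
  olog (fun n => \sum_(0 <= k < n) site_drift h k * ((h k ^+ 2 - lam ^+ 2) * wt k)) ->
  olog (fun n => \sum_(0 <= k < n) (h k ^+ 2 - lam ^+ 2) * wt k) ->
  (fun n : nat => ln (prufer_radius F E psi n) / ln n%:R) @ \oo --> lam ^+ 2 / (8 * F).
Proof.
move=> psiP gam0 m1 m2 m3.
pose c := stark_coef F E th0 h.
have c0 k : 0 < (c k).1 ^+ 2 + (c k).2 ^+ 2 by exact: stark_coef_gt0.
have free k : exists U V : R -> R, [/\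
    forall x : R, is_derive x 1 U (V x),
    forall x : R, is_derive x 1 V (- (F * x + E) * U x),
    forall x, 0 < U x ^+ 2 + V x ^+ 2,
    U k.+1%:R = site_value h k /\ V k.+1%:R = site_slope h k + h k * site_value h k &
    U k.+2%:R = site_value h k.+1 /\ V k.+2%:R = site_slope h k.+1].
  exists (stark_sol F E (c k.+1)), (stark_sol' F E (c k.+1)).
  split=> [x|x|x||]; first exact: is_derive_stark_sol.
  - exact: is_derive_stark_sol'.
  - exact: stark_sol_gt0.
  - exact: (stark_dataE E F0 (site_value h k) (site_slope h k + h k * site_value h k) k.+1%:R).
  - by split; reflexivity.
have growth := log_energy_growth F0 (site_gt0 h) free gam0 m1 m2 m3.
have cmp := site_energy_olog E F0 c0.
have [B HB] := prufer_radius_log E F0.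
have HB' n : `|ln (prufer_radius F E psi n.+1) - 2^-1 * ln ((c n).1 ^+ 2 + (c n).2 ^+ 2)| <= B.
  by apply: HB => // x xn; exact: (gen_eigen_solution_stark F0 psiP).
have o1 : olog (fun n => ln (prufer_radius F E psi n.+1) - 2^-1 * ln ((c n).1 ^+ 2 + (c n).2 ^+ 2)).
  by apply: (@olog_bounded _ _ B); near=> n; exact: HB'.
have o2 : olog (fun n => ln (prufer_radius F E psi n.+1) - lam ^+ 2 / (8 * F) * ln n%:R).
  have := ologD o1 (ologM 2^-1 (ologB growth cmp)); congr olog; apply/funext => n.
  by rewrite /site_energy; field; rewrite gt_eqF.
rewrite -cvg_shiftS /=; apply/cvgrPdist_le => e e0.
set L := lam ^+ 2 / (8 * F) in o2 *.
have L0 : 0 <= L by rewrite divr_ge0 ?sqr_ge0// mulr_ge0// ltW.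
have e2 : 0 < e / 2 by rewrite divr_gt0.
have /ologP/(_ _ e2) o3 := o2.
near=> n.
have n0 : (0 < n)%N by near: n; exact: nbhs_infty_gt.
have nn0 : 0 < n%:R :> R by rewrite ltr0n.
have l1 : 1 <= ln n%:R :> R by near: n; exact: near_le_ln.
(* Replacing [ln n] by [ln (n + 1)] costs at most [L], which this makes at most [e / 2] times the
   logarithm. *)
have l2 : L * 2 / e <= ln n%:R :> R by near: n; exact: near_le_ln.
have lnS : ln n%:R <= ln n.+1%:R :> R by rewrite ler_ln ?posrE ?ltr0n// ler_nat.
have lnS1 : ln n.+1%:R <= ln n%:R + 1 :> R.
  rewrite -lerBlDl -ln_div ?posrE ?ltr0n//.
  have -> : n.+1%:R / n%:R = 1 + n%:R^-1 :> R by rewrite -natr1 mulrDl mulfV ?mul1r// gt_eqF.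
  apply: (le_trans (le_ln1Dx _)); first by apply: (@lt_trans _ _ 0) => //; rewrite invr_gt0.
  by rewrite invf_le1// ler1n.
have l0 : 0 < ln n.+1%:R :> R by lra.
have h3 : `|ln (prufer_radius F E psi n.+1) - L * ln n%:R| <= e / 2 * ln n%:R by near: n.
have -> : L - ln (prufer_radius F E psi n.+1) / ln n.+1%:R =
   (L * (ln n.+1%:R - ln n%:R) - (ln (prufer_radius F E psi n.+1) - L * ln n%:R)) / ln n.+1%:R.
  by move: (ln _) l0 => y y0; field; rewrite gt_eqF.
rewrite normrM normfV (gtr0_norm l0) ler_pdivrMr//.
apply: (le_trans (ler_normB _ _)).
rewrite ler_pdivrMr// in l2.
have t1 : `|L * (ln n.+1%:R - ln n%:R)| <= L * 1.
  rewrite normrM (ger0_norm L0) ler_wpM2l// ger0_norm; lra.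
have t2 : e / 2 * ln n%:R <= e / 2 * ln n.+1%:R by rewrite ler_wpM2l// ltW.
have t3 : e * ln n%:R <= e * ln n.+1%:R by rewrite ler_wpM2l// ltW.
apply: (le_trans (lerD t1 h3)); lra.
Unshelve. all: by end_near. Qed.

End DeterministicLimit.

(** * Adaptedness of the phase to the couplings *)

Section Adapted.
Context {d} {T : measurableType d} {R : realType} (P : probability T R).
Variables (h : nat -> {RV P >-> R}) (k : nat).

Lemma adapted_cst (c : R) : adapted h k (fun=> c).
Proof. exact: measurable_cst. Qed.

Lemma adaptedD (X Y : T -> R) : adapted h k X -> adapted h k Y ->
  adapted h k (fun w => X w + Y w).
Proof. exact: measurable_funD. Qed.

Lemma adaptedB (X Y : T -> R) : adapted h k X -> adapted h k Y ->
  adapted h k (fun w => X w - Y w).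
Proof. exact: measurable_funB. Qed.

Lemma adaptedM (X Y : T -> R) : adapted h k X -> adapted h k Y ->
  adapted h k (fun w => X w * Y w).
Proof. exact: measurable_funM. Qed.

Lemma adaptedV (X : T -> R) : (forall w, 0 <= X w) -> adapted h k X ->
  adapted h k (fun w => (X w)^-1).
Proof.
move=> X0 aX; rewrite (_ : (fun w => _) = (fun w => powR (X w) (-1))).
  exact: (measurableT_comp (measurable_powR (-1)) aX).
by apply/funext => w; rewrite powR_inv1.
Qed.

Lemma adapted_osc_energy q (X Y : T -> R) : adapted h k X -> adapted h k Y ->
  adapted h k (fun w => osc_energy q (X w) (Y w)).
Proof.
move=> aX aY; apply: adaptedD; last exact: (adaptedM aY aY).
apply: adaptedM; first exact: adapted_cst.
exact: (adaptedM aX aX).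
Qed.

Lemma adapted_osc_cos q (X Y : T -> R) : 0 <= q -> adapted h k X -> adapted h k Y ->
  adapted h k (fun w => osc_cos q (X w) (Y w)).
Proof.
move=> q0 aX aY; apply: adaptedM.
  apply: adaptedB; last exact: (adaptedM aY aY).
  by apply: adaptedM; [exact: adapted_cst|exact: (adaptedM aX aX)].
apply: adaptedV; last exact: adapted_osc_energy.
by move=> w; rewrite /osc_energy addr_ge0 ?sqr_ge0// mulr_ge0 ?sqr_ge0.
Qed.

Lemma adapted_osc_sin q (X Y : T -> R) : 0 <= q -> adapted h k X -> adapted h k Y ->
  adapted h k (fun w => osc_sin q (X w) (Y w)).
Proof.
move=> q0 aX aY; apply: adaptedM.
  by apply: adaptedM => //; apply: adaptedM => //; exact: adapted_cst.
apply: adaptedV; last exact: adapted_osc_energy.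
by move=> w; rewrite /osc_energy addr_ge0 ?sqr_ge0// mulr_ge0 ?sqr_ge0.
Qed.

End Adapted.

Section AdaptedCoefficients.
Context {d} {T : measurableType d} {R : realType} (P : probability T R).
Variable h : nat -> {RV P >-> R}.
Variables (F E th0 : R).
Local Notation hw w := (fun j => h j w).

Lemma adapted_stark_lin k (f g : R) (c : T -> R * R) :
  adapted h k (fun w => (c w).1) -> adapted h k (fun w => (c w).2) ->
  adapted h k (fun w => (c w).1 * f + (c w).2 * g).
Proof.
by move=> a1 a2; apply: adaptedD; apply: adaptedM => //; exact: adapted_cst.
Qed.

(** The coupling [h k] first enters at level [k + 1]; the data before the kick at the site [k + 1]
    therefore belong to its past. *)
Lemma adapted_stark_coef k :
  adapted h k (fun w => (stark_coef F E th0 (hw w) k).1) /\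
  adapted h k (fun w => (stark_coef F E th0 (hw w) k).2).
Proof.
elim: k => [|k [a1 a2]]; first by split; exact: adapted_cst.
have {}a1 := adapted_le (leqnSn k) a1; have {}a2 := adapted_le (leqnSn k) a2.
pose u w := stark_sol F E (stark_coef F E th0 (hw w) k) k.+1%:R.
pose v w := stark_sol' F E (stark_coef F E th0 (hw w) k) k.+1%:R.
have au : adapted h k.+1 u by exact: adapted_stark_lin.
have av : adapted h k.+1 v by exact: adapted_stark_lin.
have ah : adapted h k.+1 (h k) by exact: adapted_coord.
have av' : adapted h k.+1 (fun w => v w + h k w * u w).
  by apply: adaptedD => //; exact: adaptedM.
have cM (X : T -> R) (x : R) : adapted h k.+1 X -> adapted h k.+1 (fun w => X w * x).
  by move=> aX; apply: adaptedM => //; exact: adapted_cst.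
have cMl (X : T -> R) (x : R) : adapted h k.+1 X -> adapted h k.+1 (fun w => x * X w).
  by move=> aX; apply: adaptedM => //; exact: adapted_cst.
have aN (X : T -> R) : adapted h k.+1 X -> adapted h k.+1 (fun w => - X w).
  by move=> aX; rewrite (_ : (fun w => - X w) = (fun w => -1 * X w));
    [exact: cMl|apply/funext => w; rewrite mulN1r].
split; apply: (cM (fun w => - _)); apply: aN; apply: adaptedB.
- exact: (cM u).
- exact: (cM (fun w => v w + h k w * u w)).
- exact: (cMl (fun w => v w + h k w * u w)).
- exact: (cMl u).
Qed.

Lemma adapted_site k :
  adapted h k (fun w => site_cos F E th0 (hw w) k) /\
  adapted h k (fun w => site_sin F E th0 (hw w) k).
Proof.
have [a1 a2] := adapted_stark_coef k; have q0 := ltW (bq_gt0 F E k).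
by split; [apply: adapted_osc_cos|apply: adapted_osc_sin] => //; exact: adapted_stark_lin.
Qed.

End AdaptedCoefficients.

(** * Moments of the couplings and of their centred squares *)

Section Moments.
Context {d} {T : measurableType d} {R : realType} (P : probability T R).
Implicit Types X Y : T -> R.

Lemma sqint_of_moment X : measurable_fun setT X ->
  ('E_P[fun w => (X w ^+ 2)%R] < +oo)%E -> sqint P X.
Proof.
move=> mX h; split => //; apply/integrableP; split.
  by apply/measurable_EFinP; exact: measurable_funX.
move: h; rewrite unlock; apply: le_lt_trans.
by under eq_integral do rewrite /= ger0_norm ?sqr_ge0//.
Qed.

Lemma sqint_scale (c : R) X : sqint P X -> sqint P (fun w => X w * c).
Proof.
move=> [mX iX]; split; first by apply: measurable_funM => //; exact: measurable_cst.
rewrite (_ : (fun w => _) = (fun w => (c ^+ 2)%:E * (X w ^+ 2)%:E)%E).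
  exact: integrableZl.
by apply/funext => w; rewrite -EFinM exprMn mulrC.
Qed.

Lemma Lfun1_sqr X : sqint P X -> (fun w => X w ^+ 2) \in Lfun P 1.
Proof. by move=> [_ iX]; apply/Lfun1_integrable. Qed.

Lemma Lfun1_cst (c : R) : (fun=> c) \in Lfun P 1.
Proof. exact: sqint_Lfun1 (sqint_cst P c). Qed.

End Moments.

Section SquaredCoupling.
Context {d} {T : measurableType d} {R : realType} (P : probability T R).
Variables (X : {RV P >-> R}) (lam m4 c : R).
Hypothesis X2 : ('E_P[fun w => (X w ^+ 2)%R] = (lam ^+ 2)%:E)%E.
Hypothesis X4 : ('E_P[fun w => (X w ^+ 4)%R] = m4%:E)%E.

Lemma sqint_coupling : sqint P X.
Proof. by apply: sqint_of_moment => //; rewrite X2 ltry. Qed.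

Lemma sqint_coupling_sqr : sqint P (fun w => X w ^+ 2).
Proof.
apply: sqint_of_moment; first exact: measurable_funX.
rewrite (_ : (fun w => _) = (fun w => X w ^+ 4)) ?X4 ?ltry//.
by apply/funext => w; rewrite -exprM.
Qed.

Lemma expectation_centered_sqr : ('E_P[fun w => ((X w ^+ 2 - lam ^+ 2) * c)%R] = 0)%E.
Proof.
have h := Lfun1_sqr sqint_coupling.
have -> : (fun w => (X w ^+ 2 - lam ^+ 2) * c) =
    c \o* ((fun w => X w ^+ 2) \- cst (lam ^+ 2)) by apply/funext => w.
rewrite expectationZl; last by apply: rpredB => //; exact: Lfun1_cst.
rewrite expectationB//; last exact: Lfun1_cst.
by rewrite X2 expectation_cst subee// mule0.
Qed.

Lemma sqint_centered_sqr : sqint P (fun w => (X w ^+ 2 - lam ^+ 2) * c).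
Proof.
apply: sqint_scale; exact: (sqint_add sqint_coupling_sqr (sqint_cst P (- lam ^+ 2))).
Qed.

Lemma expectation_centered_sqr_le :
  ('E_P[fun w => (((X w ^+ 2 - lam ^+ 2) * c) ^+ 2)%R] <= ((m4 + lam ^+ 4) * c ^+ 2)%:E)%E.
Proof.
have h4 : (fun w => X w ^+ 4) \in Lfun P 1.
  have := Lfun1_sqr sqint_coupling_sqr.
  by rewrite (_ : (fun w => (X w ^+ 2) ^+ 2) = (fun w => X w ^+ 4))//; apply/funext => w; rewrite -exprM.
have -> : (((m4 + lam ^+ 4) * c ^+ 2)%R%:E =
    'E_P[((c ^+ 2) \o* ((fun w => X w ^+ 4) \+ cst (lam ^+ 4)))%R])%E.
  rewrite expectationZl; last by apply: rpredD => //; exact: Lfun1_cst.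
  rewrite expectationD//; last exact: Lfun1_cst.
  by rewrite X4 expectation_cst -EFinD -EFinM mulrC.
have mX : measurable_fun setT X by [].
have l4 : 0 <= lam ^+ 4 by exact: exprn_even_ge0.
have x4 w : 0 <= X w ^+ 4 by exact: exprn_even_ge0.
apply: expectation_le.
- by apply: measurable_funX; exact: sqint_centered_sqr.1.
- apply: measurable_funM; last exact: measurable_cst.
  by apply: measurable_funD; [exact: measurable_funX|exact: measurable_cst].
- by move=> w; exact: sqr_ge0.
- by move=> w /=; rewrite mulr_ge0 ?sqr_ge0// addr_ge0.
(* The cross term [- 2 lam^2 X^2] of the square is nonpositive and is dropped. *)
- apply: aeW => w /=; rewrite exprMn ler_wpM2r ?sqr_ge0//.
  have : 0 <= X w ^+ 2 * lam ^+ 2 by rewrite mulr_ge0 ?sqr_ge0.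
  have -> : (X w ^+ 2 - lam ^+ 2) ^+ 2 = X w ^+ 4 + lam ^+ 4 - 2 * (X w ^+ 2 * lam ^+ 2) by ring.
  by lra.
Qed.

End SquaredCoupling.

(** * The almost sure limits *)

Section AlmostSureLimits.
Context {d} {T : measurableType d} {R : realType} (P : probability T R).
Variables (h : nat -> {RV P >-> R}) (F E lam th0 : R) (m4 : nat -> R) (M : R).
Hypothesis F0 : 0 < F.
Hypothesis hind : forall (k : nat) (B : nat -> set R), (forall i, measurable (B i)) ->
  (P (\big[setI/setT]_(i <- iota 0 k.+1) (h i @^-1` B i)) =
  P (\big[setI/setT]_(i <- iota 0 k) (h i @^-1` B i)) * P (h k @^-1` B k))%E.
Hypothesis h1 : forall k, ('E_P[h k] = 0)%E.
Hypothesis h2 : forall k, ('E_P[fun w => (h k w ^+ 2)%R] = (lam ^+ 2)%:E)%E.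
Hypothesis h4 : forall k, ('E_P[fun w => (h k w ^+ 4)%R] = (m4 k)%:E)%E.
Hypothesis m4_sum : forall n, \sum_(0 <= k < n) m4 k / k.+1%:R ^+ 2 <= M.
Local Notation bq := (bq F E).
Local Notation bw := (bw F E).
Local Notation wt := (wt F E).
Local Notation hw w := (fun j => h j w).

Let C := (1 + `|E|) / F.
Let C0 : 0 <= C. Proof. by rewrite divr_ge0 ?(ltW F0)// addr_ge0. Qed.

Let m4_ge0 k : 0 <= m4 k.
Proof.
rewrite -lee_fin -h4; apply: expectation_ge0 => w.
exact: exprn_even_ge0.
Qed.

Lemma sin_predictable : predictable h (fun k w => site_sin F E th0 (hw w) k).
Proof.
split=> k; first by have [] := adapted_site h F E th0 k.
by move=> w; apply: osc_sin_le1; [exact: bq_gt0|exact: site_gt0].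
Qed.

Lemma drift_predictable : predictable h (fun k w => site_drift F E th0 (hw w) k).
Proof.
split=> k.
  have [a1 a2] := adapted_site h F E th0 k.
  apply: adaptedM; last exact: adapted_cst.
  apply: adaptedB; last exact: (adaptedM a2 a2).
  by apply: adaptedD => //; exact: adapted_cst.
move=> w; rewrite /site_drift.
have e : site_cos F E th0 (hw w) k ^+ 2 + site_sin F E th0 (hw w) k ^+ 2 = 1.
  by apply: osc_cos2Dsin2; [exact: bq_gt0|exact: site_gt0].
have := osc_cos_le1 (bq_gt0 F E k) (site_gt0 E th0 F0 (hw w) k).
rewrite -/(site_cos F E th0 (hw w) k) !ler_norml => /andP[c1 c2].
have s2 := sqr_ge0 (site_sin F E th0 (hw w) k); have c3 := sqr_ge0 (site_cos F E th0 (hw w) k).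
(* With [sin^2 = 1 - cos^2] the drift factor is [(cos + cos^2) / 2], which lies within the unit
   bound required of a predictable factor. *)
by apply/andP; split; lra.
Qed.

Lemma one_predictable : predictable h (fun k w => 1).
Proof. by split=> k; [exact: adapted_cst|move=> w; rewrite normr1]. Qed.

Lemma linear_martingale_olog : {ae P, forall w,
  olog (fun n => \sum_(0 <= k < n) site_sin F E th0 (hw w) k * (h k w / bw k))}.
Proof.
have s k : sqint P (h k) by exact: sqint_coupling (h2 k).
apply: (@mart_olog _ _ _ P h hind (fun k x => x / bw k) (fun k => lam ^+ 2 * wt k)
  _ _ _ _ _ (lam ^+ 2 * C) sin_predictable).
- by move=> k; apply: measurable_funM; [exact: measurable_id|exact: measurable_cst].
- by move=> k; exact: sqint_scale.
- move=> k; rewrite (_ : _ \o _ = (bw k)^-1 \o* h k)//.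
  by rewrite expectationZl ?h1 ?mule0//; exact: sqint_Lfun1.
- move=> k; rewrite (_ : (fun w => _) = (bw k)^-1 ^+ 2 \o* (fun w => h k w ^+ 2)); last first.
    by apply/funext => w; rewrite /= exprMn.
  by rewrite expectationZl ?h2 -?EFinM -?wt_bw 1?mulrC//; exact: Lfun1_sqr.
- by rewrite mulr_ge0 ?sqr_ge0.
- move=> n n0; rewrite -mulr_sumr -mulrA ler_wpM2l ?sqr_ge0//; exact: wt_sum_all.
Qed.

(** The variance splits in two: [m4 k * wt k ^+ 2] is at most [C^2 m4 k / (k + 1)^2], with bounded
    sums by (iii), and [lam^4 wt^2 <= lam^4 wt] has logarithmic sums. *)
Lemma quadratic_martingale_olog (V : nat -> T -> R) : predictable h V -> {ae P, forall w,
  olog (fun n => \sum_(0 <= k < n) V k w * ((h k w ^+ 2 - lam ^+ 2) * wt k))}.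
Proof.
move=> pV.
apply: (@mart_olog _ _ _ P h hind (fun k x => (x ^+ 2 - lam ^+ 2) * wt k)
  (fun k => (m4 k + lam ^+ 4) * wt k ^+ 2) _ _ _ _ _ (C ^+ 2 * `|M| + lam ^+ 4 * C) pV).
- move=> k; apply: measurable_funM; last exact: measurable_cst.
  by apply: measurable_funB; [exact: measurable_funX|exact: measurable_cst].
- by move=> k; exact: (sqint_centered_sqr lam (wt k) (h4 k)).
- by move=> k; exact: (expectation_centered_sqr (wt k) (h2 k)).
- by move=> k; exact: (expectation_centered_sqr_le lam (wt k) (h4 k)).
- by apply: addr_ge0; apply: mulr_ge0 => //; [exact: sqr_ge0|exact: exprn_even_ge0].
- move=> n n0.
  have l4 : 0 <= lam ^+ 4 by exact: exprn_even_ge0.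
  have ln0 : 0 <= ln n%:R :> R by apply: ln_ge0; rewrite ler1n.
  apply: (@le_trans _ _ (\sum_(0 <= k < n) (C ^+ 2 * (m4 k / k.+1%:R ^+ 2) + lam ^+ 4 * wt k))).
    apply: ler_sum => k _; rewrite mulrDl; apply: lerD.
      have -> : C ^+ 2 * (m4 k / k.+1%:R ^+ 2) = m4 k * (C * k.+1%:R^-1) ^+ 2.
        by rewrite [in RHS]exprMn exprVn mulrCA mulrA.
      rewrite ler_wpM2l// lerXn2r ?nnegrE ?wt_ge0//; last exact: wt_le_harmonic.
      by rewrite mulr_ge0.
    by rewrite ler_wpM2l// expr2 ler_piMl ?wt_ge0 ?wt_le1.
  rewrite big_split /= -!mulr_sumr mulrDl; apply: lerD.
    apply: (@le_trans _ _ (C ^+ 2 * `|M|)).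
      by rewrite ler_wpM2l ?sqr_ge0// (le_trans (m4_sum n))// ler_norm.
    by rewrite ler_peMr ?lerDl//; exact: mulr_ge0 (sqr_ge0 C) (normr_ge0 M).
  by rewrite -mulrA ler_wpM2l//; exact: wt_sum_all.
Qed.

End AlmostSureLimits.

(** * Transfer of the hypotheses to couplings indexed from zero *)

Section Shifts.
Context {d} {T : measurableType d} {R : realType} (P : probability T R).

Lemma indep_shift (g : nat -> {RV P >-> R}) :
  mutually_independent_pos P (fun n => g n : T -> R) ->
  forall (k : nat) (B : nat -> set R), (forall i, measurable (B i)) ->
  (P (\big[setI/setT]_(i <- iota 0 k.+1) (g i.+1 @^-1` B i)) =
   P (\big[setI/setT]_(i <- iota 0 k) (g i.+1 @^-1` B i)) * P (g k.+1 @^-1` B k))%E.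
Proof.
move=> ind k B mB.
have prodE n : (P (\big[setI/setT]_(i <- iota 0 n) (g i.+1 @^-1` B i)) =
    \prod_(i <- iota 0 n) P (g i.+1 @^-1` B i))%E.
  have := ind (map S (iota 0 n)) (fun i => B i.-1) _ _ (fun i => mB i.-1).
  rewrite !big_map; apply; first by rewrite (map_inj_uniq succn_inj) iota_uniq.
  by apply/allP => i /mapP[j _ ->].
have e : iota 0 k.+1 = iota 0 k ++ [:: k] by rewrite -addn1 iotaD add0n.
by rewrite !prodE e big_cat /= big_seq1.
Qed.

(** A finite sum of nonnegative terms with positive weights has finite terms, so each fourth moment
    is a real number. *)
Lemma fourth_moments (g : nat -> {RV P >-> R}) :
  (\sum_(1 <= n <oo) ('E_P[fun w => (g n w ^+ 4)%R] * ((n%:R : R) ^- 2)%R%:E) < +oo)%E ->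
  exists m4 : nat -> R, exists2 M : R,
    forall k, ('E_P[fun w => (g k.+1 w ^+ 4)%R] = (m4 k)%:E)%E &
    forall n, \sum_(0 <= k < n) m4 k / k.+1%:R ^+ 2 <= M.
Proof.
move=> sum4.
have e0 n : (0 <= 'E_P[fun w => (g n w ^+ 4)%R])%E.
  by apply: expectation_ge0 => w; exact: exprn_even_ge0.
have t0 n : (0 <= 'E_P[fun w => (g n w ^+ 4)%R] * ((n%:R : R) ^- 2)%R%:E)%E.
  by rewrite mule_ge0// lee_fin invr_ge0 sqr_ge0.
pose tot := (\sum_(1 <= n <oo) ('E_P[fun w => (g n w ^+ 4)%R] * ((n%:R : R) ^- 2)%R%:E))%E.
have tot0 : (0 <= tot)%E by exact: nneseries_ge0.
have totfin : tot \is a fin_num by rewrite ge0_fin_numE.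
have part k : (\sum_(1 <= n < k.+1) ('E_P[fun w => (g n w ^+ 4)%R] * ((n%:R : R) ^- 2)%R%:E) <= tot)%E.
  by apply: nneseries_lim_ge => n _ _.
have fin k : ('E_P[fun w => (g k.+1 w ^+ 4)%R])%E \is a fin_num.
  rewrite ge0_fin_numE//; apply: contraLR (part k.+1).
  rewrite -leNgt leye_eq => /eqP oo; rewrite -ltNge big_nat_recr//= oo.
  rewrite gt0_mulye; last by rewrite lte_fin invr_gt0 exprn_gt0.
  rewrite addey ?ltNye_eq; first by rewrite ltey_eq totfin.
  by rewrite gt_eqF// (lt_le_trans (ltNyr 0))// sume_ge0.
exists (fun k => fine ('E_P[fun w => (g k.+1 w ^+ 4)%R])%E), (fine tot).
  by move=> k; rewrite fineK.
move=> n; rewrite -lee_fin fineK//; apply: le_trans (part n).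
rewrite big_add1 /= -sumEFin; apply: lee_sum => k _.
by rewrite EFinM fineK.
Qed.

(** With [z = (k + 1)^(-1/4) <= 1], [1 / b_k^2 <= C z^4 <= C z^2 <= (1 + C)^2 z^2], so [1 / b_k] is
    at most a constant times [z]. *)
Lemma coupling_over_frequency (F E : R) (g : nat -> R) : 0 < F ->
  (fun n : nat => g n * powR n%:R (- (1 / 4))) @ \oo --> 0 ->
  (fun k => g k.+1 / bw F E k) @ \oo --> 0.
Proof.
move=> F0 g0; pose C := (1 + `|E|) / F.
have C0 : 0 <= C by rewrite divr_ge0 ?(ltW F0)// addr_ge0.
have g1 : (fun k : nat => g k.+1 * powR k.+1%:R (- (1 / 4))) @ \oo --> 0.
  by have := g0; rewrite -cvg_shiftS.
have g2 : (fun k : nat => (1 + C) * `|g k.+1 * powR k.+1%:R (- (1 / 4))| +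
    0 * `|g k.+1 * powR k.+1%:R (- (1 / 4))|) @ \oo --> 0.
  by apply: null_comb; exact: null_norm.
apply: (null_le g2); exists 0%N => k _; rewrite mul0r addr0.
set z := powR _ _.
have k1 : 1 <= k.+1%:R :> R by rewrite ler1n.
have z0 : 0 < z by apply: powR_gt0; rewrite ltr0n.
have z1 : z <= 1.
  by rewrite -[leRHS](powRr0 (k.+1%:R : R)); apply: ler_powR => //; lra.
have z4 : z ^+ 4 = k.+1%:R^-1.
  rewrite /z -powR_mulrn ?powR_ge0// -powRrM (_ : - (1 / 4) * 4%:R = -1); last by field.
  by rewrite powR_inv1// ler0n.
have b0 := bw_gt0 F E k.
rewrite normrM [`|g k.+1 * z|]normrM (gtr0_norm z0) normfV (gtr0_norm b0).
rewrite mulrCA ler_wpM2l//.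
rewrite -(@ler_pXn2r _ 2) ?nnegrE ?invr_ge0 ?(ltW b0)//; last first.
  by rewrite mulr_ge0 ?(ltW z0)//; lra.
rewrite -wt_bw; apply: (le_trans (wt_le_harmonic E F0 k)).
rewrite -/C -z4 exprMn.
have z2 : z ^+ 2 <= 1 by rewrite expr_le1// ltW.
have h1 : z ^+ 4 <= z ^+ 2.
  by rewrite (_ : 4 = 2 + 2)%N// exprD ler_piMl ?sqr_ge0.
apply: (@le_trans _ _ (C * z ^+ 2)); first by rewrite ler_wpM2l.
by rewrite ler_wpM2r ?sqr_ge0//; have := sqr_ge0 C; rewrite sqrrD; lra.
Qed.

End Shifts.

Theorem theorem4p4 (d : measure_display) (T : measurableType d) (R : realType)
  (P : probability T R) (g : nat -> {RV P >-> R}) (lam F E th0 : R) :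
  lam != 0 ->
  mutually_independent_pos P (fun n => g n : T -> R) ->
  (forall n : nat, (0 < n)%N -> ('E_P[g n] = 0)%E) ->
  (forall n : nat, (0 < n)%N -> ('E_P[fun w => (g n w ^+ 2)%R] = (lam ^+ 2)%R%:E)%E) ->
  (\sum_(1 <= n <oo) ('E_P[fun w => (g n w ^+ 4)%R] * ((n%:R : R) ^- 2)%R%:E) < +oo)%E ->
  {ae P, forall w, (fun n : nat => g n w * powR n%:R (- (1 / 4))) @ \oo --> 0} ->
  0 < F -> 0 <= th0 -> th0 < pi ->
  {ae P, forall w, forall psi : R -> R,
      is_gen_eigen_solution F E th0 (fun n => g n w) psi ->
      (fun n : nat => ln (prufer_radius F E psi n) / ln n%:R) @ \oo
        --> lam ^+ 2 / (8 * F)}.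
Proof.
move=> _ ind mean var sum4 small F0 _ _.
pose h k := g k.+1.
have hind := indep_shift ind.
have [m4 [M h4 m4_sum]] := fourth_moments sum4.
have h1 k : ('E_P[h k] = 0)%E by exact: mean.
have h2 k : ('E_P[fun w => (h k w ^+ 2)%R] = (lam ^+ 2)%:E)%E by exact: var.
have a1 := linear_martingale_olog E th0 F0 hind h1 h2.
have a2 := quadratic_martingale_olog E F0 hind h2 h4 m4_sum (drift_predictable h E th0 F0).
have a3 := quadratic_martingale_olog E F0 hind h2 h4 m4_sum (one_predictable h).
(* The full-measure event is fixed before [psi]: on it the deterministic limit holds for every
   solution at once. *)
apply: filterS (filterI (filterI small a1) (filterI a2 a3)).
move=> w [[s1 s2] [s3 s4]] psi psiP.
apply: (@prufer_radius_limit _ F E lam th0 F0 (fun n => g n w) psi psiP).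
- exact: (@coupling_over_frequency _ F E (fun n => g n w) F0 s1).
- exact: s2.
- exact: s3.
- move: s4; congr olog; apply/funext => n; apply: eq_bigr => k _.
  by rewrite mul1r.
Qed.
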